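(* Let $K$ be an algebraically closed field of characteristic zero and let $H$ be a semisimple Hopf algebra over $K$. If $H$ has a simple module of even dimension over $K$, then the dimension $\dim_K H$ is even.
   Context: A Hopf algebra is semisimple if it is semisimple as an algebra; a semisimple Hopf algebra over a field is automatically finite-dimensional. Modules are left modules. *)

(* Defs.v *)
From HB Require Import structures.
From mathcomp Require Import all_boot all_order all_algebra.
From mathcomp Require Import boolp.

Set Implicit Arguments.
Unset Strict Implicit.
Unset Printing Implicit Defensive.

Import GRing.Theory.
Local Open Scope ring_scope.
Local Open Scope quotient_scope.

Notation bilinear_map b := (bilinear_for *:%R *:%R b).

(* A sequence [:: (u1, v1); ...; (un, vn)] denotes the sum of the ui (x) vi.
   Two such sums are identified when no bilinear map separates them; the
   universal property is given by tlift_linear, tlift_tens and tlift_unique. *)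
Section TensorProduct.
Variables (K : fieldType) (U V : lmodType K).

Definition tsum (W : lmodType K) (b : U -> V -> W) (s : seq (U * V)) : W :=
  \sum_(p <- s) b p.1 p.2.

Definition teq (s t : seq (U * V)) : bool :=
  `[< forall (W : lmodType K) (b : U -> V -> W),
        bilinear_map b -> tsum b s = tsum b t >].

Lemma teq_refl : reflexive teq. Proof. by move=> s; apply/asboolP. Qed.
Lemma teq_sym : symmetric teq.
Proof. by move=> s t; apply/asboolP/asboolP => h W b bb; rewrite h. Qed.
Lemma teq_trans : transitive teq.
Proof.
move=> t s u /asboolP h1 /asboolP h2; apply/asboolP => W b bb.
by rewrite h1 // h2.
Qed.

Canonical teq_equiv := EquivRel teq teq_refl teq_sym teq_trans.

Definition tensor : Type := {eq_quot teq}.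
HB.instance Definition _ : EqQuotient _ teq tensor := EqQuotient.on tensor.
HB.instance Definition _ := Choice.on tensor.

Definition tens (u : U) (v : V) : tensor := \pi_tensor [:: (u, v)].

(* Only meaningful when b is bilinear. *)
Definition tlift (W : lmodType K) (b : U -> V -> W) (x : tensor) : W :=
  tsum b (repr x).

Lemma tlift_pi (W : lmodType K) (b : U -> V -> W) s :
  bilinear_map b -> tlift b (\pi_tensor s) = tsum b s.
Proof.
move=> bb; rewrite /tlift.
have /eqmodP/asboolP h : repr (\pi_tensor s) = s %[mod tensor] by rewrite reprK.
exact: h.
Qed.

Lemma tensorP (x y : tensor) :
  (forall (W : lmodType K) (b : U -> V -> W),
     bilinear_map b -> tlift b x = tlift b y) -> x = y.
Proof.
move=> h; rewrite -[x]reprK -[y]reprK; apply/eqmodP/asboolP => W b bb.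
exact: h.
Qed.

Definition tzero : tensor := \pi_tensor [::].
Definition tadd (x y : tensor) : tensor := \pi_tensor (repr x ++ repr y).
Definition tscale (k : K) (x : tensor) : tensor :=
  \pi_tensor [seq (k *: p.1, p.2) | p <- repr x].
Definition topp (x : tensor) : tensor := tscale (-1) x.

Lemma bilin_scalel (W : lmodType K) (b : U -> V -> W) k u v :
  bilinear_map b -> b (k *: u) v = k *: b u v.
Proof.
move=> [bl _]; have b0 : b 0 v = 0.
  by have /= := bl v 1 0 0; rewrite !scale1r add0r => /eqP;
     rewrite -subr_eq subrr => /eqP.
by have /= := bl v k u 0; rewrite addr0 b0 addr0.
Qed.

Lemma tlift0 (W : lmodType K) (b : U -> V -> W) :
  bilinear_map b -> tlift b tzero = 0.
Proof. by move=> bb; rewrite tlift_pi // /tsum big_nil. Qed.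

Lemma tliftD (W : lmodType K) (b : U -> V -> W) x y :
  bilinear_map b -> tlift b (tadd x y) = tlift b x + tlift b y.
Proof. by move=> bb; rewrite tlift_pi // /tsum big_cat. Qed.

Lemma tliftZ (W : lmodType K) (b : U -> V -> W) k x :
  bilinear_map b -> tlift b (tscale k x) = k *: tlift b x.
Proof.
move=> bb; rewrite tlift_pi // /tsum big_map scaler_sumr.
by apply: eq_bigr => p _; rewrite bilin_scalel.
Qed.

Fact taddA : associative tadd.
Proof. by move=> x y z; apply: tensorP => W b bb; rewrite !tliftD // addrA. Qed.
Fact taddC : commutative tadd.
Proof. by move=> x y; apply: tensorP => W b bb; rewrite !tliftD // addrC. Qed.
Fact tadd0 : left_id tzero tadd.
Proof. by move=> x; apply: tensorP => W b bb; rewrite tliftD // tlift0 // add0r. Qed.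
Fact taddN : left_inverse tzero topp tadd.
Proof.
move=> x; apply: tensorP => W b bb.
by rewrite tliftD // tliftZ // tlift0 // scaleN1r addNr.
Qed.

HB.instance Definition _ := GRing.isZmodule.Build tensor taddA taddC tadd0 taddN.

Fact tscaleA k l x : tscale k (tscale l x) = tscale (k * l) x.
Proof. by apply: tensorP => W b bb; rewrite !tliftZ // scalerA. Qed.
Fact tscale1 : left_id 1 tscale.
Proof. by move=> x; apply: tensorP => W b bb; rewrite tliftZ // scale1r. Qed.
Fact tscaleDr : right_distributive tscale +%R.
Proof.
by move=> k x y; apply: tensorP => W b bb; rewrite !(tliftZ, tliftD) // scalerDr.
Qed.
Fact tscaleDl x : {morph tscale^~ x : k l / k + l}.
Proof.
by move=> k l; apply: tensorP => W b bb; rewrite !(tliftZ, tliftD) // scalerDl.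
Qed.

HB.instance Definition _ :=
  GRing.Zmodule_isLmodule.Build K tensor tscaleA tscale1 tscaleDr tscaleDl.

Lemma tlift_linear (W : lmodType K) (b : U -> V -> W) :
  bilinear_map b -> linear (tlift b).
Proof. by move=> bb k x y; rewrite [LHS]tliftD // tliftZ. Qed.

Lemma tlift_tens (W : lmodType K) (b : U -> V -> W) u v :
  bilinear_map b -> tlift b (tens u v) = b u v.
Proof. by move=> bb; rewrite tlift_pi // /tsum big_seq1. Qed.

Lemma tens_bilinear : bilinear_map tens.
Proof.
by split=> z k x y; apply: tensorP => W b bb;
   rewrite [RHS]tliftD // tliftZ // !tlift_tens //; case: bb => bl br;
   [exact: bl | exact: br].
Qed.

Lemma tensorE (x : tensor) : x = \sum_(p <- repr x) tens p.1 p.2.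
Proof.
apply: tensorP => W b bb; rewrite [LHS]/tlift /tsum.
by elim: (repr x) => [|p s IH];
   rewrite ?big_nil ?big_cons ?tlift0 // [RHS]tliftD // tlift_tens // IH.
Qed.

Lemma tlift_unique (W : lmodType K) (f g : {linear tensor -> W}) :
  (forall u v, f (tens u v) = g (tens u v)) -> f =1 g.
Proof.
move=> fg x; rewrite [x]tensorE !linear_sum.
by apply: eq_bigr => p _; exact: fg.
Qed.

End TensorProduct.

Notation "U ⊗ V" := (tensor U V)
  (at level 40, left associativity) : type_scope.

Section TensorMaps.
Variable K : fieldType.

Definition tmap (U V U' V' : lmodType K) (f : U -> U') (g : V -> V') :
    U ⊗ V -> U' ⊗ V' :=
  tlift (fun u v => tens (f u) (g v)).

Definition tassoc (U V W : lmodType K) : (U ⊗ V) ⊗ W -> U ⊗ (V ⊗ W) :=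
  tlift (fun x w => tlift (fun u v => tens u (tens v w)) x).

Definition tmul (A B : algType K) (x y : A ⊗ B) : A ⊗ B :=
  tlift (fun a b => tlift (fun a' b' => tens (a * a') (b * b')) y) x.

Definition mulmap (A : algType K) : A ⊗ A -> A := tlift (fun a b : A => a * b).

Let tensl (U V : lmodType K) (v : V) : linear (fun u : U => tens u v).
Proof. by case: (tens_bilinear U V) => h _; exact: h. Qed.
Let tensr (U V : lmodType K) (u : U) : linear (fun v : V => tens u v).
Proof. by case: (tens_bilinear U V) => _ h; exact: h. Qed.

Lemma tmapE (U V U' V' : lmodType K) (f : {linear U -> U'})
    (g : {linear V -> V'}) u v :
  tmap f g (tens u v) = tens (f u) (g v).
Proof.
rewrite /tmap tlift_tens //.
by split=> z k x y /=; rewrite linearP ?tensl ?tensr.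
Qed.

Lemma tassocE (U V W : lmodType K) (u : U) (v : V) (w : W) :
  tassoc (tens (tens u v) w) = tens u (tens v w).
Proof.
have bi w' : bilinear_map (fun (u : U) (v : V) => tens u (tens v w')).
  by split=> z k x y /=; rewrite tensl ?tensr.
rewrite /tassoc tlift_tens ?tlift_tens //; split=> [w'|x] k y z /=.
  by rewrite tlift_linear.
rewrite /tlift /tsum scaler_sumr -big_split; apply: eq_bigr => p _ /=.
by rewrite !tensr.
Qed.

Lemma tmulE (A B : algType K) (a a' : A) (b b' : B) :
  tmul (tens a b) (tens a' b') = tens (a * a') (b * b').
Proof.
have bi c d : bilinear_map (fun (a' : A) (b' : B) => tens (c * a') (d * b')).
  by split=> z k x y /=; rewrite mulrDr -scalerAr ?tensl ?tensr.
rewrite /tmul tlift_tens ?tlift_tens //.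
by split=> z k x y /=; rewrite /tlift /tsum scaler_sumr -big_split;
   apply: eq_bigr => p _ /=; rewrite mulrDl -scalerAl ?tensl ?tensr.
Qed.

Lemma mulmapE (A : algType K) (a b : A) : mulmap (tens a b) = a * b.
Proof.
rewrite /mulmap tlift_tens //; split=> z k x y /=.
  by rewrite mulrDl -scalerAl.
by rewrite mulrDr -scalerAr.
Qed.

End TensorMaps.

Record hopf_structure (K : fieldType) (H : algType K) := HopfStructure {
  comul : {linear H -> H ⊗ H};
  counit : {linear H -> K^o};
  antipode : {linear H -> H};
  comul_coassoc : forall h,
    tassoc (tmap comul idfun (comul h)) = tmap idfun comul (comul h);
  comul_counitl : forall h, tlift (fun a b : H => counit a *: b) (comul h) = h;
  comul_counitr : forall h, tlift (fun a b : H => counit b *: a) (comul h) = h;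
  comul1 : comul 1 = tens 1 1;
  comulM : forall g h, comul (g * h) = tmul (comul g) (comul h);
  counit1 : counit 1 = 1;
  counitM : forall g h, counit (g * h) = counit g * counit h;
  antipodel : forall h, mulmap (tmap antipode idfun (comul h)) = (counit h)%:A;
  antipoder : forall h, mulmap (tmap idfun antipode (comul h)) = (counit h)%:A
}.

(* Submodules are boolean predicates; under the classical axioms of boolp every
   subset is of this form. *)
Section Modules.
Variables (R : nzRingType) (M : lmodType R).

Definition simple_module : Prop :=
  (exists x : M, x != 0) /\
  forall S : {pred M}, submod_closed S ->
    (forall x, x \in S -> x = 0) \/ (forall x, x \in S).

Definition semisimple_module : Prop :=
  forall S : {pred M}, submod_closed S ->
  exists T : {pred M},
    [/\ submod_closed T,
        forall x, x \in S -> x \in T -> x = 0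
      & forall x, exists y z, [/\ y \in S, z \in T & x = y + z]].

End Modules.

Definition semisimple_algebra (K : fieldType) (A : algType K) : Prop :=
  semisimple_module (A^o : lmodType A).

Section RestrictionOfScalars.
Variables (K : fieldType) (A : algType K) (M : lmodType A).

Definition restrict_scalars : Type := M.
HB.instance Definition _ := GRing.Zmodule.on restrict_scalars.

Let scale (k : K) (m : restrict_scalars) : restrict_scalars :=
  (k%:A : A) *: (m : M).

Fact restrict_scaleA k l m : scale k (scale l m) = scale (k * l) m.
Proof. by rewrite /scale scalerA -scalerAl mul1r scalerA. Qed.
Fact restrict_scale1 : left_id 1 scale.
Proof. by move=> m; rewrite /scale !scale1r. Qed.
Fact restrict_scaleDr : right_distributive scale +%R.
Proof. by move=> k m n; rewrite /scale scalerDr. Qed.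
Fact restrict_scaleDl m : {morph scale^~ m : k l / k + l}.
Proof. by move=> k l; rewrite /scale !scalerDl. Qed.

HB.instance Definition _ := GRing.Zmodule_isLmodule.Build K restrict_scalars
  restrict_scaleA restrict_scale1 restrict_scaleDr restrict_scaleDl.

End RestrictionOfScalars.

(* Finite-dimensionality is part of the assertion: V is linearly isomorphic to
   the space of row vectors of length n. *)
Definition has_dim (K : fieldType) (V : lmodType K) (n : nat) : Prop :=
  inhabited (Vector.axiom n V).

(* Main.v *)
Require Import Defs.
From HB Require Import structures.
From mathcomp Require Import all_boot all_order all_algebra.
From mathcomp Require Import ring zify.
From mathcomp Require Import boolp classical_sets.

Set Implicit Arguments.
Unset Strict Implicit.
Unset Printing Implicit Defensive.

Import Order.TTheory GRing.Theory Num.Theory.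
Local Open Scope ring_scope.

(** Write n for the dimension of H and suppose that n is odd while M is simple
    of even dimension d.  The contradiction comes from the module End(M), on
    which h acts by X |-> r(S h1) X r(h2) in a matrix representation r of M.
    The trace form tr(XY) is symmetric, invariant and nondegenerate.  So is its
    restriction to the matrices of trace zero, since tr 1 = d is not 0.  These
    matrices form a module of odd dimension d^2 - 1 without invariants: the
    normalized integral L maps X to the scalar matrix tr(X)/d, by Schur's lemma
    ([rep_averaging]).

    Such a module does not exist when n is odd ([no_odd_form]).  Take a simple
    submodule X.  If the form is degenerate on X it vanishes on X, and
    X^perp / X is a smaller module of the same kind and again of odd dimension.
    So the form is nondegenerate on some simple X, and it remains to show that
    n is even if a simple module V with L V = 0 carries a nondegenerate
    symmetric invariant form ([no_selfdual]).

    Consider the twist U : v (x) h |-> h1 v (x) h2 on V (x) H.  Its trace is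
    n tr_V(L) = 0, and the trace of U^2 is n times the Frobenius-Schur indicator
    of V ([twist_parity]), which is 1 by the orthogonality relations
    ([frobenius_schur]).  All eigenvalues of U are roots of unity
    ([twist_eigenvalue]), so (tr U)^2 - tr(U^2), which is twice their second
    elementary symmetric function, is twice an algebraic integer.  Hence n/2 is
    an algebraic integer and n is even ([odd_half_not_integral]).

    That the eigenvalues of U are roots of unity is a determinant argument
    ([eigenvalue_unity]).  On V (x) H (x) H (x) H the operator U commutes with
    operators Phi, Lh, J, R and B that satisfy Lh B U = Phi R.  Here Phi and Lh
    are commutators of operators that commute with U, and B and R are conjugate
    by the involution J to the inverses of Phi and Lh.  On the eigenspace for a,
    the operators Phi, Lh, B and R therefore have determinant 1, hence so has
    U: the power of a by the dimension of this eigenspace is 1.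

    For all this the antipode has to be an involution, which is a theorem of
    Larson and Radford ([antipode_involutive]).  Semisimplicity gives the
    integral L, which makes H a finite dimensional Frobenius algebra with form
    lam; dual bases are given by the coproduct of L.  The number lam(1) is a
    sum over the simple modules of positive multiples of squared absolute
    values of sums of roots of unity, so it is not zero ([lam_one_neq0]).  This
    forces the modular element to be 1, hence S^4 = 1 by Radford's formula.
    The traces of S^2 and of its composite with h |-> h1 chi(h2), where chi is
    the regular character, then leave only S^2 = 1. *)

(** * Linear and bilinear maps, Sweedler sums *)

Section Lin.
Variable K : fieldType.

(** Linearity as a predicate on functions: the summands of a Sweedler sum are
    lambda terms, for which no canonical linear structure is inferred.  The
    tactic [lin] below proves goals of this form. *)
Definition lin (U W : lmodType K) (f : U -> W) : Prop :=
  forall k x y, f (k *: x + y) = k *: f x + f y.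

Definition bil (U V W : lmodType K) (F : U -> V -> W) : Prop :=
  (forall b, lin (fun a => F a b)) /\ (forall a, lin (fun b => F a b)).

Definition mklin (U W : lmodType K) (f : U -> W) (hf : lin f) : {linear U -> W} :=
  HB.pack_for {linear U -> W} f (GRing.isLinear.Build K U W *:%R f hf).

Lemma mklinE (U W : lmodType K) (f : U -> W) (hf : lin f) x : mklin hf x = f x.
Proof. by []. Qed.

Lemma lin_id (U : lmodType K) : lin (fun x : U => x).
Proof. by []. Qed.

Lemma lin_app (U V W : lmodType K) (g : {linear V -> W}) (f : U -> V) :
  lin f -> lin (fun x => g (f x)).
Proof. by move=> hf k x y; rewrite hf linearP. Qed.

Lemma lin_comp (U V W : lmodType K) (g : V -> W) (f : U -> V) :
  lin g -> lin f -> lin (fun x => g (f x)).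
Proof. by move=> hg hf k x y; rewrite hf hg. Qed.

Lemma lin_mull (U : lmodType K) (A : algType K) (f : U -> A) c :
  lin f -> lin (fun x => f x * c).
Proof. by move=> hf k x y; rewrite hf mulrDl scalerAl. Qed.

Lemma lin_mulr (U : lmodType K) (A : algType K) (f : U -> A) c :
  lin f -> lin (fun x => c * f x).
Proof. by move=> hf k x y; rewrite hf mulrDr scalerAr. Qed.

Lemma lin_scalel (U W : lmodType K) (f : U -> K^o) (c : W) :
  lin f -> lin (fun x => f x *: c).
Proof. by move=> hf k x y; rewrite hf scalerDl scalerA. Qed.

Lemma lin_scaler (U W : lmodType K) (f : U -> W) (c : K) :
  lin f -> lin (fun x => c *: f x).
Proof. by move=> hf k x y; rewrite hf scalerDr !scalerA mulrC. Qed.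

Lemma lin_add (U W : lmodType K) (f g : U -> W) :
  lin f -> lin g -> lin (fun x => f x + g x).
Proof. by move=> hf hg k x y; rewrite hf hg scalerDr addrACA. Qed.

Lemma lin_mxl (U : lmodType K) m n p (f : U -> 'M[K]_(m, n)) (A : 'M_(n, p)) :
  lin f -> lin (fun x => f x *m A).
Proof. by move=> hf k x y; rewrite hf mulmxDl scalemxAl. Qed.

Lemma lin_mxr (U : lmodType K) m n p (f : U -> 'M[K]_(m, n)) (A : 'M_(p, m)) :
  lin f -> lin (fun x => A *m f x).
Proof. by move=> hf k x y; rewrite hf mulmxDr scalemxAr. Qed.

Lemma lin_sum (U W : lmodType K) (I : Type) (s : seq I) (F : I -> U -> W) :
  (forall i, lin (F i)) -> lin (fun x => \sum_(i <- s) F i x).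
Proof.
move=> hF k x y; rewrite scaler_sumr -big_split.
by apply: eq_bigr => i _; rewrite hF.
Qed.

Lemma lin_tensl (U V W : lmodType K) (f : U -> V) (c : W) :
  lin f -> lin (fun x => tens (f x) c).
Proof. by move=> hf k x y; rewrite hf; case: (tens_bilinear V W) => h _; exact: h. Qed.

Lemma lin_tensr (U V W : lmodType K) (f : U -> V) (c : W) :
  lin f -> lin (fun x => tens c (f x)).
Proof. by move=> hf k x y; rewrite hf; case: (tens_bilinear W V) => _ h; exact: h. Qed.

Lemma bil_bilinear (U V W : lmodType K) (F : U -> V -> W) :
  bil F -> bilinear_map F.
Proof. by case=> h1 h2; split. Qed.

Lemma lin_tlift (U V W X : lmodType K) (F : V -> W -> X) (f : U -> V ⊗ W) :
  bil F -> lin f -> lin (fun x => tlift F (f x)).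
Proof. by move=> /bil_bilinear hF hf k x y; rewrite hf tlift_linear. Qed.

Lemma tliftE (U V W : lmodType K) (F : U -> V -> W) u v :
  bil F -> tlift F (tens u v) = F u v.
Proof. by move=> /bil_bilinear hF; rewrite tlift_tens. Qed.

Lemma lin_bil1 (U V W X : lmodType K) (F : V -> W -> X) (f : U -> V) c :
  bil F -> lin f -> lin (fun x => F (f x) c).
Proof. by move=> [hF _] hf k x y; rewrite hf hF. Qed.

Lemma lin_bil2 (U V W X : lmodType K) (F : V -> W -> X) (f : U -> W) c :
  bil F -> lin f -> lin (fun x => F c (f x)).
Proof. by move=> [_ hF] hf k x y; rewrite hf hF. Qed.

Definition tri (U V W X : lmodType K) (F : U -> V -> W -> X) : Prop :=
  [/\ forall b c, lin (fun a => F a b c), forall a c, lin (fun b => F a b c)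
    & forall a b, lin (fun c => F a b c)].

Lemma lin_tri1 (U V W X Y : lmodType K) (F : U -> V -> W -> X) (f : Y -> U) b c :
  tri F -> lin f -> lin (fun x => F (f x) b c).
Proof. by move=> [hF _ _] hf k x y; rewrite hf hF. Qed.

Lemma lin_tri2 (U V W X Y : lmodType K) (F : U -> V -> W -> X) (f : Y -> V) a c :
  tri F -> lin f -> lin (fun x => F a (f x) c).
Proof. by move=> [_ hF _] hf k x y; rewrite hf hF. Qed.

Lemma lin_tri3 (U V W X Y : lmodType K) (F : U -> V -> W -> X) (f : Y -> W) a b :
  tri F -> lin f -> lin (fun x => F a b (f x)).
Proof. by move=> [_ _ hF] hf k x y; rewrite hf hF. Qed.

Lemma lin0 (U W : lmodType K) (f : U -> W) : lin f -> f 0 = 0.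
Proof. by move=> hf; have := linear0 (mklin hf). Qed.

Lemma linZ (U W : lmodType K) (f : U -> W) k x : lin f -> f (k *: x) = k *: f x.
Proof. by move=> hf; rewrite -[k *: x]addr0 hf lin0 // addr0. Qed.

Lemma linB (U W : lmodType K) (f : U -> W) x y : lin f -> f (x - y) = f x - f y.
Proof. by move=> hf; have := linearB (mklin hf) x y. Qed.

Lemma lin_bigsum (U W : lmodType K) (f : U -> W) (I : Type) (s : seq I) (F : I -> U) :
  lin f -> f (\sum_(i <- s) F i) = \sum_(i <- s) f (F i).
Proof. by move=> hf; have := linear_sum (mklin hf) s xpredT F. Qed.

Lemma tens_ext (U V W : lmodType K) (f g : U ⊗ V -> W) :
  lin f -> lin g -> (forall u v, f (tens u v) = g (tens u v)) -> f =1 g.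
Proof.
by move=> hf hg fg x; have := @tlift_unique _ _ _ _ (mklin hf) (mklin hg) fg x.
Qed.

End Lin.

Section Sweedler.
Variables (K : fieldType) (H : algType K) (hopfH : hopf_structure H).

Local Notation S := (antipode hopfH).
Local Notation eps := (counit hopfH).

(** The sum of F h1 h2 over the coproduct h1 (x) h2 of h.  It is a sum over a
    fixed representative of the coproduct, so linear maps can be moved through
    it and two such sums exchanged for every F; the laws that involve the
    coalgebra structure need F to be bilinear. *)
Definition sw (W : lmodType K) (h : H) (F : H -> H -> W) : W :=
  tlift F (comul hopfH h).

Lemma eq_sw (W : lmodType K) h (F G : H -> H -> W) :
  (forall a b, F a b = G a b) -> sw h F = sw h G.
Proof. by move=> FG; apply: eq_bigr => p _; apply: FG. Qed.

Lemma lin_swF (U W : lmodType K) h (F : U -> H -> H -> W) :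
  (forall a b, lin (fun x => F x a b)) -> lin (fun x => sw h (F x)).
Proof. by move=> hF; apply: lin_sum => p. Qed.

Lemma lin_sw (U W : lmodType K) (f : U -> H) (F : H -> H -> W) :
  lin f -> bil F -> lin (fun x => sw (f x) F).
Proof. by move=> hf hF; apply: lin_tlift => //; apply: lin_app. Qed.

Lemma sw_lin (U W : lmodType K) (f : U -> W) h (F : H -> H -> U) :
  lin f -> f (sw h F) = sw h (fun a b => f (F a b)).
Proof. by move=> hf; exact: (@lin_bigsum _ _ _ f _ _ _ hf). Qed.

Lemma sw_scale (W : lmodType K) h (F : H -> H -> K^o) (w : W) :
  sw h F *: w = sw h (fun a b => F a b *: w).
Proof. exact: (sw_lin (f := fun x : K^o => x *: w) _ _ (lin_scalel _ (@lin_id _ _))). Qed.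

Lemma sw_sum_tens (W : lmodType K) h (F : H -> H -> W) (I : finType) (p q : I -> H) :
  comul hopfH h = \sum_i tens (p i) (q i) -> bil F -> sw h F = \sum_i F (p i) (q i).
Proof.
move=> hE hF; rewrite /sw hE (lin_bigsum (f := tlift F)); last exact: lin_tlift.
by apply: eq_bigr => i _; rewrite tliftE.
Qed.

Lemma swC (W : lmodType K) x y (F : H -> H -> H -> H -> W) :
  sw x (fun a b => sw y (fun c d => F a b c d)) =
  sw y (fun c d => sw x (fun a b => F a b c d)).
Proof. exact: exchange_big. Qed.

Lemma swM (W : lmodType K) x y (F : H -> H -> W) : bil F ->
  sw (x * y) F = sw x (fun a b => sw y (fun c d => F (a * c) (b * d))).
Proof.
move=> hF; rewrite /sw comulM.
rewrite [LHS](sw_lin (f := tlift F)); last exact: lin_tlift.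
apply: eq_sw => a b; rewrite [LHS](sw_lin (f := tlift F)); last exact: lin_tlift.
by apply: eq_sw => c d; rewrite tliftE.
Qed.

Lemma swA (W : lmodType K) h (F : H -> H -> H -> W) : tri F ->
  sw h (fun a b => sw a (fun c d => F c d b)) =
  sw h (fun a b => sw b (fun c d => F a c d)).
Proof.
case=> h1 h2 h3.
have bt a : bil (F a) by split.
have bT : bil (fun a x => tlift (F a) x).
  by split=> [x|a]; [apply: lin_sum => p | apply: lin_tlift].
have lT : lin (tlift (fun a x => tlift (F a) x)) by apply: lin_tlift.
have := congr1 (tlift (fun a x => tlift (F a) x)) (comul_coassoc hopfH h).
have las : lin (@tassoc _ H H H).
  apply: lin_tlift => //; split=> [c|x].
    apply: lin_tlift => //; split=> ?; last apply: lin_tensr; exact: lin_tensl.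
  by apply: lin_sum => p; apply: lin_tensr; apply: lin_tensr.
have -> : tassoc (tmap (comul hopfH) idfun (comul hopfH h)) =
   sw h (fun a b => sw a (fun c d => tens c (tens d b))).
  rewrite [LHS](sw_lin (f := @tassoc _ H H H)) //; apply: eq_sw => a b.
  rewrite {1}[comul hopfH a]tensorE [LHS](@lin_bigsum _ _ _ (fun x => tassoc (tens x b))).
    by apply: eq_bigr => p _; rewrite tassocE.
  by apply: lin_comp => //; apply: lin_tensl.
have -> : tmap idfun (comul hopfH) (comul hopfH h) =
   sw h (fun a b => sw b (fun c d => tens a (tens c d))).
  apply: eq_sw => a b; rewrite {1}[comul hopfH b]tensorE /=.
  by rewrite [LHS](@lin_bigsum _ _ _ (fun x => tens a x)) //; apply: lin_tensr.
rewrite !(sw_lin _ _ lT).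
under eq_sw do rewrite (sw_lin _ _ lT).
under [in RHS]eq_sw do rewrite (sw_lin _ _ lT).
move=> E; transitivity (sw h (fun a b => sw a (fun c d => tlift (fun a x => tlift (F a) x) (tens c (tens d b))))).
  by apply: eq_sw => a b; apply: eq_sw => c d; rewrite tliftE // tliftE.
by rewrite E; apply: eq_sw => a b; apply: eq_sw => c d; rewrite tliftE // tliftE.
Qed.

Lemma sw_epsl (W : lmodType K) h (F : H -> W) : lin F ->
  sw h (fun a b => eps a *: F b) = F h.
Proof.
move=> hF; rewrite -[in RHS](comul_counitl hopfH h).
by rewrite [RHS](sw_lin _ _ hF); apply: eq_sw => a b; rewrite linZ.
Qed.

Lemma sw_epsr (W : lmodType K) h (F : H -> W) : lin F ->
  sw h (fun a b => eps b *: F a) = F h.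
Proof.
move=> hF; rewrite -[in RHS](comul_counitr hopfH h).
by rewrite [RHS](sw_lin _ _ hF); apply: eq_sw => a b; rewrite linZ.
Qed.

Let lmul : lin (@mulmap K H).
Proof.
apply: lin_tlift => //; split=> ?; first exact: lin_mull.
exact: lin_mulr.
Qed.

Lemma sw_Sl (W : lmodType K) h (F : H -> W) : lin F ->
  sw h (fun a b => F (S a * b)) = eps h *: F 1.
Proof.
move=> hF; rewrite -linZ // -(antipodel hopfH h) [X in F X](sw_lin _ _ lmul) (sw_lin _ _ hF).
by apply: eq_sw => a b; rewrite mulmapE.
Qed.

Lemma sw_Sr (W : lmodType K) h (F : H -> W) : lin F ->
  sw h (fun a b => F (a * S b)) = eps h *: F 1.
Proof.
move=> hF; rewrite -linZ // -(antipoder hopfH h) [X in F X](sw_lin _ _ lmul) (sw_lin _ _ hF).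
by apply: eq_sw => a b; rewrite mulmapE.
Qed.

Lemma sw1 (W : lmodType K) (F : H -> H -> W) : bil F -> sw 1 F = F 1 1.
Proof. by move=> hF; rewrite /sw comul1 tliftE. Qed.

End Sweedler.

Arguments sw {K H} hopfH {W} h F.
Arguments sw_lin {K H hopfH U W} f {h F} _.
Arguments sw_epsl {K H hopfH W h} F _.
Arguments sw_epsr {K H hopfH W h} F _.
Arguments sw_Sl {K H hopfH W h} F _.
Arguments sw_Sr {K H hopfH W h} F _.
Arguments swA {K H hopfH W h} F _.

Ltac lin1 := first
 [ done
 | apply: lin_id
 | match goal with
   | hF : bil _ |- _ => first [apply: (lin_bil1 _ hF) | apply: (lin_bil2 _ hF)]
   | hF : tri _ |- _ =>
       first [apply: (lin_tri1 _ _ hF) | apply: (lin_tri2 _ _ hF) | apply: (lin_tri3 _ _ hF)]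
   | hF : lin _ |- _ => apply: (lin_comp hF)
   end
 | apply: lin_tensl | apply: lin_tensr
 | apply: lin_mull | apply: lin_mulr
 | apply: lin_scalel | apply: lin_scaler
 | apply: lin_mxl | apply: lin_mxr
 | apply: lin_app
 | apply: lin_sw | apply: lin_swF => ? ?
 | apply: lin_add
 | apply: lin_sum => ? ].
Ltac lin := repeat first [ assumption | progress intros | split | lin1 | progress cbv beta].

(** * The antipode is an antihomomorphism of algebras and coalgebras *)

Section Antipode.
Variables (K : fieldType) (H : algType K) (hopfH : hopf_structure H).

Local Notation S := (antipode hopfH).
Local Notation eps := (counit hopfH).
Local Notation sw := (sw hopfH).

Lemma antipode1 : S 1 = 1.
Proof.
have := @sw_Sl _ _ hopfH _ 1 idfun (@lin_id _ _).
by rewrite sw1 /= ?counit1 ?scale1r ?mulr1 //; lin.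
Qed.

Lemma counit_antipode h : eps (S h) = eps h.
Proof.
transitivity (sw h (fun a b => eps (S a * b))).
  transitivity (sw h (fun a b => eps b *: eps (S a))).
    by rewrite (sw_epsr (fun a => eps (S a))) //; lin.
  by apply: eq_sw => a b; rewrite counitM mulrC.
rewrite (sw_Sl (eps)) ?counit1; last by lin.
exact: mulr1.
Qed.

(** The maps S(x y) and S(y) S(x) are a left and a right convolution inverse of
    the product on H (x) H: both are equal to the sum of S(x1 y1) x2 y2 S(y3)
    S(x3). *)
Lemma antipodeM x y : S (x * y) = S y * S x.
Proof.
transitivity (sw x (fun a b => sw b (fun b1 b2 => sw y (fun c d => sw d (fun d1 d2 =>
   S (a * c) * (b1 * (d1 * S d2) * S b2)))))).
  transitivity (sw x (fun a b => eps b *: S (a * y))).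
    by rewrite (sw_epsr (fun a => S (a * y))) //; lin.
  apply: eq_sw => a b.
  transitivity (sw b (fun b1 b2 => sw y (fun c d => eps d *: (S (a * c) * (b1 * S b2))))).
    under eq_sw => b1 b2 do
      (rewrite (sw_epsr (fun c => S (a * c) * (b1 * S b2))); last by lin).
    rewrite (sw_Sr (fun u => S (a * y) * u)) ?mulr1 //; lin.
  apply: eq_sw => b1 b2; apply: eq_sw => c d.
  rewrite (sw_Sr (fun u => S (a * c) * (b1 * u * S b2))) ?mulr1 //; lin.
transitivity (sw x (fun p q => sw y (fun r s => sw (p * r) (fun u v => S u * v * (S s * S q))))).
  under [RHS]eq_sw => p q do under eq_sw => r s do (rewrite swM; last by lin).
  under [RHS]eq_sw => p q do rewrite swC.
  rewrite (swA (fun a b1 b2 => sw y (fun r s => sw r (fun c d => S (a * c) * (b1 * d) * (S s * S b2))))).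
    apply: eq_sw => a b; apply: eq_sw => b1 b2.
    rewrite (swA (fun c d1 d2 => S (a * c) * (b1 * d1) * (S d2 * S b2))); last by lin.
    by apply: eq_sw => c d; apply: eq_sw => d1 d2; rewrite !mulrA.
  all: lin.
under eq_sw => p q do under eq_sw => r s do
  (rewrite (sw_Sl (fun u => u * (S s * S q))); last by lin).
under eq_sw => p q do under eq_sw => r s do
  rewrite mul1r counitM -scalerA.
transitivity (sw x (fun p q => eps p *: (S y * S q))).
  apply: eq_sw => p q; rewrite -(sw_epsl (hopfH := hopfH) (h := y) (fun s => S s * S q)); last by lin.
  by rewrite (sw_lin (fun z : H => (eps p : K) *: z)) //; lin.
by rewrite (sw_epsl (fun q => S y * S q)) //; lin.
Qed.

(** The dual of the previous argument: the coproduct of S(h) and S(h2) (x)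
    S(h1) are both convolution inverses of the coproduct. *)
Lemma sw_antipode (W : lmodType K) h (F : H -> H -> W) : bil F ->
  sw (S h) F = sw h (fun a b => F (S b) (S a)).
Proof.
move=> hF.
(* The middle factors of b1 S(b4) (x) b2 S(b3) cancel, then the outer ones. *)
have key (G : H -> H -> W) b : bil G ->
    sw b (fun b' q => sw b' (fun b1 b2 => sw q (fun q1 q2 => G (b1 * S q2) (b2 * S q1)))) =
    eps b *: G 1 1.
  move=> hG.
  rewrite (swA (fun b1 b2 q => sw q (fun q1 q2 => G (b1 * S q2) (b2 * S q1)))); last by lin.
  transitivity (sw b (fun b1 t => G (b1 * S t) 1)).
    apply: eq_sw => b1 t.
    rewrite -(swA (fun b2 q1 q2 => G (b1 * S q2) (b2 * S q1))); last by lin.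
    transitivity (sw t (fun m q2 => eps m *: G (b1 * S q2) 1)).
      by apply: eq_sw => m q2; rewrite (sw_Sr (fun u => G (b1 * S q2) u)) //; lin.
    by rewrite (sw_epsl (fun q2 => G (b1 * S q2) 1)) //; lin.
  by rewrite (sw_Sr (fun u => G u 1)) //; lin.
transitivity (sw h (fun a b => sw (S a) (fun u v => sw b (fun b' q => sw b' (fun b1 b2 =>
    sw q (fun q1 q2 => F (u * b1 * S q2) (v * b2 * S q1))))))).
  transitivity (sw h (fun a b => eps b *: sw (S a) F)).
    by rewrite (sw_epsr (fun a => sw (S a) F)) //; lin.
  apply: eq_sw => a b; rewrite (sw_lin (fun z : W => (eps b : K) *: z)); last by lin.
  apply: eq_sw => u v; under [RHS]eq_sw => b' q do under eq_sw => b1 b2 do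
    under eq_sw => q1 q2 do rewrite -!mulrA.
  by rewrite (key (fun x y => F (u * x) (v * y))) ?mulr1 //; lin.
transitivity (sw h (fun p q => sw p (fun a b => sw (S a * b) (fun r s =>
    sw q (fun q1 q2 => F (r * S q2) (s * S q1)))))).
  rewrite (swA (fun a b q => sw (S a * b) (fun r s => sw q (fun q1 q2 => F (r * S q2) (s * S q1))))); last by lin.
  apply: eq_sw => a b; rewrite swC; apply: eq_sw => b' q.
  by rewrite swM //; lin.
transitivity (sw h (fun p q => eps p *: sw q (fun q1 q2 => F (S q2) (S q1)))).
  apply: eq_sw => p q.
  rewrite (sw_Sl (fun z => sw z (fun r s => sw q (fun q1 q2 => F (r * S q2) (s * S q1))))); last by lin.
  rewrite sw1; last by lin.
  by congr (_ *: _); apply: eq_sw => a b; rewrite !mul1r.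
by rewrite (sw_epsl (fun q => sw q (fun q1 q2 => F (S q2) (S q1)))) //; lin.
Qed.

End Antipode.

(** * Finite spanning sets and separating functionals *)

Section FiniteDimension.
Variables (K : fieldType) (V : lmodType K).

(** A vector that occurs in a linear relation can be dropped from a spanning
    family. *)
Lemma spanning_has_dim m (e : 'I_m -> V) :
  (forall v, exists c : 'I_m -> K, v = \sum_i c i *: e i) ->
  exists n, has_dim V n.
Proof.
elim: m e => [|m IHm] e span_e.
  exists 0; constructor; exists (fun _ => 0).
    by move=> k x y; rewrite scaler0 addr0.
  exists (fun _ => 0) => [v|v]; last by rewrite thinmx0 [RHS]thinmx0.
  by have [c ->] := span_e v; rewrite big_ord0.
have [[c [i ci0 sum0]]|indep] :=
  pselect (exists c : 'I_m.+1 -> K, exists2 i, c i != 0 & \sum_j c j *: e j = 0).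
  apply: (IHm (e \o lift i)) => v; have [d dE] := span_e v.
  exists (fun j => d (lift i j) - d i / c i * c (lift i j)).
  have ei : e i = - (c i)^-1 *: \sum_j c (lift i j) *: e (lift i j).
    apply: (scalerI ci0); rewrite scalerA mulrN mulfV // scaleN1r.
    apply/eqP; rewrite -addr_eq0; apply/eqP; rewrite -[RHS]sum0.
    by rewrite [RHS](bigD1_ord i).
  rewrite dE (bigD1_ord i) //= ei scalerA scaler_sumr -big_split /=.
  apply: eq_bigr => j _; rewrite scalerA -scalerDl; congr (_ *: _).
  by rewrite mulrN mulNr addrC.
exists m.+1; constructor.
have [f fE] := choice span_e.
pose g (w : 'rV[K]_m.+1) := \sum_i w 0 i *: e i.
have glin : lin g.
  by apply: lin_sum => i; apply: lin_scalel => k x y; rewrite !mxE.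
have ginj w : g w = 0 -> w = 0.
  move=> gw0; apply/rowP => i; rewrite mxE; apply/eqP/negP => /negP wi0.
  by apply: indep; exists (w 0); exists i.
pose r v : 'rV[K]_m.+1 := \row_i f v i.
have gr v : g (r v) = v.
  by rewrite [RHS]fE; apply: eq_bigr => i _; rewrite mxE.
have rg w : r (g w) = w.
  by apply/subr0_eq/ginj; rewrite linB // gr subrr.
exists r; last by exists g.
by move=> k x y; rewrite -{1}[x]gr -{1}[y]gr -glin rg.
Qed.

(** By Zorn's lemma there is a subspace maximal among those that contain A and
    avoid x.  Such a subspace is a hyperplane complementary to the line of x,
    and f is the coordinate along x. *)
Lemma separating_functional (A : {pred V}) (x : V) :
  submod_closed A -> x \notin A ->
  exists f : {linear V -> K^o}, (forall y, y \in A -> f y = 0) /\ f x = 1.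
Proof.
move=> [A0 Alin] xA.
pose sub (T : set V) := T 0 /\ forall k u v, T u -> T v -> T (k *: u + v).
pose P (T : set V) := [/\ sub T, forall y, y \in A -> T y & ~ T x].
(* The empty set is added because it is the union of the empty chain. *)
have [|T [PT Tmax]] := @Zorn_bigcup V [set T | P T \/ T = set0]%classic.
  move=> F FP Ftot.
  have [[T0 FT0 PT0]|noP] := pselect (exists2 T, F T & P T); last first.
    right; apply/seteqP; split => // y [T FT Ty].
    by case: (FP _ FT) => [PT|T0]; [case: noP; exists T | rewrite T0 in Ty].
  have PF T y : F T -> T y -> P T by move=> FT Ty; case: (FP _ FT) => // T1; rewrite T1 in Ty.
  left; case: (PT0) => -[T00 _] AT0 _; split.
  - split; first by exists T0.
    move=> k u v [T1 FT1 T1u] [T2 FT2 T2v].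
    have [[[_ l1] _ _] [[_ l2] _ _]] := (PF _ _ FT1 T1u, PF _ _ FT2 T2v).
    case: (Ftot _ _ FT1 FT2) => s; [exists T2 => //; apply: l2 => //; exact: s|].
    by exists T1 => //; apply: l1 => //; exact: s.
  - by move=> y yA; exists T0 => //; apply: AT0.
  - by move=> [T FT Tx]; case: (PF _ _ FT Tx).
have {PT} [[T0 Tlin] AT Tx] : P T.
  case: PT => // T0; exfalso; apply: (Tmax [set y | y \in A]%classic).
    by rewrite T0; split=> [y []|/(_ 0)]; apply; exact: A0.
  left; split; last by move=> /= xA'; rewrite xA' in xA.
    split=> [|k u v uA vA]; [exact: A0 | exact: Alin].
  by [].
have dec y : exists c : K, T (y - c *: x).
  have [Ty|Ty] := pselect (T y); first by exists 0; rewrite scale0r subr0.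
  pose Ty' : set V := [set w | exists c u, T u /\ w = u + c *: y]%classic.
  have [c [u [Tu xE]]] : Ty' x.
    apply: contrapT => nx; apply: (Tmax Ty').
      split=> [w Tw|]; first by exists 0, w; rewrite scale0r addr0.
      by move=> /(_ y); apply: contra_not Ty; apply; exists 1, 0; rewrite scale1r add0r.
    left; split=> //.
      split=> [|k u v [c [u' [Tu ->]]] [d [v' [Tv ->]]]].
        by exists 0, 0; rewrite scale0r addr0.
      exists (k * c + d), (k *: u' + v'); split; first exact: Tlin.
      by rewrite scalerDr scalerDl scalerA addrACA.
    by move=> w wA; exists 0, w; rewrite scale0r addr0; split=> //; apply: AT.
  have c0 : c != 0 by apply: contra_notN Tx => /eqP c0; rewrite xE c0 scale0r addr0.
  exists c^-1; rewrite xE scalerDr scalerA mulVf // scale1r [- (_ + _)]opprD addrCA subrr addr0 -scalerN.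
  have TZ k w : T w -> T (k *: w) by move=> Tw; rewrite -[_ *: _]addr0; apply: Tlin.
  by apply: (TZ); rewrite -scaleN1r; apply: TZ.
have [f fT] := choice dec.
have Tx0 c : T (c *: x) -> c = 0.
  move=> Tc; apply/eqP; apply: contra_notT Tx => c0.
  by rewrite -[x]scale1r -(mulVf c0) -scalerA -[_ *: _]addr0; apply: Tlin.
have uniq y c : T (y - c *: x) -> f y = c.
  move=> Tc; apply/subr0_eq/Tx0; have := Tlin (-1) _ _ (fT y) Tc.
  by rewrite scaleN1r opprB addrA subrK -scalerBl.
have flin : lin (f : V -> K^o).
  move=> k y z; apply: uniq; have := Tlin k _ _ (fT y) (fT z).
  by rewrite scalerBr addrACA scalerDl -scalerA opprD.
exists (mklin flin); split=> [y yA|] /=; apply: uniq.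
  by rewrite scale0r subr0; apply: AT.
by rewrite scale1r subrr.
Qed.

End FiniteDimension.

(** * Integrals and finite dimensionality *)

Section TensorRank.
Variables (K : fieldType) (U V : lmodType K).

(** A linear relation between the left factors of a sum of tensors shortens the
    sum. *)
Lemma tensor_reduced (x : U ⊗ V) :
  exists m (p : 'I_m -> U) (q : 'I_m -> V),
    x = \sum_i tens (p i) (q i) /\
    forall c : 'I_m -> K, \sum_i c i *: p i = 0 -> forall i, c i = 0.
Proof.
suff ind m (p : 'I_m -> U) (q : 'I_m -> V) : x = \sum_i tens (p i) (q i) ->
    exists m (p : 'I_m -> U) (q : 'I_m -> V), x = \sum_i tens (p i) (q i) /\
    forall c : 'I_m -> K, \sum_i c i *: p i = 0 -> forall i, c i = 0.
  apply: (ind _ (fun i => (tnth (in_tuple (repr x)) i).1) (fun i => (tnth (in_tuple (repr x)) i).2)).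
  by rewrite [LHS]tensorE big_tnth.
elim: m p q => [|m IHm] p q xE.
  by exists 0, p, q; split=> // c _ [].
have [[c [i ci0 sum0]]|indep] :=
  pselect (exists c : 'I_m.+1 -> K, exists2 i, c i != 0 & \sum_j c j *: p j = 0); last first.
  exists m.+1, p, q; split=> // c c0 i; apply/eqP/negP => /negP ci.
  by apply: indep; exists c; exists i.
apply: (IHm (p \o lift i) (fun j => q (lift i j) - (c (lift i j) / c i) *: q i)).
have pi : p i = - (c i)^-1 *: \sum_j c (lift i j) *: p (lift i j).
  apply: (scalerI ci0); rewrite scalerA mulrN mulfV // scaleN1r.
  apply/eqP; rewrite -addr_eq0; apply/eqP; rewrite -[RHS]sum0.
  by rewrite [RHS](bigD1_ord i).
have lr (u : U) := @lin_tensr K V V U (fun v : V => v) u (@lin_id _ _).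
have ll (v : V) := @lin_tensl K U U V (fun u : U => u) v (@lin_id _ _).
rewrite xE (bigD1_ord i) //= pi (linZ _ _ (ll _)) (lin_bigsum _ _ (ll _)) scaler_sumr -big_split /=.
apply: eq_bigr => j _; rewrite (linB _ _ (lr _)) (linZ _ _ (ll _)) (linZ _ _ (lr _)) addrC.
by rewrite scalerA -scaleNr mulNr mulrC.
Qed.

(** The p i need not be a basis, so the functional comes from separating p j
    from the span of the other ones. *)
Lemma dual_functional m (p : 'I_m -> U) (j : 'I_m) :
  (forall c : 'I_m -> K, \sum_i c i *: p i = 0 -> forall i, c i = 0) ->
  exists f : {linear U -> K^o}, forall i, f (p i) = (i == j)%:R.
Proof.
move=> indep; pose A : {pred U} := [pred v | `[< exists c : 'I_m -> K, c j = 0 /\ v = \sum_i c i *: p i >]].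
have [||f [fA fj]] := @separating_functional K U A (p j).
- split=> [|k u v /asboolP[c [cj uE]] /asboolP[d [dj vE]]]; apply/asboolP.
    by exists (fun _ => 0); split=> //; rewrite big1 // => i _; rewrite scale0r.
  exists (fun i => k * c i + d i); rewrite cj dj mulr0 addr0; split=> //.
  rewrite uE vE scaler_sumr -big_split /=; apply: eq_bigr => i _.
  by rewrite scalerDl scalerA.
- apply/negP => /asboolP[c [cj pE]].
  have /indep/(_ j) : \sum_i (c i - (i == j)%:R) *: p i = 0.
    under eq_bigr do rewrite scalerBl.
    rewrite sumrB -pE (bigD1 j) //= eqxx scale1r big1 ?addr0 ?subrr // => i /negPf->.
    by rewrite scale0r.
  by rewrite cj eqxx => /eqP; rewrite sub0r oppr_eq0 oner_eq0.
exists f => i; have [->|ij] := eqVneq i j; first by rewrite fj.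
apply: fA; apply/asboolP; exists (fun k => (k == i)%:R); rewrite eq_sym (negPf ij); split=> //.
rewrite (bigD1 i) //= eqxx scale1r big1 ?addr0 // => k /negPf->.
by rewrite scale0r.
Qed.

End TensorRank.

Section Integral.
Variables (K : fieldType) (H : algType K) (hopfH : hopf_structure H).

Local Notation S := (antipode hopfH).
Local Notation eps := (counit hopfH).
Local Notation sw := (sw hopfH).

Definition left_integral (L : H) : Prop := eps L = 1 /\ forall h, h * L = eps h *: L.

(** The augmentation ideal has a complement in the left regular module; the
    component of 1 in it is the integral. *)
Lemma semisimple_integral : semisimple_algebra H -> exists L, left_integral L.
Proof.
pose I : {pred H^o} := [pred x : H | eps x == 0].
have closedI : submod_closed I.
  split=> [|a u v]; first by rewrite inE linear0.
  rewrite !inE => /eqP u0 /eqP v0.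
  change (a *: u + v) with ((a : H) * (u : H) + (v : H)).
  by rewrite linearD /= counitM u0 v0 addr0 mulr0.
move=> /(_ I closedI) [T [[T0 Tlin] IT0 dec]].
have [y [z [yI zT e1]]] := dec 1.
have ez : eps z = 1.
  rewrite -(counit1 hopfH).
  change (1 : H^o) with (1 : H) in e1.
  by rewrite [in RHS]e1 [RHS]linearD /= (eqP yI) add0r.
exists z; split=> // h.
apply/subr0_eq/IT0.
  by rewrite inE linearB linearZ /= counitM ez subrr.
have -> : h * z - eps h *: z = (h - (eps h)%:A : H) *: (z : H^o) + 0.
  by rewrite addr0 [RHS]mulrBl -scalerAl mul1r.
exact: Tlin.
Qed.

Variables (L : H) (intL : left_integral L).

(** Inserting S(h1) h2 in front of the first factor turns the sum of L1 (x) h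
    L2 into that of S(h1) h2 L1 (x) h3 L2, and L absorbs h2, h3. *)
Lemma sw_integral_mulr (W : lmodType K) h (F : H -> H -> W) : bil F ->
  sw L (fun a b => F a (h * b)) = sw L (fun a b => F (S h * a) b).
Proof.
move=> hF; case: intL => _ lL.
transitivity (sw h (fun p q => sw (q * L) (fun a b => F (S p * a) b))).
  under [RHS]eq_sw => p q do (rewrite swM; last by lin).
  rewrite -(swA (fun p c d => sw L (fun a b => F (S p * (c * a)) (d * b)))); try by lin.
  transitivity (sw h (fun m d => eps m *: sw L (fun a b => F a (d * b)))).
    by rewrite (sw_epsl (fun d => sw L (fun a b => F a (d * b)))) //; lin.
  apply: eq_sw => m d; under [RHS]eq_sw => c p do under eq_sw => a b do rewrite mulrA.
  rewrite (sw_Sl (fun u => sw L (fun a b => F (u * a) (d * b)))); last by lin.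
  by congr (_ *: _); apply: eq_sw => a b; rewrite mul1r.
transitivity (sw h (fun p q => eps q *: sw L (fun a b => F (S p * a) b))).
  apply: eq_sw => p q; rewrite lL.
  by rewrite (linZ (f := fun z => sw z (fun a b => F (S p * a) b))) //; lin.
by rewrite (sw_epsr (fun p => sw L (fun a b => F (S p * a) b))) //; lin.
Qed.

(** Write the coproduct of L as a sum of p i (x) q i with independent p i.  By
    [sw_integral_mulr] and a functional dual to p j, the span of the q i is
    closed under left multiplication, and it contains S(L1) L2 = 1. *)
Lemma integral_has_dim : exists n, has_dim H n.
Proof.
case: (intL) => eL lL.
have [m [p [q [LE indep]]]] := tensor_reduced (comul hopfH L).
have swL (W : lmodType K) (F : H -> H -> W) : bil F -> sw L F = \sum_i F (p i) (q i).
  exact: sw_sum_tens.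
apply: (spanning_has_dim (e := q)) => h.
have ideal x j : exists c : 'I_m -> K, x * q j = \sum_i c i *: q i.
  have [f fE] := dual_functional j indep; exists (fun i => f (S x * p i)).
  transitivity (sw L (fun a b => f a *: (x * b))).
    rewrite swL; last by lin.
    rewrite (bigD1 j) //= fE eqxx scale1r big1 ?addr0 // => i /negPf ij.
    by rewrite fE ij scale0r.
  rewrite (sw_integral_mulr x (F := fun a b => f a *: b)); last by lin.
  by rewrite swL //; lin.
have hE : h = \sum_i (h * S (p i)) * q i.
  transitivity (sw L (fun a b => h * (S a * b))).
    by rewrite (sw_Sl (fun u => h * u)) ?eL ?scale1r ?mulr1 //; lin.
  rewrite swL; last by lin.
  by apply: eq_bigr => i _; rewrite mulrA.
have [c cE] := choice (fun j => ideal (h * S (p j)) j).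
exists (fun i => \sum_j c j i).
rewrite {1}hE; under eq_bigr do rewrite cE.
by rewrite exchange_big; apply: eq_bigr => i _; rewrite scaler_suml.
Qed.

End Integral.

(** * Eigenvalues and traces of powers *)

Section Eigenvalues.
Variable K : closedFieldType.

Lemma eigenvalue_exists n (A : 'M[K]_n.+1) : exists a, eigenvalue A a.
Proof.
have /closed_rootP[a ra] : size (char_poly A) != 1 by rewrite size_char_poly.
by exists a; rewrite eigenvalue_root_char.
Qed.

Lemma eigenvector_exp n (A : 'M[K]_n) x (v : 'rV_n) k :
  v *m A = x *: v -> v *m A ^+ k = x ^+ k *: v.
Proof.
move=> vA; elim: k => [|k IHk]; first by rewrite !expr0 scale1r mulmx1.
by rewrite exprS mulmxA vA -scalemxAl IHk scalerA exprS.
Qed.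

(** The list s contains the eigenvalues with multiplicity: in a basis that
    starts with an eigenvector the matrix is block triangular, and the other
    diagonal block is smaller. *)
Lemma mxtrace_eigenvalues n (A : 'M[K]_n) : exists s : seq K,
  [/\ size s = n, forall j, \tr (A ^+ j) = \sum_(x <- s) x ^+ j
    & forall x, (x \in s) = eigenvalue A x].
Proof.
suff [s [sn trs sE]] : exists s : seq K,
    [/\ size s = n, forall j, \tr (A ^+ j) = \sum_(x <- s) x ^+ j
      & char_poly A = \prod_(x <- s) ('X - x%:P)].
  by exists s; split=> // x; rewrite eigenvalue_root_char sE root_prod_XsubC.
elim: n A => [|n IHn] A.
  exists [::]; split=> //.
    by move=> j; rewrite big_nil /mxtrace big_ord0.
  by rewrite /char_poly det_mx00 big_nil.
have [a /eigenvalueP[v vA v0]] := eigenvalue_exists A.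
rewrite -[n.+1]/(1 + n)%N in A v vA v0 *.
pose P := row_ebase v; have uP : P \in unitmx by exact: row_ebase_unit.
have rv : \rank v = 1%N by apply/eqP; rewrite rank_rV v0.
pose B := P *m A *m invmx P.
have BE : (pid_mx 1 : 'M_(1, 1 + n)) *m B = a *: pid_mx 1.
  have vE : col_ebase v *m (pid_mx 1 *m P) = v by rewrite mulmxA; have := mulmx_ebase v; rewrite rv.
  have uA : ((pid_mx 1 : 'rV_(1 + n)) *m P) *m A = a *: (pid_mx 1 *m P).
    have uC := col_ebase_unit v.
    have uE : pid_mx 1 *m P = invmx (col_ebase v) *m v.
      exact: (canRL (mulKmx uC)).
    by rewrite uE -mulmxA vA scalemxAr.
  by rewrite /B !mulmxA uA -!scalemxAl mulmxK.
have uB : usubmx B = row_mx a%:M 0.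
  have p1 : (pid_mx 1 : 'M[K]_(1, 1 + n)) = row_mx 1%:M 0 by rewrite pid_mx_row.
  move: BE; rewrite p1 -[X in _ *m X](vsubmxK B) mul_row_col mul1mx mul0mx addr0 => ->.
  by rewrite scale_row_mx scaler0 scalemx1.
have BB : B = block_mx a%:M 0 (dlsubmx B) (drsubmx B).
  rewrite -{1}[B]vsubmxK uB -{1}[dsubmx B]hsubmxK.
  by rewrite /block_mx.
set C := dlsubmx B in BB; set D := drsubmx B in BB.
have [s [sn trs sE]] := IHn D.
exists (a :: s); split; first by rewrite /= sn.
  move=> j; rewrite big_cons -trs.
  have BX : B ^+ j = P *m A ^+ j *m invmx P.
    elim: j => [|j IHj]; first by rewrite !expr0 mulmx1 mulmxV.
    by rewrite !exprS IHj /B -![_ * _]/(_ *m _) !mulmxA mulmxKV.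
  transitivity (\tr (B ^+ j)); first by rewrite BX mxtrace_mulC mulmxA mulVmx // mul1mx.
  have [Cj ->] : exists Cj, B ^+ j = block_mx (a ^+ j)%:M 0 Cj (D ^+ j).
    elim: j {BX} => [|j [Cj IHj]].
      by exists 0; rewrite !expr0 -scalar_mx_block.
    exists (C *m (a ^+ j)%:M + D *m Cj).
    rewrite !exprS IHj BB -![_ * _]/(_ *m _) mulmx_block !mulmx0 !mul0mx !addr0 add0r.
    by rewrite -scalar_mxM.
  by rewrite mxtrace_block mxtrace_scalar mulr1n.
have -> : char_poly A = char_poly B.
  rewrite /char_poly.
  have -> : char_poly_mx B = map_mx polyC P *m char_poly_mx A *m map_mx polyC (invmx P).
    rewrite /char_poly_mx mulmxBr mulmxBl -!map_mxM; congr (_ - _).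
    by rewrite mul_mx_scalar -scalemxAl -map_mxM mulmxV // map_mx1 scalemx1.
  rewrite !det_mulmx mulrAC -det_mulmx -map_mxM mulmxV // map_mx1 det1 mul1r //.
rewrite big_cons -sE /char_poly BB /char_poly_mx map_block_mx [_%:M]scalar_mx_block.
rewrite opp_block_mx add_block_mx map_mx0 oppr0 addr0 det_lblock; congr (_ * _).
by rewrite det_mx11 !mxE eqxx !mulr1n.
Qed.

End Eigenvalues.

(** * A positivity property of sums of roots of unity *)

Section Positivity.

(** Over the rationals, the matrix M, a positive combination of the Gram
    matrices of the R q, satisfies M x = 0 only if R p x = 0.  Hence R p
    factors through M on the left, and c clears the denominators. *)
Lemma int_gram_factor (N : nat) (T : eqType) (s : seq T) (m : T -> nat) (R : T -> 'M[int]_N) :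
  (forall p, p \in s -> 0 < m p)%N ->
  forall p, p \in s -> exists (c : int) (Y : 'M[int]_N),
    c != 0 /\ c *: R p = Y *m (\sum_(q <- s) (m q)%:R *: ((R q)^T *m R q)).
Proof.
move=> m0 p ps; set M := \sum_(q <- s) _.
pose toQ n1 n2 (A : 'M[int]_(n1, n2)) : 'M[rat]_(n1, n2) := map_mx intr A.
have [C CE] : exists C, C = cokermx (toQ _ _ M) by eexists.
have MC : toQ _ _ M *m C = 0 by rewrite CE mulmx_coker.
have sqE n1 n2 (A : 'M[rat]_(n1, n2)) : \tr (A^T *m A) = \sum_i \sum_j A j i ^+ 2.
  by apply: eq_bigr => i _; rewrite mxE; apply: eq_bigr => j _; rewrite !mxE expr2.
have sq0 n1 n2 (A : 'M[rat]_(n1, n2)) : 0 <= \tr (A^T *m A).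
  by rewrite sqE; apply: sumr_ge0 => i _; apply: sumr_ge0 => j _; rewrite sqr_ge0.
(* The quadratic form of M on C is a sum of squares, so each R p kills C. *)
have /eqP : \tr (C^T *m (toQ _ _ M *m C)) = 0 by rewrite MC mulmx0 mxtrace0.
have -> : \tr (C^T *m (toQ _ _ M *m C)) =
    \sum_(q <- s) (m q)%:R * \tr ((toQ _ _ (R q) *m C)^T *m (toQ _ _ (R q) *m C)).
  rewrite /toQ /M raddf_sum mulmx_suml mulmx_sumr raddf_sum; apply: eq_bigr => q _.
  rewrite /= map_mxZ -scalemxAl -scalemxAr mxtraceZ map_mxM -map_trmx trmx_mul !mulmxA.
  by rewrite rmorph_nat.
rewrite big_seq psumr_eq0 => [/allP/(_ _ ps)|q qs]; last by rewrite mulr_ge0 // ler0n.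
rewrite ps /= mulf_eq0 pnatr_eq0 eqn0Ngt m0 //= => /eqP tr0.
have RC : toQ _ _ (R p) *m C = 0.
  apply/matrixP => j i; rewrite [RHS]mxE; apply/eqP; rewrite -sqrf_eq0.
  move/eqP: tr0; rewrite sqE psumr_eq0 => [/allP/(_ i)|k _]; last first.
    by apply: sumr_ge0 => l _; rewrite sqr_ge0.
  rewrite mem_index_enum => /(_ isT); rewrite psumr_eq0 => [/allP/(_ j)|l _]; last by rewrite sqr_ge0.
  by rewrite mem_index_enum => /(_ isT).
have /submxP[Y RY] : (toQ _ _ (R p) <= toQ _ _ M)%MS by rewrite submxE -CE RC.
pose d : int := \prod_(ij : 'I_N * 'I_N) denq (Y ij.1 ij.2).
have d0 : d != 0 by apply/prodf_neq0 => ij _; rewrite denq_eq0.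
have dY i j : d%:~R * Y i j \is a Num.int.
  rewrite /d (bigD1 (i, j)) //= rmorphM /= mulrAC [_ * Y i j]mulrC -numqE.
  by rewrite rpredM // rpred_int.
exists d, (map_mx numq (d%:~R *: Y)); split=> //.
have injQ n1 n2 : injective (@toQ n1 n2).
  move=> A B /matrixP AB; apply/matrixP => i j; apply: (@intr_inj rat).
  by have := AB i j; rewrite !mxE.
apply: injQ; rewrite /toQ map_mxZ /= -/(toQ _ _ (R p)) RY map_mxM /= scalemxAl; congr (_ *m _).
by apply/matrixP => i j; rewrite !mxE numqK.
Qed.

Variable K : closedFieldType.
Hypothesis charK : [pchar K] =i pred0.

Lemma intr_eq0_char0 (c : int) : (c%:~R == 0 :> K) = (c == 0).
Proof.
have nat0 := (pcharf0P K).1 charK.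
by case: c => n; rewrite ?NegzE ?mulrNz ?oppr_eq0 -pmulrn ?nat0.
Qed.

(** Over the complex numbers the second factor is the conjugate of the first
    one, and the hypothesis says that a positive combination of squared
    absolute values vanishes.  A general K has no conjugation.  Instead,
    multiplication by a root of unity permutes the N-th roots of unity, so the
    two sums are the eigenvalues of an integral matrix R p and of its transpose
    on the column X of all N-th roots of unity.  The hypothesis says that the
    sum of the Gram matrices of the R p kills X, and [int_gram_factor] carries
    this over to each R p. *)
Lemma unity_sums_positive (N : nat) (F : seq (nat * seq K)) : (0 < N)%N ->
  (forall p, p \in F -> 0 < p.1)%N ->
  (forall p x, p \in F -> x \in p.2 -> x ^+ N = 1) ->
  \sum_(p <- F) p.1%:R * ((\sum_(x <- p.2) x) * (\sum_(x <- p.2) x ^+ N.-1)) = 0 ->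
  forall p, p \in F -> \sum_(x <- p.2) x = 0.
Proof.
move=> N0 F0 FN sum0.
have [rs rsE] : exists rs : seq K, forall x, (x \in rs) = (x ^+ N == 1).
  have [rs rsE] := closed_field_poly_normal ('X^N - 1 : {poly K}).
  have mon := monicXnsubC (1 : K) N0.
  exists rs => x; rewrite (monicP mon) scale1r in rsE.
  have := root_prod_XsubC rs x; rewrite -rsE => <-.
  by rewrite rootE !hornerE subr_eq0.
pose I := seq_sub rs; pose n := #|{: I}|.
pose v (i : 'I_n) : K := val (enum_val i).
have vN i : v i ^+ N = 1 by apply/eqP; rewrite -rsE; apply: valP.
have vsum (y : K) (f : K -> K) : y ^+ N = 1 -> \sum_i (v i == y)%:R * f (v i) = f y.
  move=> yN; have yrs : y \in rs by rewrite rsE yN.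
  pose j := enum_rank (SeqSub yrs : I).
  have vj : v j = y by rewrite /v enum_rankK.
  rewrite (bigD1 j) //= vj eqxx mul1r big1 ?addr0 // => i ij.
  have [viy|] := eqVneq (v i) y; last by rewrite mul0r.
  case/eqP: ij; apply: enum_val_inj; apply: val_inj.
  by rewrite -/(v i) -/(v j) viy vj.
pose R (p : nat * seq K) : 'M[int]_n := \matrix_(i, j) \sum_(x <- p.2) ((v j == v i * x) : nat)%:Z.
pose X : 'cV[K]_n := \col_i v i.
pose toK n1 n2 (A : 'M[int]_(n1, n2)) : 'M[K]_(n1, n2) := map_mx intr A.
have RX p : p \in F -> toK _ _ (R p) *m X = (\sum_(x <- p.2) x) *: X.
  move=> pF; apply/colP => i; rewrite !mxE mulr_suml.
  under eq_bigr => j _ do rewrite !mxE rmorph_sum mulr_suml.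
  rewrite exchange_big /= big_seq [RHS]big_seq; apply: eq_bigr => x xp.
  under eq_bigr => j _ do rewrite -pmulrn.
  by rewrite (vsum _ id) ?exprMn ?vN ?(FN p) ?mulr1 // mulrC.
have RTX p : p \in F -> toK _ _ (R p)^T *m X = (\sum_(x <- p.2) x ^+ N.-1) *: X.
  move=> pF; apply/colP => i; rewrite !mxE mulr_suml.
  under eq_bigr => j _ do rewrite !mxE rmorph_sum mulr_suml.
  rewrite exchange_big /= big_seq [RHS]big_seq; apply: eq_bigr => x xp.
  have xN := FN p x pF xp.
  have xx : x * x ^+ N.-1 = 1 by rewrite -exprS prednK.
  rewrite -(vsum (x ^+ N.-1 * v i) id) ?exprMn ?vN ?mulr1 -?exprM 1?mulnC ?exprM ?xN ?expr1n //.
  apply: eq_bigr => j _; rewrite -pmulrn; congr (_%:R * _); congr nat_of_bool.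
  apply/eqP/eqP => [->|->]; first by rewrite mulrCA [_ ^+ _ * _]mulrC xx mulr1.
  by rewrite mulrC mulrA xx mul1r.
move=> p pF; have [c [Y [c0 cY]]] := int_gram_factor (m := fst) R F0 pF.
have MX : toK _ _ (\sum_(q <- F) q.1%:R *: ((R q)^T *m R q)) *m X = 0.
  rewrite -[RHS](scale0r X) -sum0 /toK raddf_sum mulmx_suml scaler_suml big_seq [RHS]big_seq.
  apply: eq_bigr => q qF; rewrite /= map_mxZ map_mxM -scalemxAl -mulmxA -/(toK _ _ (R q)) RX //.
  rewrite -scalemxAr -/(toK _ _ (R q)^T) RTX // !scalerA -mulrA rmorph_nat //.
have : toK _ _ (c *: R p) *m X = 0 by rewrite cY /toK map_mxM -mulmxA -/(toK _ _ _) MX mulmx0.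
rewrite /toK map_mxZ -scalemxAl -/(toK _ _ (R p)) RX // scalerA => /colP sX.
have one_rs : (1 : K) \in rs by rewrite rsE expr1n.
have := sX (enum_rank (SeqSub one_rs : I)); rewrite !mxE /v enum_rankK mulr1 => /eqP.
by rewrite mulf_eq0 intr_eq0_char0 (negPf c0) => /eqP.
Qed.

End Positivity.

(** * Determinants on eigenspaces and parity of traces *)

Section Commutators.
Variables (K : fieldType) (N : nat) (U : 'M[K]_N).

Let V a := row_base (eigenspace U a).
Let dt a (X : 'M[K]_N) := \det (conjmx (V a) X).

Let stab a X : comm_mx U X -> stablemx (V a) X.
Proof. by move=> UX; rewrite stablemx_row_base comm_mx_stable_eigenspace. Qed.

Let dtM a X Y : comm_mx U X -> comm_mx U Y -> dt a (X *m Y) = dt a X * dt a Y.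
Proof. by move=> UX UY; rewrite /dt conjmxM ?det_mulmx // inE stab. Qed.

Let dt1 a : dt a 1%:M = 1.
Proof. by rewrite /dt conjmx_scalar ?row_base_free // det1. Qed.

(** All matrices in the first list preserve the eigenspace of U for a; let det
    be the determinant of the restriction to it.  The relation Pw Aw = Aw Ph Pw
    gives det Ph = 1, and Lw Lh Ll = Ll Lw gives det Lh = 1.  Then B and R,
    which are inverse to Ph and Lh up to conjugation by J, have determinant 1
    as well, and the last relation gives det U = 1, where U is the scalar a. *)
Lemma eigenvalue_unity (Pw Ph Aw Lw Lh Ll J B R : 'M[K]_N) a :
  (forall X, X \in [:: Pw; Ph; Aw; Lw; Lh; Ll; J] -> comm_mx U X) ->
  (forall X, X \in [:: Pw; Aw; Lw; Ll] -> exists X', X *m X' = 1%:M) ->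
  Pw *m Aw = Aw *m Ph *m Pw -> Lw *m Lh *m Ll = Ll *m Lw ->
  J *m J = 1%:M -> J *m B *m J *m Ph = 1%:M -> J *m R *m J *m Lh = 1%:M ->
  Lh *m B *m U = Ph *m R ->
  eigenvalue U a -> exists2 k, (0 < k)%N & a ^+ k = 1.
Proof.
move=> comm inv PA LL JJ JBJP JRJL LBU Ua.
have cM X Y : comm_mx U X -> comm_mx U Y -> comm_mx U (X *m Y) by exact: comm_mxM.
have cV X X' : comm_mx U X -> X *m X' = 1%:M -> comm_mx U X'.
  move=> UX XX'; have X'X := mulmx1C XX'.
  by rewrite /comm_mx -[U *m X']mul1mx -X'X -!mulmxA [X *m (_ *m _)]mulmxA -UX -mulmxA XX' mulmx1.
have [Pwc Phc Awc] : [/\ comm_mx U Pw, comm_mx U Ph & comm_mx U Aw].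
  by split; apply: comm; rewrite !inE eqxx ?orbT.
have [Lwc Lhc Llc] : [/\ comm_mx U Lw, comm_mx U Lh & comm_mx U Ll].
  by split; apply: comm; rewrite !inE eqxx ?orbT.
have Jc : comm_mx U J by apply: comm; rewrite !inE eqxx ?orbT.
have conjJ X : X = J *m (J *m X *m J) *m J.
  by rewrite !mulmxA JJ mul1mx -mulmxA JJ mulmx1.
have Bc : comm_mx U B.
  by rewrite [B]conjJ; do 2!apply: (cM) => //; apply: cV Phc (mulmx1C JBJP).
have Rc : comm_mx U R.
  by rewrite [R]conjJ; do 2!apply: (cM) => //; apply: cV Lhc (mulmx1C JRJL).
have d0 X : comm_mx U X -> X \in [:: Pw; Aw; Lw; Ll] -> dt a X != 0.
  move=> UX Xin; have [X' XX'] := inv _ Xin; apply/eqP => dX.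
  have := dt1 a; rewrite -XX' (dtM _ UX (cV _ _ UX XX')) dX mul0r => /esym/eqP.
  by rewrite oner_eq0.
have dPh : dt a Ph = 1.
  have := congr1 (dt a) PA; rewrite !dtM; try (by repeat (assumption || apply: (cM))); move=> E.
  apply: (mulfI (d0 Aw _ _)) => //; first by rewrite !inE eqxx ?orbT.
  apply: (mulIf (d0 Pw _ _)) => //; first by rewrite !inE eqxx ?orbT.
  by rewrite -E mulr1 mulrC.
have dLh : dt a Lh = 1.
  have := congr1 (dt a) LL; rewrite !dtM; try (by repeat (assumption || apply: (cM))); move=> E.
  apply: (mulfI (d0 Lw _ _)) => //; first by rewrite !inE eqxx ?orbT.
  apply: (mulIf (d0 Ll _ _)) => //; first by rewrite !inE eqxx ?orbT.
  by rewrite E mulr1 mulrC.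
have dJ : dt a J * dt a J = 1 by rewrite -dtM // JJ dt1.
have dB : dt a B = 1.
  have := congr1 (dt a) JBJP; rewrite !dtM; try (by repeat (assumption || apply: (cM))).
  by rewrite dt1 dPh mulr1 mulrAC dJ mul1r.
have dR : dt a R = 1.
  have := congr1 (dt a) JRJL; rewrite !dtM; try (by repeat (assumption || apply: (cM))).
  by rewrite dt1 dLh mulr1 mulrAC dJ mul1r.
exists (\rank (eigenspace U a)).
  by rewrite lt0n mxrank_eq0.
have := congr1 (dt a) LBU; rewrite !dtM; try (by repeat (assumption || apply: (cM))).
rewrite dPh dLh dB dR !mul1r.
rewrite /dt (@conjmx_eigenvalue _ _ _ a) ?row_base_free ?eq_row_base //.
by rewrite det_scalar.
Qed.

End Commutators.

Section Parity.
Variable K : closedFieldType.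
Hypothesis charK : [pchar K] =i pred0.

Local Notation integralZ := (integralOver (intr : int -> K)).

Lemma unity_integral (x : K) k : (0 < k)%N -> x ^+ k = 1 -> integralZ x.
Proof.
move=> k0 xk; exists ('X^k - 1); first exact: monicXnsubC.
by rewrite rmorphB /= map_polyXn rmorph1 rootE !hornerE xk subrr.
Qed.

(** Here y is the second elementary symmetric function of the eigenvalues. *)
Lemma mxtrace_sqr_parity n (A : 'M[K]_n) :
  (forall x, eigenvalue A x -> exists2 k, (0 < k)%N & x ^+ k = 1) ->
  exists2 y, integralZ y & (\tr A) ^+ 2 = \tr (A ^+ 2) + 2%:R * y.
Proof.
have [s [_ trs sE]] := mxtrace_eigenvalues A.
move=> A1; rewrite -{1}[A]expr1 !trs; under eq_bigr do rewrite expr1.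
have {}A1 x : x \in s -> integralZ x.
  by rewrite sE => /A1[k k0 xk]; apply: unity_integral xk.
have [y iy [z iz zE]] : exists2 y, integralZ y &
    exists2 z, integralZ z & z = \sum_(x <- s) x /\ z ^+ 2 = \sum_(x <- s) x ^+ 2 + 2%:R * y.
  elim: s {trs sE} A1 => [|x s IHs] A1.
    exists 0; first exact: integral0.
    by exists 0; [exact: integral0 | rewrite !big_nil mulr0 addr0 expr0n].
  have [|y iy [z iz [zE z2]]] := IHs; first by move=> u us; apply: A1; rewrite inE us orbT.
  have ix : integralZ x by apply: A1; rewrite inE eqxx.
  exists (y + x * z); first by apply: integral_add => //; apply: integral_mul.
  exists (x + z); first exact: integral_add.
  rewrite !big_cons -zE; split=> //.
  by rewrite sqrrD z2; ring.
by exists y => //; rewrite -zE.1 zE.2.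
Qed.

(** Multiplying a monic integral equation of degree d for n/2 by the d-th power
    of 2 shows that n to the power d is even. *)
Lemma odd_half_not_integral (n : nat) (y : K) :
  integralZ y -> 2%:R * y = n%:R -> ~~ odd n.
Proof.
move=> [p monp rooty] yn; apply/negP => oddn.
have nat0 := (pcharf0P K).1 charK.
pose d := (size p).-1.
have szp : (size p = d.+1)%N by rewrite prednK // size_poly_gt0 monic_neq0.
have pd : p`_d = 1 by have := monicP monp; rewrite lead_coefE.
pose c : int := \sum_(i < d) p`_i * (n%:Z ^+ i * 2 ^+ (d - i.+1)).
have c0 : n%:Z ^+ d + 2 * c = 0.
  apply/eqP; rewrite -(intr_eq0_char0 charK); apply/eqP.
  rewrite -[RHS](mul0r (2%:R ^+ d)) -(rootP rooty).
  rewrite (@horner_coef_wide _ d.+1) ?(leq_trans (size_poly _ _)) ?szp // mulr_suml big_ord_recr /=.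
  rewrite coef_map pd; rewrite /= mulr1z mul1r -exprMn [y * _]mulrC yn rmorphD rmorphXn /=.
  rewrite [RHS]addrC; congr (_ + _); rewrite rmorphM /c rmorph_sum mulr_sumr; apply: eq_bigr => i _.
  rewrite coef_map !rmorphM !rmorphXn /= -[n%:~R]/(n%:R) -yn exprMn.
  have -> : 2%:R ^+ d = 2%:R ^+ i * (2%:R * 2%:R ^+ (d - i.+1)) :> K.
    by rewrite -exprS -exprD subnSK // subnKC // ltnW.
  by ring.
move/eqP: c0; rewrite addr_eq0 => /eqP/(congr1 (fun z => odd (absz z))).
by rewrite abszX abszN abszM oddX oddM oddn orbT.
Qed.

End Parity.

(** * Bases, traces and matrices of operators *)

(** A basis together with its dual basis of coordinate forms. *)
Record basis (K : fieldType) (Z : lmodType K) (I : finType) := Basis {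
  bvec : I -> Z;
  bcoord : I -> {linear Z -> K^o};
  bvecE : forall z, z = \sum_i bcoord i z *: bvec i;
  bcoordE : forall i j, bcoord i (bvec j) = (i == j)%:R }.

Section Trace.
Variables (K : fieldType) (Z : lmodType K) (I : finType) (B : basis Z I).

Definition trace (F : Z -> Z) : K := \sum_i bcoord B i (F (bvec B i)).

(** The matrix acts on columns of coordinates; its transpose acts on the rows
    [crow] of coordinates. *)
Definition mxrep (F : Z -> Z) : 'M[K]_#|I| :=
  \matrix_(i, j) bcoord B (enum_val i) (F (bvec B (enum_val j))).

Lemma coord_ext z z' : (forall i, bcoord B i z = bcoord B i z') -> z = z'.
Proof. by move=> E; rewrite [z](bvecE B) [z'](bvecE B); under eq_bigr do rewrite E. Qed.

Lemma eq_trace F G : F =1 G -> trace F = trace G.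
Proof. by move=> FG; apply: eq_bigr => i _; rewrite FG. Qed.

(** Any finite resolution of the identity computes the trace, not only a
    basis. *)
Lemma trace_frame (J : Type) (s : seq J) (e : J -> Z) (e' : J -> Z -> K^o) (F : Z -> Z) :
  lin F -> (forall j, lin (e' j)) -> (forall z, z = \sum_(j <- s) e' j z *: e j) ->
  trace F = \sum_(j <- s) e' j (F (e j)).
Proof.
move=> lF le' zE.
transitivity (\sum_i \sum_(j <- s) e' j (bvec B i) * bcoord B i (F (e j))).
  apply: eq_bigr => i _; rewrite {1}[bvec B i]zE lin_bigsum // linear_sum.
  by apply: eq_bigr => j _; rewrite linZ // linearZ.
rewrite exchange_big; apply: eq_bigr => j _.
rewrite {2}[F (e j)](bvecE B) lin_bigsum //.
by apply: eq_bigr => i _; rewrite linZ //; apply: mulrC.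
Qed.

Lemma trace_id : trace id = #|I|%:R.
Proof. by rewrite /trace; under eq_bigr do rewrite bcoordE eqxx; rewrite sumr_const. Qed.

Lemma trace_rank1 (f : Z -> K^o) (u : Z) : lin f -> trace (fun z => f z *: u) = f u.
Proof.
move=> lf; rewrite {2}[u](bvecE B) lin_bigsum //.
by apply: eq_bigr => i _; rewrite linearZ linZ //; apply: mulrC.
Qed.

Lemma mxrepM F G : lin F -> mxrep (fun z => F (G z)) = mxrep F *m mxrep G.
Proof.
move=> lF; apply/matrixP => i j; rewrite !mxE.
rewrite {1}[G _](bvecE B) lin_bigsum // linear_sum.
rewrite (reindex_onto (@enum_val I I) (@enum_rank I)) => [|k _]; last exact: enum_rankK.
apply: eq_big => [k|k _]; first by rewrite enum_valK eqxx.
by rewrite !mxE linZ // linearZ; apply: mulrC.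
Qed.

Lemma mxrep_id : mxrep id = 1%:M.
Proof.
by apply/matrixP => i j; rewrite !mxE bcoordE (inj_eq enum_val_inj).
Qed.

Lemma mxtrace_mxrep F : \tr (mxrep F) = trace F.
Proof.
rewrite /trace (reindex_onto (@enum_val I I) (@enum_rank I)) => [|k _]; last exact: enum_rankK.
apply: eq_big => [k|k _]; first by rewrite enum_valK eqxx.
by rewrite mxE.
Qed.

Lemma mxrep_inj F G : lin F -> lin G -> mxrep F = mxrep G -> F =1 G.
Proof.
move=> lF lG /matrixP E z; rewrite [z](bvecE B) !lin_bigsum //.
apply: eq_bigr => i _; rewrite !linZ //; congr (_ *: _); apply: coord_ext => j.
by have := E (enum_rank j) (enum_rank i); rewrite !mxE !enum_rankK.
Qed.

Lemma eq_mxrep F G : F =1 G -> mxrep F = mxrep G.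
Proof. by move=> E; apply/matrixP => i j; rewrite !mxE E. Qed.

Lemma traceC F G : lin F -> lin G -> trace (fun z => F (G z)) = trace (fun z => G (F z)).
Proof. by move=> lF lG; rewrite -[LHS]mxtrace_mxrep -[RHS]mxtrace_mxrep (mxrepM G lF) (mxrepM F lG) mxtrace_mulC. Qed.

Lemma trace_lin (W : lmodType K) (F : W -> Z -> Z) : (forall z, lin (fun w => F w z)) ->
  lin (fun w => trace (F w) : K^o).
Proof. by move=> lF; apply: lin_sum => i; apply: lin_app. Qed.

Lemma mxrep_inv F G : lin F -> (forall z, F (G z) = z) -> mxrep F *m mxrep G = 1%:M.
Proof. by move=> lF FG; rewrite -mxrepM // -mxrep_id; apply: eq_mxrep. Qed.

Definition crow (z : Z) : 'rV[K]_#|I| := \row_i bcoord B (enum_val i) z.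

Lemma crow_mxrep (F : Z -> Z) z : lin F -> crow z *m (mxrep F)^T = crow (F z).
Proof.
move=> lF; apply/rowP => i; rewrite !mxE [in RHS](bvecE B z) lin_bigsum // linear_sum.
rewrite [RHS](reindex_onto (@enum_val I I) (@enum_rank I)) => [|k _]; last exact: enum_rankK.
apply: eq_big => [k|k _]; first by rewrite enum_valK eqxx.
by rewrite !mxE linZ // linearZ.
Qed.

Lemma crow_inj : injective crow.
Proof.
move=> z z' /rowP E; apply: coord_ext => i.
by have := E (enum_rank i); rewrite !mxE enum_rankK.
Qed.

Lemma crow0 : crow 0 = 0.
Proof. by apply/rowP => i; rewrite !mxE linear0. Qed.

Lemma crowZ c z : crow (c *: z) = c *: crow z.
Proof. by apply/rowP => i; rewrite !mxE linearZ. Qed.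

Definition of_crow (u : 'rV[K]_#|I|) : Z := \sum_i u 0 (enum_rank i) *: bvec B i.

Lemma of_crowK u : crow (of_crow u) = u.
Proof.
apply/rowP => i; rewrite mxE -[in RHS](enum_valK i); move: (enum_val i) => j.
rewrite linear_sum (bigD1 j) //= linearZ [X in X + _]/= bcoordE eqxx [X in X + _]mulr1.
by rewrite big1 ?addr0 // => k /negPf kj; rewrite linearZ /= bcoordE eq_sym kj [LHS]mulr0.
Qed.

Lemma linear_injective_surjective (F : Z -> Z) : lin F -> (forall z, F z = 0 -> z = 0) ->
  forall z, exists z', F z' = z.
Proof.
move=> lF injF z.
have uF : (mxrep F)^T \in unitmx.
  rewrite -row_free_unit; apply: inj_row_free => v; rewrite -[v]of_crowK crow_mxrep // => F0.
  by rewrite [of_crow v]injF ?crow0 //; apply: crow_inj; rewrite F0 crow0.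
exists (of_crow (crow z *m invmx (mxrep F)^T)); apply: crow_inj.
by rewrite -crow_mxrep // of_crowK mulmxKV.
Qed.

End Trace.

Section TensorBasis.
Variables (K : fieldType) (U V : lmodType K) (I J : finType) (B : basis U I) (C : basis V J).

Definition tcoord_fun (ij : I * J) : U ⊗ V -> K^o :=
  tlift (fun u v => (bcoord B ij.1 u : K^o) * bcoord C ij.2 v : K^o).

Lemma tcoord_bil ij : bil (fun u v => (bcoord B ij.1 u : K^o) * bcoord C ij.2 v : K^o).
Proof.
by split=> ?; [apply: (@lin_mull K _ K^o) | apply: (@lin_mulr K _ K^o)]; apply: lin_app.
Qed.

Lemma tcoord_lin ij : lin (tcoord_fun ij).
Proof. by apply: lin_tlift => //; apply: tcoord_bil. Qed.

Definition tensor_basis : basis (U ⊗ V) (I * J)%type.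
Proof.
apply: (@Basis _ _ _ (fun ij => tens (bvec B ij.1) (bvec C ij.2)) (fun ij => mklin (tcoord_lin ij))).
  apply: (@tens_ext _ _ _ _ (fun z => z)) => // [|u v].
    by apply: lin_sum => ij; apply: lin_scalel; apply: tcoord_lin.
  rewrite {1}[u](bvecE B) {1}[v](bvecE C).
  rewrite (lin_bigsum (f := fun u => tens u _)); last by lin.
  rewrite -(pair_bigA _ (fun i j => (tcoord_fun (i, j) (tens u v) : K) *: tens (bvec B i) (bvec C j))) /=.
  apply: eq_bigr => i _; rewrite (linZ (f := fun u => tens u _)); last by lin.
  rewrite (lin_bigsum (f := fun v => tens _ v)); last by lin.
  rewrite scaler_sumr; apply: eq_bigr => j _; rewrite (linZ (f := fun v => tens _ v)); last by lin.
  by rewrite scalerA /tcoord_fun (tliftE _ _ (tcoord_bil (i, j))).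
move=> [i j] [k l] /=; rewrite /tcoord_fun (tliftE _ _ (tcoord_bil (i, j))) /=.
by rewrite !bcoordE xpair_eqE -natrM mulnb.
Defined.

Lemma trace_tensor (F : U -> V -> U ⊗ V) : bil F ->
  trace tensor_basis (tlift F) = \sum_i \sum_j
    tlift (fun u v => (bcoord B i u : K^o) * bcoord C j v : K^o) (F (bvec B i) (bvec C j)).
Proof.
move=> bF; rewrite pair_bigA; apply: eq_bigr => -[i j] _ /=.
by rewrite tliftE.
Qed.

End TensorBasis.

Section HasDim.
Variable K : fieldType.

Lemma has_dim_basis (V : lmodType K) n : has_dim V n -> exists _ : basis V 'I_n, True.
Proof.
case=> -[r rlin [r' rK r'K]].
have r'lin : lin r' by move=> k x y; rewrite -{1}[x]r'K -{1}[y]r'K -rlin rK.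
have clin i : lin (fun v => r v 0 i : K^o).
  by move=> k x y; rewrite rlin !mxE.
unshelve eexists; last by [].
apply: (@Basis _ _ _ (fun i => r' (delta_mx 0 i)) (fun i => mklin (clin i))).
  move=> v; rewrite -{1}[v]rK {1}[r v]row_sum_delta lin_bigsum //.
  by apply: eq_bigr => i _; rewrite linZ.
by move=> i j; rewrite /= r'K mxE eqxx.
Qed.

Lemma lin_entry n (i : 'I_n) : lin (fun v : 'rV[K]_n => v 0 i : K^o).
Proof. by move=> k x y; rewrite !mxE. Qed.

Definition rV_basis n : basis 'rV[K]_n 'I_n.
Proof.
apply: (@Basis _ _ _ (fun i => delta_mx 0 i) (fun i => mklin (lin_entry i))).
  by move=> v; rewrite {1}[v]row_sum_delta.
by move=> i j; rewrite /= mxE eqxx.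
Defined.

End HasDim.

(** * The Frobenius structure defined by an integral *)

Section Frobenius.
Variables (K : fieldType) (H : algType K) (hopfH : hopf_structure H).
Variables (I : finType) (B : basis H I).
Variables (L : H) (intL : left_integral hopfH L).

Local Notation S := (antipode hopfH).
Local Notation eps := (counit hopfH).
Local Notation sw := (sw hopfH).

(** The trace of z |-> S(S(z) h), which is an integral on H ([lam_right]). *)
Definition lam_fun (h : H) : K^o := \sum_i bcoord B i (S (S (bvec B i) * h)).

Lemma lam_lin : lin lam_fun.
Proof. by apply: lin_sum => i; lin. Qed.

Definition lam : {linear H -> K^o} := mklin lam_lin.

(** The vectors L2 and the forms lam(S(-) L1) are dual bases.  For h = 1,
    moving the basis vectors in the trace lam across L with [sw_integral_mulr]
    gives S(L1) L2 = 1; the general case follows by moving h across L. *)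
Lemma lam_frame h : sw L (fun a b => lam (S h * a) *: b) = h.
Proof.
case: intL => eL lL.
have lam1 : sw L (fun a b => lam a *: b) = 1.
  transitivity (sw L (fun a b => \sum_i bcoord B i (S (S (bvec B i) * a)) *: b)).
    by apply: eq_sw => a b; rewrite scaler_suml.
  transitivity (\sum_i sw L (fun a b => bcoord B i (S (S (bvec B i) * a)) *: b)).
    exact: exchange_big.
  transitivity (\sum_i sw L (fun a b => bcoord B i (S a) *: (bvec B i * b))).
    apply: eq_bigr => i _.
    by rewrite (sw_integral_mulr intL _ (F := fun a b => bcoord B i (S a) *: b)) //; lin.
  transitivity (sw L (fun a b => S a * b)).
    transitivity (sw L (fun a b => \sum_i bcoord B i (S a) *: (bvec B i * b))).
      exact: exchange_big.
    apply: eq_sw => a b; rewrite {2}[S a](bvecE B) mulr_suml.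
    by apply: eq_bigr => i _; rewrite scalerAl.
  by rewrite (sw_Sl (fun z => z)) ?eL ?scale1r.
rewrite -(sw_integral_mulr intL h (F := fun a b => lam a *: b)); last by lin.
transitivity (h * sw L (fun a b => lam a *: b)); last by rewrite lam1 mulr1.
by rewrite (sw_lin (fun z => h * z)) //; [apply: eq_sw => a b; rewrite scalerAr | lin].
Qed.

(** The map that sends a functional f to f(L1) L2 is onto by [lam_frame], and
    its source and target have the same dimension.  This lemma is used to
    verify identities between functionals. *)
Lemma integral_inj (f f' : H -> K^o) : lin f -> lin f' ->
  sw L (fun a b => f a *: b) = sw L (fun a b => f' a *: b) -> f =1 f'.
Proof.
(* G and G' are the map f |-> f(L1) L2 and the right inverse from [lam_frame],
   with functionals identified with vectors by the dual basis. *)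
pose G z := sw L (fun a b => (\sum_i bcoord B i z *: bcoord B i a) *: b).
pose dual (p : H -> K^o) := \sum_i p (bvec B i) *: bvec B i.
have dualE p z : lin p -> \sum_i bcoord B i (dual p) *: bcoord B i z = p z.
  move=> lp; rewrite {2}[z](bvecE B) lin_bigsum //; apply: eq_bigr => i _.
  rewrite linZ // linear_sum (bigD1 i) //= linearZ /= bcoordE eqxx big1 ?addr0.
    by rewrite [p _ *: _]mulr1; apply: mulrC.
  by move=> j /negPf ji; rewrite linearZ /= bcoordE eq_sym ji; apply: mulr0.
have GE p : lin p -> G (dual p) = sw L (fun a b => p a *: b).
  by move=> lp; apply: eq_sw => a b; rewrite dualE.
have lG : lin G by lin.
pose G' h := dual (fun x => lam (S h * x)).
have lG' : lin G' by lin.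
have GG' h : G (G' h) = h by rewrite GE ?lam_frame //; lin.
have G'G z : G' (G z) = z.
  have /mulmx1C E := mxrep_inv B lG GG'.
  apply: (mxrep_inj (B := B) (F := fun z => G' (G z)) (G := id)) => //; first by lin.
  by rewrite (mxrepM B G lG') E mxrep_id.
move=> lf lf' FE x; rewrite -(dualE f x) // -(dualE f' x) //.
by rewrite -(G'G (dual f)) -(G'G (dual f')) !GE // FE.
Qed.

Lemma lam1 : sw L (fun a b => lam a *: b) = 1.
Proof. by rewrite -[RHS]lam_frame; apply: eq_sw => a b; rewrite antipode1 mul1r. Qed.

Lemma lam_integral : lam L = 1.
Proof.
have := congr1 (counit hopfH) lam1; rewrite counit1 => <-.
rewrite (sw_lin (eps)); last by lin.
rewrite -[LHS](sw_epsr (hopfH := hopfH) (h := L) lam); last by lin.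
by apply: eq_sw => a b; rewrite linearZ; apply: mulrC.
Qed.

(** Both sides have the same image under f |-> f(L1) L2. *)
Lemma lam_right (W : lmodType K) h (G : H -> W) : lin G ->
  sw h (fun a b => lam a *: G b) = lam h *: G 1.
Proof.
move=> lG; transitivity (G (sw h (fun a b => lam a *: b))).
  by rewrite (sw_lin (G)) //; apply: eq_sw => a b; rewrite linZ.
rewrite -linZ //; congr (G _); apply: (coord_ext (B := B)) => i.
pose k := bcoord B i; rewrite -/k (sw_lin (k)); last by lin.
rewrite linearZ /=.
pose f1 h := sw h (fun a b => k (lam a *: b)); pose f2 h := lam h *: k 1.
have lf1 : lin f1 by lin.
have lf2 : lin f2 by lin.
apply: (integral_inj lf1 lf2).
transitivity (sw L (fun c t => sw t (fun d b => k (lam c *: d) *: b))).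
  rewrite -(swA (fun c d b => k (lam c *: d) *: b)); last by lin.
  by apply: eq_sw => a b; rewrite sw_scale.
transitivity (sw (sw L (fun c t => lam c *: t)) (fun d b => k d *: b)).
  rewrite (sw_lin (fun z => sw z (fun d b => k d *: b))); last by lin.
  apply: eq_sw => c t; rewrite (linZ (f := fun z => sw z (fun d b => k d *: b))); last by lin.
  rewrite (sw_lin (fun z : H => (lam c : K) *: z)); last by lin.
  by apply: eq_sw => d b; rewrite linearZ scalerA.
rewrite lam1 sw1; last by lin.
transitivity (k 1 *: sw L (fun c t => lam c *: t)); first by rewrite lam1.
rewrite (sw_lin (fun z : H => (k 1 : K) *: z)); last by lin.
by apply: eq_sw => a b; rewrite scalerA mulrC.
Qed.

Lemma antipode_inj : injective S.
Proof.
move=> x y Sxy; rewrite -[x]lam_frame -[y]lam_frame.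
by apply: eq_sw => a b; rewrite Sxy.
Qed.

(** An injective endomorphism of a finite dimensional space is onto. *)
Lemma antipode_surj y : exists x, S x = y.
Proof.
apply: (linear_injective_surjective B) => [|z Sz]; first by lin.
by apply: antipode_inj; rewrite Sz linear0.
Qed.

(** S(L) is a right integral, and the product S(L) L can be evaluated from both
    sides. *)
Lemma integral_antipode : S L = L.
Proof.
case: intL => eL lL.
have SLx x : S L * x = eps x *: S L.
  have [y <-] := antipode_surj x.
  by rewrite -antipodeM lL linearZ counit_antipode.
by have := SLx L; rewrite eL scale1r lL counit_antipode eL scale1r => <-.
Qed.

(** H is unimodular: the antipode exchanges left and right integrals and fixes
    L. *)
Lemma integral_right h : L * h = eps h *: L.
Proof.
case: intL => eL lL; have [y <-] := antipode_surj h.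
by rewrite -{1}integral_antipode -antipodeM lL linearZ counit_antipode /= integral_antipode.
Qed.

(** The mirror image of [sw_integral_mulr] for the right integral L. *)
Lemma sw_integral_mull (W : lmodType K) h (F : H -> H -> W) : bil F ->
  sw L (fun a b => F (a * h) b) = sw L (fun a b => F a (b * S h)).
Proof.
move=> hF.
transitivity (sw h (fun p q => sw (L * p) (fun a b => F a (b * S q)))).
  under [RHS]eq_sw => p q do (rewrite swM; [rewrite swC | by lin]).
  rewrite (swA (fun c d q => sw L (fun a b => F (a * c) (b * d * S q)))); last by lin.
  transitivity (sw h (fun c m => eps m *: sw L (fun a b => F (a * c) b))).
    by rewrite (sw_epsr (fun c => sw L (fun a b => F (a * c) b))) //; lin.
  apply: eq_sw => c m; under [RHS]eq_sw => d q do under eq_sw => a b do rewrite -mulrA.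
  rewrite (sw_Sr (fun u => sw L (fun a b => F (a * c) (b * u)))); last by lin.
  by congr (_ *: _); apply: eq_sw => a b; rewrite mulr1.
transitivity (sw h (fun p q => eps p *: sw L (fun a b => F a (b * S q)))).
  apply: eq_sw => p q; rewrite integral_right.
  by rewrite (linZ (f := fun z => sw z (fun a b => F a (b * S q)))) //; lin.
by rewrite (sw_epsl (fun q => sw L (fun a b => F a (b * S q)))) //; lin.
Qed.

Lemma lam_frame_right h : sw L (fun a b => lam (a * h) *: b) = S h.
Proof.
rewrite (sw_integral_mull h (F := fun a b => lam a *: b)); last by lin.
rewrite -[RHS]mul1r -lam1 (sw_lin (fun z => z * S h)); last by lin.
by apply: eq_sw => a b; rewrite scalerAl.
Qed.

(** The square of the antipode is the Nakayama automorphism of lam. *)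
Lemma lam_nakayama x h : lam (x * h) = lam (S (S h) * x).
Proof.
pose f1 x := lam (x * h); pose f2 x := lam (S (S h) * x).
have lf1 : lin f1 by lin.
have lf2 : lin f2 by lin.
by apply: (integral_inj lf1 lf2); rewrite lam_frame lam_frame_right.
Qed.

(** The modular element, by which lam fails to be an integral on the other side
    ([lam_left]). *)
Definition gmod := sw L (fun a b => lam b *: a).

Lemma lam_left (W : lmodType K) h (G : H -> W) : lin G ->
  sw h (fun a b => lam b *: G a) = lam h *: G gmod.
Proof.
move=> lG; transitivity (G (sw h (fun a b => lam b *: a))).
  by rewrite (sw_lin (G)) //; apply: eq_sw => a b; rewrite linZ.
rewrite -linZ //; congr (G _); apply: (coord_ext (B := B)) => i.
pose k := bcoord B i; rewrite -/k (sw_lin (k)); last by lin.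
rewrite linearZ /=.
pose f1 h := sw h (fun a b => k (lam b *: a)); pose f2 h := lam h *: k gmod.
have lf1 : lin f1 by lin.
have lf2 : lin f2 by lin.
apply: (integral_inj lf1 lf2).
transitivity (sw L (fun c t => sw t (fun d b => k c *: (lam d *: b)))).
  rewrite -(swA (fun c d b => k c *: (lam d *: b))); last by lin.
  apply: eq_sw => a b; rewrite sw_scale; apply: eq_sw => c d.
  by rewrite scalerA linearZ mulrC.
transitivity (sw L (fun c t => k c *: (lam t *: (1 : H)))).
  apply: eq_sw => c t; rewrite -(lam_right t (G := id)) //.
  by rewrite (sw_lin (fun z : H => (k c : K) *: z)) //; lin.
transitivity (k gmod *: sw L (fun c t => lam c *: t)).
  rewrite lam1 /gmod (sw_lin (k)) // ?sw_scale; last by lin.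
  by apply: eq_sw => a b; rewrite scalerA linearZ mulrC.
rewrite (sw_lin (fun z : H => (k gmod : K) *: z)); last by lin.
by apply: eq_sw => a b; rewrite scalerA mulrC.
Qed.

Lemma gmod_grouplike (W : lmodType K) (F : H -> H -> W) : bil F ->
  sw gmod F = F gmod gmod.
Proof.
move=> hF; rewrite {1}/gmod (sw_lin (fun z => sw z F)); last by lin.
transitivity (sw L (fun a b => sw b (fun d c => lam c *: F a d))).
  rewrite -(swA (fun a d c => lam c *: F a d)); last by lin.
  apply: eq_sw => a b; rewrite (linZ (f := fun z => sw z F)); last by lin.
  by rewrite (sw_lin (fun z : W => (lam b : K) *: z)) //; lin.
transitivity (sw L (fun a b => lam b *: F a gmod)).
  by apply: eq_sw => a b; rewrite (lam_left b (G := F a)) //; lin.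
by rewrite (lam_left L (G := fun a => F a gmod)) ?lam_integral ?scale1r //; lin.
Qed.

Lemma counit_gmod : eps gmod = 1.
Proof.
rewrite /gmod (sw_lin (eps)); last by lin.
rewrite -lam_integral -[RHS](sw_epsl (hopfH := hopfH) (h := L) lam); last by lin.
by apply: eq_sw => a b; rewrite linearZ; apply: mulrC.
Qed.

Lemma lam_gmod h : sw L (fun a b => lam (h * b) *: a) = S h * gmod.
Proof.
rewrite (sw_integral_mulr intL h (F := fun a b => lam b *: a)); last by lin.
rewrite /gmod (sw_lin (fun z => S h * z)); last by lin.
by apply: eq_sw => a b; rewrite scalerAr.
Qed.

(** Radford's formula for the fourth power of the antipode of a unimodular Hopf
    algebra. *)
Lemma antipode4 h : gmod * h = S (S (S (S h))) * gmod.
Proof.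
rewrite -lam_gmod {1}/gmod (sw_lin (fun z => z * h)); last by lin.
transitivity (sw L (fun a b => lam b *: (a * h))).
  by apply: eq_sw => a b; rewrite scalerAl.
rewrite (sw_integral_mull h (F := fun a b => lam b *: a)); last by lin.
by apply: eq_sw => a b; rewrite lam_nakayama.
Qed.

(** Every functional has the form lam(S(h) -), so it suffices to compare the
    two sides with such a functional applied to one factor; there the left side
    is given by [lam_gmod]. *)
Lemma integral_flip (W : lmodType K) (F : H -> H -> W) : bil F ->
  sw L (fun a b => F b a) = sw L (fun a b => F a (S (S b) * gmod)).
Proof.
move=> hF.
have key (f : H -> K^o) (G : H -> W) : lin f -> lin G ->
    sw L (fun a b => f b *: G a) = sw L (fun a b => f a *: G (S (S b) * gmod)).
  move=> lf lG.
  pose h := sw L (fun a b => f a *: b).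
  have lf' : lin (fun x => lam (S h * x)) by lin.
  have fE : f =1 fun x => lam (S h * x) by apply: (integral_inj lf lf'); rewrite lam_frame.
  transitivity (G (sw L (fun a b => lam (S h * b) *: a))).
    by rewrite (sw_lin (G)) //; apply: eq_sw => a b; rewrite fE linZ.
  rewrite lam_gmod /h !(sw_lin (fun z => G (S (S z) * gmod))) //; last by lin.
  by apply: eq_sw => a b; rewrite !linearZ -scalerAl linZ.
transitivity (\sum_i sw L (fun a b => bcoord B i b *: F (bvec B i) a)).
  transitivity (sw L (fun a b => \sum_i bcoord B i b *: F (bvec B i) a)).
    apply: eq_sw => a b; rewrite {1}[b](bvecE B) (lin_bigsum (f := fun z => F z a)); last by lin.
    by apply: eq_bigr => i _; rewrite (linZ (f := fun z => F z a)) //; lin.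
  exact: exchange_big.
transitivity (\sum_i sw L (fun a b => bcoord B i a *: F (bvec B i) (S (S b) * gmod))).
  by apply: eq_bigr => i _; apply: (key _ (F (bvec B i))); lin.
transitivity (sw L (fun a b => \sum_i bcoord B i a *: F (bvec B i) (S (S b) * gmod))).
  exact: exchange_big.
apply: eq_sw => a b; rewrite {2}[a](bvecE B) (lin_bigsum (f := fun z => F z _)); last by lin.
by apply: eq_bigr => i _; rewrite (linZ (f := fun z => F z _)) //; lin.
Qed.

End Frobenius.

(** * Matrix representations *)

(** The matrix of h acts on row vectors from the right, which explains the
    order of the factors in [repM]. *)
Record rep (K : fieldType) (H : algType K) (n : nat) := Rep {
  rep_fun :> {linear H -> 'M[K]_n};
  rep1 : rep_fun 1 = 1%:M;
  repM : forall x y, rep_fun (x * y) = rep_fun y *m rep_fun x }.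

Section Reps.
Variables (K : fieldType) (H : algType K).

Definition stable n (r : rep H n) m (X : 'M[K]_(m, n)) := forall h, stablemx X (r h).

Definition irreducible n (r : rep H n) : Prop :=
  (0 < n)%N /\ forall m (X : 'M[K]_(m, n)), stable r X -> X != 0 -> row_full X.

Definition subrep n (r : rep H n) m (q : rep H m) : Prop :=
  exists2 X : 'M[K]_(m, n), row_free X & forall h, X *m r h = q h *m X.

Lemma subrep_refl n (r : rep H n) : subrep r r.
Proof. by exists 1%:M => [|h]; rewrite ?row_free_unit ?unitmx1 // mul1mx mulmx1. Qed.

Lemma subrep_trans n (r : rep H n) m (q : rep H m) k (p : rep H k) :
  subrep r q -> subrep q p -> subrep r p.
Proof.
move=> [X fX rX] [Y fY qY]; exists (Y *m X) => [|h].
  by rewrite /row_free mxrankMfree.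
by rewrite -mulmxA rX mulmxA qY mulmxA.
Qed.

Definition restr_fun n (r : rep H n) m (X : 'M[K]_(m, n)) (h : H) := conjmx X (r h).

Lemma restr_lin n (r : rep H n) m (X : 'M[K]_(m, n)) : lin (restr_fun r X).
Proof. by rewrite /restr_fun /conjmx; lin. Qed.

Lemma restr1 n (r : rep H n) m (X : 'M[K]_(m, n)) : row_free X ->
  mklin (restr_lin r X) 1 = 1%:M.
Proof. by move=> fX; rewrite mklinE /restr_fun rep1 conjmx_scalar. Qed.

Lemma restrM n (r : rep H n) m (X : 'M[K]_(m, n)) : stable r X -> forall x y,
  mklin (restr_lin r X) (x * y) = mklin (restr_lin r X) y *m mklin (restr_lin r X) x.
Proof. by move=> sX x y; rewrite !mklinE /restr_fun repM conjmxM ?inE ?sX. Qed.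

(** The representation on the row space of X in the basis given by the rows of
    X. *)
Definition restr n (r : rep H n) m (X : 'M[K]_(m, n)) (fX : row_free X) (sX : stable r X) : rep H m :=
  Rep (restr1 r fX) (restrM sX).

Lemma restrE n (r : rep H n) m (X : 'M[K]_(m, n)) (fX : row_free X) (sX : stable r X) h :
  X *m r h = restr fX sX h *m X.
Proof. by rewrite /= /restr_fun /conjmx mulmxKpV // sX. Qed.

Lemma restr_subrep n (r : rep H n) m (X : 'M[K]_(m, n)) (fX : row_free X) (sX : stable r X) :
  subrep r (restr fX sX).
Proof. by exists X => // h; apply: restrE. Qed.

Lemma stable_row_base n (r : rep H n) m (X : 'M[K]_(m, n)) : stable r X -> stable r (row_base X).
Proof. by move=> sX h; rewrite stablemx_row_base. Qed.

Lemma stable_comm_ker n (r : rep H n) m (A : 'M[K]_(n, m)) :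
  (forall h, exists Ah, r h *m A = A *m Ah) -> stable r (kermx A).
Proof.
move=> rA h; have [Ah E] := rA h.
by apply/sub_kermxP; rewrite -mulmxA E mulmxA mulmx_ker mul0mx.
Qed.

Lemma irreducible_or n (r : rep H n) : (0 < n)%N ->
  irreducible r \/ exists m (X : 'M[K]_(m, n)), [/\ row_free X, stable r X, (0 < m)%N & (m < n)%N].
Proof.
move=> n0; have [irr|nirr] := pselect (irreducible r); [by left | right].
apply: contrapT => none; case: nirr; split=> // m X sX X0.
apply/negP => /negP nfull; apply: none.
exists (\rank X), (row_base X); split.
- exact: row_base_free.
- exact: stable_row_base.
- by rewrite lt0n mxrank_eq0.
- by rewrite ltn_neqAle rank_leq_col andbT.
Qed.

Lemma irreducible_subrep n (r : rep H n) : (0 < n)%N ->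
  exists m (q : rep H m), irreducible q /\ subrep r q.
Proof.
have [k] := ubnP n; elim: k n r => // k IHk n r nk n0.
have [irr|[m [X [fX sX m0 mn]]]] := irreducible_or r n0.
  by exists n, r; split=> //; apply: subrep_refl.
have [|p [q [iq sq]]] := IHk m (restr fX sX) _ m0; first exact: leq_trans mn _.
by exists p, q; split=> //; apply: subrep_trans sq; apply: restr_subrep.
Qed.

Lemma trace_complement n (r : rep H n) m1 m2 (X : 'M[K]_(m1, n)) (Y : 'M[K]_(m2, n))
    (fX : row_free X) (fY : row_free Y) (sX : stable r X) (sY : stable r Y) h :
  (X :&: Y = 0)%MS -> row_full (X + Y)%MS ->
  \tr (r h) = \tr (restr fX sX h) + \tr (restr fY sY h).
Proof.
move=> XY0 XYf.
have nE : (m1 + m2)%N = n.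
  have := mxrank_sum_cap X Y; rewrite XY0 mxrank0 addn0 (eqP XYf).
  by rewrite (eqP fX) (eqP fY).
case: n / nE r X Y fX fY sX sY XY0 XYf => r X Y fX fY sX sY XY0 XYf.
pose P := col_mx X Y.
have uP : P \in unitmx.
  by rewrite -row_full_unit /row_full /P -addsmxE; exact: XYf.
have PE : P *m r h = block_mx (restr fX sX h) 0 0 (restr fY sY h) *m P.
  by rewrite mul_col_mx mul_block_col !mul0mx addr0 add0r -!restrE.
transitivity (\tr (P *m r h *m invmx P)).
  by rewrite mxtrace_mulC mulmxA mulVmx // mul1mx.
by rewrite PE mulmxK // mxtrace_block.
Qed.

Lemma mxtrace_repC n (r : rep H n) x y : \tr (r (x * y)) = \tr (r (y * x)).
Proof. by rewrite !repM mxtrace_mulC. Qed.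

End Reps.

Section Schur.
Variables (K : closedFieldType) (H : algType K).

Lemma schur n (r : rep H n) (A : 'M[K]_n) : irreducible r ->
  (forall h, comm_mx A (r h)) -> exists a, A = a%:M.
Proof.
case: n r A => [|n] r A [n0 irr] // comA.
have [a Aa] := eigenvalue_exists A; exists a.
have full : row_full (eigenspace A a).
  by apply: irr => // h; apply: comm_mx_stable_eigenspace; apply: comA.
apply: (row_full_inj full).
by rewrite (eigenspaceP (submx_refl _)) mul_mx_scalar.
Qed.

End Schur.

Section Maschke.
Variables (K : fieldType) (H : algType K) (hopfH : hopf_structure H).
Variables (I : finType) (B : basis H I).
Variables (L : H) (intL : left_integral hopfH L).

Local Notation S := (antipode hopfH).
Local Notation sw := (sw hopfH).

(** Averaging a projection Q onto X over the integral gives a projection p onto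
    X that commutes with H; its kernel is the complement. *)
Lemma maschke n (r : rep H n) m (X : 'M[K]_(m, n)) : stable r X ->
  exists Y : 'M[K]_n, [/\ stable r Y, (X :&: Y = 0)%MS & row_full (X + Y)%MS].
Proof.
move=> sX.
have [Q QX XQ] : exists2 Q : 'M[K]_n, (Q <= X)%MS & forall k (W : 'M_(k, n)), (W <= X)%MS -> W *m Q = W.
  exists (pinvmx X *m X) => [|k W WX]; first exact: submxMl.
  by rewrite mulmxA mulmxKpV.
pose p : 'M[K]_n := sw L (fun a b => r (S b) *m Q *m r a).
have comp h : p *m r h = r h *m p.
  have [x <-] := antipode_surj B intL h.
  rewrite (sw_lin (fun z => z *m r (S x))); last by lin.
  rewrite (sw_lin (fun z => r (S x) *m z)); last by lin.
  transitivity (sw L (fun a b => r (S b) *m Q *m r (S x * a))).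
    by apply: eq_sw => a b; rewrite repM !mulmxA.
  rewrite -(sw_integral_mulr intL x (F := fun a b => r (S b) *m Q *m r a)); last by lin.
  by apply: eq_sw => a b; rewrite antipodeM repM !mulmxA.
have Xp : X *m p = X.
  rewrite (sw_lin (fun z => X *m z)); last by lin.
  transitivity (sw L (fun a b => X *m r (a * S b))).
    by apply: eq_sw => a b; rewrite repM !mulmxA XQ // sX.
  rewrite (sw_Sr (fun z => X *m r z)); last by lin.
  by case: intL => -> _; rewrite rep1 mulmx1 scale1r.
have pX : (p <= X)%MS.
  have closed (s : seq (H * H)) : ((\sum_(c <- s) r (S c.2) *m Q *m r c.1)%R <= X)%MS.
    elim: s => [|c s IHs]; first by rewrite big_nil sub0mx.
    rewrite big_cons; apply: addmx_sub => //; rewrite -mulmxA.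
    exact: submx_trans (submxMl _ _) (submx_trans (submxMr _ QX) (sX _)).
  exact: closed.
have fix_p v : (v <= X)%MS -> v *m p = v.
  by case/submxP => w ->; rewrite -mulmxA Xp.
exists (kermx p); split.
- by apply: stable_comm_ker => h; exists (r h); rewrite comp.
- apply/eqP; rewrite -submx0; apply/rV_subP => v; rewrite sub_capmx => /andP[vX /sub_kermxP vp].
  by rewrite -(fix_p _ _ vX) vp sub0mx.
- rewrite -sub1mx -[1%:M](subrK p) addrC; apply: addmx_sub_adds => //.
  by apply/sub_kermxP; rewrite mulmxBl mul1mx (fix_p _ _ pX) subrr.
Qed.

(** The sequence s lists the simple constituents of r, each of which occurs as
    a submodule. *)
Lemma character_decomposition n (r : rep H n) : exists s : seq {m & rep H m},
  all (fun q => `[< irreducible (projT2 q) /\ subrep r (projT2 q) >]) s /\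
  forall h, \tr (r h) = \sum_(q <- s) \tr (projT2 q h).
Proof.
have [k] := ubnP n; elim: k n r => // k IHk n r nk.
have [n0|n0] := posnP n.
  exists [::]; split=> // h; rewrite big_nil /mxtrace big1 // => i _.
  by have := ltn_ord i; rewrite {2}n0.
have [irr|[m [X [fX sX m0 mn]]]] := irreducible_or r n0.
  exists [:: existT _ n r]; split=> [|h]; last by rewrite big_seq1.
  by rewrite /= andbT; apply/asboolP; split=> //; apply: subrep_refl.
have [Y [sY XY0 XYf]] := maschke sX.
have rY : (\rank Y < n)%N.
  have := mxrank_sum_cap X Y; rewrite XY0 mxrank0 addn0 (eqP XYf) (eqP fX) => E.
  by rewrite [X in (_ < X)%N]E -[X in (X < _)%N]add0n ltn_add2r.
have fY : row_free (row_base Y) by exact: row_base_free.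
have sY' : stable r (row_base Y) by exact: stable_row_base.
have [|s1 [s1P s1E]] := IHk _ (restr fX sX); first exact: leq_trans mn _.
have [|s2 [s2P s2E]] := IHk _ (restr fY sY'); first exact: leq_trans rY _.
exists (s1 ++ s2); split=> [|h].
  rewrite all_cat; apply/andP; split; [apply: sub_all s1P | apply: sub_all s2P];
    move=> q /asboolP[iq sq]; apply/asboolP; split=> //.
    exact: subrep_trans (restr_subrep fX sX) sq.
  exact: subrep_trans (restr_subrep fY sY') sq.
rewrite big_cat -s1E -s2E; apply: trace_complement.
  by apply/eqP; rewrite -submx0 -XY0 capmxS // eq_row_base.
rewrite -sub1mx (submx_trans _ (addsmxS (submx_refl X) (_ : (Y <= row_base Y)%MS))) ?sub1mx //.
by rewrite eq_row_base.
Qed.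

(** The transpose turns left multiplication into an action on rows of
    coordinates. *)
Lemma regular_rep : exists r : rep H #|I|, forall h, r h = (mxrep B (fun x => h * x))^T.
Proof.
have rl : lin (fun h => (mxrep B (fun x => h * x))^T).
  by move=> k x y; apply/matrixP => i j; rewrite !mxE mulrDl -scalerAl linearP.
have r1 : mklin rl 1 = 1%:M.
  rewrite mklinE -(trmx1 _ #|I|) -(mxrep_id B); congr (_^T).
  by apply: eq_mxrep => x; rewrite mul1r.
have rM x y : mklin rl (x * y) = mklin rl y *m mklin rl x.
  rewrite !mklinE -trmx_mul; congr (_^T).
  rewrite -(mxrepM B (fun z => y * z) (F := fun z => x * z)); last by lin.
  by apply: eq_mxrep => z; rewrite mulrA.
by exists (Rep r1 rM).
Qed.

End Maschke.

(** * Grouplike elements *)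

Section Grouplike.
Variables (K : fieldType) (H : algType K) (hopfH : hopf_structure H).
Variables (I : finType) (B : basis H I).

Local Notation S := (antipode hopfH).
Local Notation eps := (counit hopfH).
Local Notation sw := (sw hopfH).

(** Distinct grouplike elements are linearly independent.  In detail, let m be
    minimal such that the power g^m is a combination of the smaller powers.
    Applying a functional to the first factor of the coproduct of g^m, computed
    in two ways, shows that g^m is one of these smaller powers. *)
Lemma grouplike_finite_order (g : H) : eps g = 1 ->
  (forall (W : lmodType K) (F : H -> H -> W), bil F -> sw g F = F g g) ->
  exists2 N, (0 < N)%N & g ^+ N = 1.
Proof.
move=> eg gl.
have glX i (W : lmodType K) (F : H -> H -> W) : bil F -> sw (g ^+ i) F = F (g ^+ i) (g ^+ i).
  elim: i W F => [|i IHi] W F hF; first by rewrite expr0 sw1.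
  rewrite exprSr swM // IHi; last by lin.
  by rewrite gl //; lin.
have egX i : eps (g ^+ i) = 1.
  by elim: i => [|i IHi]; rewrite ?expr0 ?counit1 // exprS counitM eg IHi mulr1.
have gu : g * S g = 1.
  by rewrite -(gl _ (fun a b => a * S b)) ?(sw_Sr id) ?eg ?scale1r //; lin.
have gX0 i : g ^+ i != 0.
  by apply/eqP => /(congr1 eps); rewrite egX linear0 => /eqP; rewrite oner_eq0.
pose indep m := `[< forall c : 'I_m -> K, \sum_i c i *: g ^+ i = 0 -> forall i, c i = 0 >].
have [m [im nim]] : exists m, indep m /\ ~~ indep m.+1.
  have ex : exists m, ~~ indep m.
    exists #|I|.+1; apply/asboolPn => ind.
    pose G : 'M[K]_(#|I|.+1, #|I|) := \matrix_(i, j) bcoord B (enum_val j) (g ^+ i).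
    have fG : row_free G.
      apply: inj_row_free => v vG; apply/rowP => i; rewrite mxE; apply: ind.
      apply: (coord_ext (B := B)) => j; rewrite linear_sum linear0.
      have /rowP/(_ (enum_rank j)) := vG; rewrite !mxE; apply: etrans.
      by apply: eq_bigr => k _; rewrite linearZ !mxE enum_rankK.
    by move: (rank_leq_col G); rewrite (eqP fG) ltnn.
  have [[|m] nm minm] := ex_minnP ex; first by case/asboolPn: nm => c _ [].
  exists m; split=> //; apply: contraT => /minm; by rewrite ltnn.
move/asboolP: im => im.
have [c [c0 [k ck]]] : exists c : 'I_m.+1 -> K, \sum_i c i *: g ^+ i = 0 /\ exists k, c k <> 0.
  apply: contrapT => none; case/asboolPn: nim => c c0 k.
  by apply: contrapT => ck; apply: none; exists c; split=> //; exists k.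
have cm : c ord_max != 0.
  apply/eqP => cm; move: c0; rewrite big_ord_recr /= cm scale0r addr0 => c0.
  have ci := im (fun i => c (widen_ord (leqnSn m) i)) c0.
  case: ck; have [->//|km] := eqVneq k ord_max.
  have kltm : (k < m)%N by rewrite ltn_neqAle -ltnS ltn_ord andbT; apply: contra km => /eqP E; apply/eqP/val_inj.
  by rewrite -(ci (Ordinal kltm)); congr c; apply: val_inj.
pose a i := - (c (widen_ord (leqnSn m) i)) / c ord_max.
have gm : g ^+ m = \sum_(i < m) a i *: g ^+ i.
  apply: (scalerI cm); rewrite scaler_sumr; under eq_bigr do rewrite scalerA mulrCA mulfV // mulr1 scaleNr.
  by rewrite sumrN; apply/eqP; rewrite -addr_eq0 addrC; move: c0; rewrite big_ord_recr /= => ->.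
have [j aj] : exists j : 'I_m, a j != 0.
  apply: contrapT => a0; move: (gX0 m); rewrite gm big1 ?eqxx // => i _.
  by apply/eqP; rewrite scaler_eq0; apply/orP; left; apply/negP => /negP ai; apply: a0; exists i.
have [f fE] := dual_functional j im.
have : f (g ^+ m) *: g ^+ m = f (g ^+ j) *: (a j *: g ^+ j).
  rewrite -(glX m _ (fun x y => f x *: y)); last by lin.
  rewrite gm (lin_bigsum (f := fun z => sw z (fun x y => f x *: y))); last by lin.
  rewrite (bigD1 j) //= big1 ?addr0 => [|i /negPf ij].
    rewrite (linZ (f := fun z => sw z (fun x y => f x *: y))); last by lin.
    by rewrite glX ?scalerA 1?mulrC //; lin.
  rewrite (linZ (f := fun z => sw z (fun x y => f x *: y))); last by lin.
  by rewrite glX ?fE ?ij ?scale0r ?scaler0 //; lin.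
have -> : f (g ^+ m) = a j.
  rewrite gm linear_sum (bigD1 j) //= linearZ /= fE eqxx big1 ?addr0.
    exact: mulr1.
  by move=> i /negPf ij; rewrite linearZ /= fE ij; apply: mulr0.
rewrite fE eqxx scale1r => /(scalerI aj) gmj.
exists (m - j)%N; first by rewrite subn_gt0.
have gXu i : g ^+ i * S g ^+ i = 1.
  elim: i => [|i IHi]; first by rewrite !expr0 mulr1.
  by rewrite exprSr exprS mulrA -[g ^+ i * g * _]mulrA gu mulr1.
by rewrite -[LHS]mulr1 -(gXu j) mulrA -exprD subnK ?gmj // ltnW.
Qed.

End Grouplike.

(** * The element implementing the square of the antipode *)

Section Pivot.
Variables (K : fieldType) (H : algType K) (hopfH : hopf_structure H).
Variables (I : finType) (B : basis H I).
Variables (L : H) (intL : left_integral hopfH L).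

Local Notation S := (antipode hopfH).
Local Notation sw := (sw hopfH).
Local Notation lam := (lam hopfH B).
Local Notation g := (gmod hopfH B L).

(** L2 S(L1), which would be 1 if the antipode were known to be an
    involution. *)
Definition pivot := sw L (fun a b => b * S a).
Local Notation D := pivot.

Lemma pivot_intertwines h : h * D = D * S (S h).
Proof.
rewrite (sw_lin (fun z => h * z)); last by lin.
rewrite (sw_lin (fun z => z * S (S h))); last by lin.
transitivity (sw L (fun a b => (h * b) * S a)); first by apply: eq_sw => a b; rewrite mulrA.
rewrite (sw_integral_mulr intL h (F := fun a b => b * S a)); last by lin.
by apply: eq_sw => a b; rewrite antipodeM mulrA.
Qed.

(** The trace computed with the dual bases of [lam_frame]. *)
Lemma trace_via_integral (F : H -> H) : lin F ->
  trace B F = sw L (fun a b => lam (S (F b) * a)).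
Proof.
move=> lF; rewrite (@trace_frame _ _ _ B _ (repr (comul hopfH L)) snd (fun p h => lam (S h * p.1))) //.
  by move=> p; lin.
by move=> z; rewrite -{1}[z](lam_frame B intL).
Qed.

Lemma regular_character h : trace B (fun x => h * x) = lam (S (h * D)).
Proof.
rewrite trace_via_integral; last by lin.
rewrite (sw_lin (fun z => h * z)); last by lin.
rewrite (sw_lin (fun z => lam (S z))); last by lin.
apply: (@eq_sw _ _ _ K^o) => a b; rewrite !antipodeM (lam_nakayama B intL).
by rewrite !mulrA.
Qed.

Lemma gmod_antipode : g * S g = 1 /\ S g * g = 1.
Proof.
have gl := gmod_grouplike B intL; have eg := counit_gmod B intL.
by rewrite -(gl _ (fun a b => a * S b)) -?(gl _ (fun a b => S a * b)) ?(sw_Sr id) ?(sw_Sl id) ?eg ?scale1r //; lin.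
Qed.

Lemma antipode_gmod2 : S (S g) = g.
Proof.
have [gS Sg] := gmod_antipode.
have /(congr1 (fun z => z * g)) := congr1 S gS.
by rewrite antipodeM antipode1 mul1r -mulrA Sg mulr1.
Qed.

Lemma gmod_pivot : g * D = D * g.
Proof. by rewrite pivot_intertwines antipode_gmod2. Qed.

(** D implements the square of the antipode and g its fourth power, in opposite
    directions. *)
Lemma pivot2_central h : h * (D * D * g) = D * D * g * h.
Proof.
rewrite mulrA mulrA (pivot_intertwines h) -[D * _ * D]mulrA (pivot_intertwines (S (S h))).
by rewrite -!mulrA (antipode4 B intL h).
Qed.

(** The trace of L2 S(L1) is that of S(L1) L2 = 1. *)
Lemma trace_pivot n (r : rep H n) : \tr (r D) = n%:R.
Proof.
rewrite (sw_lin (fun z => \tr (r z) : K^o)); last by move=> k x y; rewrite !linearP.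
transitivity (sw L (fun a b => \tr (r (S a * b)) : K^o)).
  by apply: (@eq_sw _ _ _ K^o) => a b; rewrite mxtrace_repC.
rewrite (sw_Sl (fun z => \tr (r z) : K^o)); last by move=> k x y; rewrite !linearP.
by case: intL => -> _; rewrite scale1r rep1 mxtrace1.
Qed.

(** Flipping the factors of the coproduct of L with [integral_flip] brings in
    factors S(g) and g, which cancel in the trace by [antipode4]. *)
Lemma trace_pivot_gmod n (r : rep H n) : \tr (r (D * g)) = n%:R.
Proof.
have ltr : lin (fun z => \tr (r z) : K^o) by move=> k x y; rewrite !linearP.
have -> : D * g = sw L (fun a b => a * (S g * S (S (S b))) * g).
  rewrite /pivot (integral_flip B intL (F := fun b a => b * S a)); last by lin.
  rewrite (sw_lin (fun z => z * g)); last by lin.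
  by apply: eq_sw => a b; rewrite antipodeM.
rewrite (sw_lin _ ltr).
transitivity (sw L (fun a b => \tr (r (S (S (S (S a * b))))) : K^o)).
  apply: (@eq_sw _ _ _ K^o) => a b.
  rewrite -mulrA mxtrace_repC -!mulrA mxtrace_repC; congr (\tr (r _)).
  rewrite !antipodeM -[RHS]mulr1 -[X in _ = _ * X]gmod_antipode.1 !mulrA.
  rewrite -[_ * g in RHS]mulrA -(antipode4 B intL a) !mulrA //.
rewrite (sw_Sl (fun z => \tr (r (S (S (S z)))) : K^o)); last first.
  by move=> k x y; rewrite !linearP.
by case: intL => -> _; rewrite scale1r !antipode1 rep1 mxtrace1.
Qed.

End Pivot.

(** * Cosemisimplicity *)

Lemma eq_big_all (R : nmodType) (T : Type) (P : pred T) (s : seq T) (F G : T -> R) :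
  all P s -> (forall i, P i -> F i = G i) -> \sum_(i <- s) F i = \sum_(i <- s) G i.
Proof.
move=> + FG; elim: s => [|i s IHs] /=; first by rewrite !big_nil.
by move=> /andP[Pi /IHs E]; rewrite !big_cons E FG.
Qed.

Section Cosemisimple.
Variables (K : closedFieldType) (charK : [pchar K] =i pred0).
Variables (H : algType K) (hopfH : hopf_structure H).
Variables (I : finType) (B : basis H I).
Variables (L : H) (intL : left_integral hopfH L).

Local Notation S := (antipode hopfH).
Local Notation sw := (sw hopfH).
Local Notation lam := (lam hopfH B).
Local Notation g := (gmod hopfH B L).
Local Notation D := (pivot hopfH L).
Local Notation z := (D * D * g).

Let nat0 n : (n%:R == 0 :> K) = (n == 0)%N. Proof. exact: (pcharf0P K).1. Qed.

Lemma central_scalar n (r : rep H n) x : irreducible r -> (forall h, h * x = x * h) ->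
  exists s, r x = s%:M.
Proof.
by move=> irr xc; apply: (schur irr) => h; rewrite /comm_mx -!repM xc.
Qed.

(** If s = 0 then D^2 = 0 on this simple module, so that D has trace 0 there,
    contrary to [trace_pivot]. *)
Lemma pivot2_scalar n (r : rep H n) : irreducible r ->
  exists2 s, s != 0 & r z = s%:M.
Proof.
move=> irr; have [s rz] := central_scalar irr (pivot2_central B intL).
exists s => //; apply/eqP => s0; case: (irr) => n0 _.
have DD : r D *m r D = 0.
  have [gS _] := gmod_antipode B intL.
  have : r (S g) *m r z = 0 by rewrite rz s0 -scalemx1 scale0r mulmx0.
  by rewrite -repM -[_ * S g]mulrA gS mulr1 repM.
have [t [_ trt tE]] := mxtrace_eigenvalues (r D).
have := trace_pivot intL r; have := trt 1%N; rewrite expr1 => ->.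
rewrite big_seq big1 => [/esym/eqP|x]; first by rewrite nat0 -leqn0 leqNgt n0.
rewrite tE expr1 => /eigenvalueP[v vD v0]; apply/eqP.
have : x ^+ 2 *: v = 0 by rewrite expr2 -scalerA -vD scalemxAl -vD -mulmxA DD mulmx0.
by move/eqP; rewrite scaler_eq0 (negPf v0) orbF sqrf_eq0.
Qed.

(** The kernel of z on the regular module would contain a simple module on
    which z vanishes. *)
Lemma pivot2_invertible : exists w, z * w = 1 /\ forall h, h * w = w * h.
Proof.
have inj x : z * x = 0 -> x = 0.
  move=> zx; apply: contrapT => x0.
  have [r rE] := regular_rep B.
  pose v := crow B x.
  have vz : v *m r z = 0.
    by rewrite rE (crow_mxrep B) ?zx ?crow0 //; lin.
  have v0 : v != 0.
    by apply/eqP => v0; apply: x0; apply: (crow_inj (B := B)); rewrite crow0.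
  pose X := row_base (kermx (r z)).
  have fX : row_free X by exact: row_base_free.
  have sX : stable r X.
    apply: stable_row_base; apply: stable_comm_ker => h; exists (r h).
    by rewrite -!repM (pivot2_central B intL).
  have X0 : (0 < \rank (kermx (r z)))%N.
    rewrite lt0n mxrank_eq0; apply/eqP => k0; case/negP: v0; rewrite -submx0 -k0.
    by apply/sub_kermxP.
  have [m [q [irrq [Y fY qY]]]] := irreducible_subrep (restr fX sX) X0.
  have [s s0 qz] := pivot2_scalar irrq.
  case/negP: s0; have qX : restr fX sX z = 0.
    apply: (row_free_inj fX); rewrite mul0mx -restrE.
    by apply/sub_kermxP; rewrite eq_row_base.
  have : q z = 0 by apply: (row_free_inj fY); rewrite -qY qX mulmx0 mul0mx.
  case: irrq => m0 _; rewrite qz => /matrixP/(_ (Ordinal m0) (Ordinal m0)).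
  by rewrite !mxE eqxx mulr1n => ->.
have [|x zx|w zw] := @linear_injective_surjective _ _ _ B (fun x => z * x) _ _ 1.
- by lin.
- exact: inj.
exists w; split=> // h.
rewrite -[h * w]mul1r -{1}zw -(pivot2_central B intL w) -mulrA; congr (_ * _).
by rewrite mulrA -(pivot2_central B intL h) -mulrA zw mulr1.
Qed.

Lemma lam_one_central w : z * w = 1 -> (forall h, h * w = w * h) ->
  lam 1 = trace B (fun x => (D * g) * w * x).
Proof.
move=> zw wc; rewrite (regular_character B intL).
rewrite -(antipode1 hopfH) -zw; congr (lam (S _)).
by rewrite -[RHS]mulrA -(wc D) [RHS]mulrA -[D * g * D]mulrA (gmod_pivot B intL) !mulrA.
Qed.

(** By [lam_one_central], lam(1) is the trace of D g z^-1 on the regular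
    module, hence a sum over its simple constituents q.  Let z act on q as the
    scalar 1/c^2, let d be the dimension of q and A = c D.  Since A^2 g = 1 and
    g has finite order, the eigenvalues of A are roots of unity, and the traces
    of A and of its inverse A g are both d c by [trace_pivot] and
    [trace_pivot_gmod].  So q contributes d c^2, which is tr(A) tr(A^-1) / d.
    If the total is zero then [unity_sums_positive] gives tr(A) = 0 for all q,
    whereas d c is not 0. *)
Lemma lam_one_neq0 : (0 < #|I|)%N -> lam 1 != 0.
Proof.
move=> I0; apply/eqP => lam10.
have [w [zw wc]] := pivot2_invertible.
have [N N0 gN] := grouplike_finite_order B (counit_gmod B intL) (gmod_grouplike B intL).
have [r rE] := regular_rep B.
have [s [sP sE]] := character_decomposition B intL r.
pose N2 := (N * 2)%N; have N20 : (0 < N2)%N by rewrite muln_gt0 N0.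
have eig (q : {m & rep H m}) : exists cs : K * seq K, irreducible (projT2 q) ->
    [/\ cs.1 != 0,
      forall x, x \in cs.2 -> x ^+ N2 = 1,
      \sum_(x <- cs.2) x = (projT1 q)%:R * cs.1,
      \sum_(x <- cs.2) x ^+ N2.-1 = (projT1 q)%:R * cs.1
    & \tr (projT2 q (D * g * w)) = (projT1 q)%:R * cs.1 ^+ 2].
  case: q => n q /=; have [irr|] := pselect (irreducible q); last by exists (0, [::]).
  have [t t0 qz] := pivot2_scalar irr.
  have [c c2] : exists c, c ^+ 2 = t^-1.
    have /closed_rootP[c] : size ('X^2 - (t^-1)%:P : {poly K}) != 1 by rewrite size_XnsubC.
    by rewrite rootE !hornerE subr_eq0 => /eqP; exists c.
  have c0 : c != 0 by rewrite -sqrf_eq0 c2 invr_eq0.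
  pose A := c *: q D.
  have Ag : A *m q g = q g *m A.
    by rewrite /A -scalemxAl -scalemxAr -!repM (gmod_pivot B intL).
  have AAg : A *m (A *m q g) = 1%:M.
    rewrite Ag /A -!scalemxAr -!scalemxAl scalerA -expr2 c2.
    rewrite -!repM -[D * g * D]mulrA (gmod_pivot B intL) mulrA.
    by rewrite qz scale_scalar_mx mulVf.
  (* A^2 is inverse to g, so twice the order of g is an exponent for A. *)
  have AN : A ^+ N2 = 1.
    have gqN : (q g) ^+ N = 1.
      have : q (g ^+ N) = 1%:M by rewrite gN rep1.
      have -> : q (g ^+ N) = (q g) ^+ N; last by [].
      elim: N {N0 gN N2 N20} => [|k IHk]; first by rewrite !expr0 rep1.
      by rewrite exprS exprSr repM IHk.
    have A2g : A ^+ 2 * q g = 1 by rewrite expr2 -mulrA.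
    have c2g : GRing.comm (A ^+ 2) (q g) by apply: commr_sym; apply: commrX; apply: commr_sym.
    by rewrite /N2 mulnC exprM -[LHS]mulr1 -gqN -exprMn_comm // A2g expr1n.
  have [s' [_ trs' s'E]] := mxtrace_eigenvalues A.
  exists (c, s') => _; case: (irr) => n0 _.
  have trA : \tr A = n%:R * c by rewrite /A mxtraceZ (trace_pivot intL) mulrC.
  split=> //=.
  - move=> x; rewrite s'E => /eigenvalueP[v vA v0].
    have /eqP := eigenvector_exp N2 vA; rewrite AN mulmx1 -subr_eq0 -{1}[v]scale1r -scalerBl.
    by rewrite scaler_eq0 (negPf v0) orbF subr_eq0 => /eqP<-.
  - by rewrite -trA -[A in RHS]expr1 trs'; under [RHS]eq_bigr do rewrite expr1.
  - rewrite -trs'.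
    have -> : A ^+ N2.-1 = A *m q g.
      have AAg1 : A * (A *m q g) = 1 by [].
      by rewrite -[LHS]mulr1 -AAg1 mulrA -exprSr prednK // AN mul1r.
    by rewrite /A -scalemxAl mxtraceZ -repM (gmod_pivot B intL) (trace_pivot_gmod B intL) mulrC.
  - have [a qw] := central_scalar irr wc.
    have ta : a = t^-1.
      have : q (z * w) = 1%:M by rewrite zw rep1.
      rewrite repM qz qw -scalar_mxM => /matrixP/(_ (Ordinal n0) (Ordinal n0)).
      by rewrite !mxE eqxx !mulr1n => E; rewrite -[LHS]mulr1 -(divff t0) mulrA E mul1r.
    by rewrite repM qw mul_scalar_mx mxtraceZ (trace_pivot_gmod B intL) ta -c2 mulrC.
have [f fP] := choice eig.
(* The weights m / d clear the denominators d in the sum of tr(A) tr(A^-1) / d. *)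
pose m := (\prod_(q <- s) projT1 q)%N.
pose F := [seq ((m %/ projT1 q)%N, (f q).2) | q <- s].
have sP' : all (fun q => `[< irreducible (projT2 q) >] && (projT1 q %| m)%N) s.
  rewrite all_predI; apply/andP; split.
    by apply: sub_all sP => q /asboolP[iq _]; apply/asboolP.
  have : all (fun n => n %| m)%N (map (@projT1 _ _) s).
    apply/allP => n ns; rewrite /m -(big_map _ xpredT id) (big_rem n) //=.
    exact: dvdn_mulr.
  by rewrite all_map.
have m0 : (0 < m)%N.
  rewrite /m; elim: s sP {sE F sP' m} => [|q s IHs] /=; first by rewrite big_nil.
  by move=> /andP[/asboolP[[q0 _] _] /IHs]; rewrite big_cons muln_gt0 q0.
have divE (q : {m & rep H m}) : (projT1 q %| m)%N ->
    (m %/ projT1 q)%:R * (projT1 q)%:R = m%:R :> K.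
  by move=> qm; rewrite -natrM divnK.
have F0 p : p \in F -> (0 < p.1)%N.
  have : all (fun p => 0 < p.1)%N F.
    rewrite /F all_map; apply: sub_all sP' => q /andP[/asboolP[q0 _] qm] /=.
    by rewrite divn_gt0 // dvdn_leq.
  by move/allP; apply.
have FN p x : p \in F -> x \in p.2 -> x ^+ N2 = 1.
  have : all (fun p => all (fun x => x ^+ N2 == 1) p.2) F.
    rewrite /F all_map; apply: sub_all sP' => q /andP[/asboolP iq _] /=.
    by apply/allP => y yf; have [_ qN _ _ _] := fP q iq; rewrite qN.
  by move=> /allP allF pF xp; apply/eqP; apply: (allP (allF _ pF)).
have sum0 : \sum_(p <- F) p.1%:R * ((\sum_(x <- p.2) x) * (\sum_(x <- p.2) x ^+ N2.-1)) = 0.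
  transitivity (m%:R * \sum_(q <- s) \tr (projT2 q (D * g * w))); last first.
    by rewrite -sE rE mxtrace_tr mxtrace_mxrep -lam_one_central // lam10 mulr0.
  rewrite /F big_map mulr_sumr; apply: (eq_big_all sP') => q /andP[/asboolP iq qm] /=.
  have [_ _ -> -> ->] := fP q iq; rewrite -(divE q qm); ring.
have Fz := unity_sums_positive charK N20 F0 FN sum0.
case: s sE @m sP' @F Fz {sP m0 divE F0 FN sum0} => [|q s] sE m sP' F Fz.
  have := sE 1; rewrite big_nil rep1 mxtrace1 => /eqP; rewrite nat0.
  by rewrite -leqn0 leqNgt I0.
move: sP' => /= /andP[/andP[/asboolP iq _] _].
have [c0 _ q1 _ _] := fP q iq.
have /eqP := Fz _ (mem_head _ _); rewrite /= q1 mulf_eq0 nat0 (negPf c0) orbF.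
by case: iq => q0 _; rewrite -leqn0 leqNgt q0.
Qed.

End Cosemisimple.

(** * The antipode is an involution *)

Section SignSums.
Variables (K : closedFieldType) (charK : [pchar K] =i pred0).

(** The sum over t is an integer c and the entries of s are signs, so their sum
    is an integer of absolute value at most the size of s.  It is the product
    of this size with c, and it is not 0, so it is extremal and all signs
    agree. *)
Lemma sign_sum (s t : seq K) :
  (forall x, x \in s -> x ^+ 2 = 1) -> (forall x, x \in t -> x ^+ 3 = x) ->
  \sum_(x <- s) x = (size s)%:R * \sum_(x <- t) x -> \sum_(x <- s) x != 0 ->
  1 \in s -> forall x, x \in s -> x = 1.
Proof.
move=> s1 t1 st s0 one x xs.
have [c tE] : exists c : int, \sum_(x <- t) x = c%:~R.
  elim: t {st} t1 => [|y t IHt] t1; first by exists 0; rewrite big_nil.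
  have [|c tE] := IHt; first by move=> z zt; apply: t1; rewrite inE zt orbT.
  have /t1 y3 : y \in y :: t by rewrite inE eqxx.
  have : (y - 0) * (y - 1) * (y - (-1)) = 0 by transitivity (y ^+ 3 - y); [ring | rewrite y3 subrr].
  move/eqP; rewrite !mulf_eq0 !subr_eq0 big_cons tE => /orP[/orP[]|] /eqP->.
  - by exists c; rewrite add0r.
  - by exists (1 + c); rewrite intrD.
  - by exists (-1 + c); rewrite intrD intrN.
have signs y : y \in s -> (y == 1) || (y == -1).
  by move/s1/eqP; rewrite sqrf_eq1.
(* The numbers p and q of positive and negative signs satisfy p - q = (p + q) c. *)
pose p := count_mem 1 s; pose q := count_mem (-1 : K) s.
have sE : \sum_(x <- s) x = (p%:Z - q%:Z)%:~R :> K /\ (p + q)%N = size s.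
  rewrite /p /q; elim: s signs {one xs s0 st s1 p q} => [|y s IHs] signs; first by rewrite big_nil.
  have [|E1 E2] := IHs; first by move=> z zs; apply: signs; rewrite inE zs orbT.
  have n11 : (1 == -1 :> K) = false.
    by rewrite -subr_eq0 opprK -[1 + 1]/(2%:R) ((pcharf0P K).1 charK).
  have /signs/orP[/eqP->|/eqP->] : y \in y :: s by rewrite inE eqxx.
    rewrite big_cons E1 /= eqxx n11 -E2 /=; split; last by lia.
    by rewrite -[X in X + _ = _]/(1%:~R) -intrD; congr (_%:~R); lia.
  rewrite big_cons E1 /= eqxx eq_sym n11 -E2 /=; split; last by lia.
  by rewrite -[X in X + _ = _]/((-1)%:~R) -intrD; congr (_%:~R); lia.
case: sE => sE szE; move: st s0; rewrite sE tE -szE -[(p + q)%:R]/((p + q)%:Z%:~R) -intrM.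
move=> /eqP; rewrite -subr_eq0 -intrB !(intr_eq0_char0 charK) subr_eq0 => /eqP pq pq0.
have p0 : (0 < p)%N by rewrite -has_count has_pred1.
have q0 : q = 0%N.
  have c0 : c != 0 by apply: contra_neq pq0 => c0; rewrite pq c0 mulr0.
  have [c1|c1] : (1 <= c) \/ (c <= -1) by lia.
    have : (p + q)%:Z <= (p + q)%:Z * c by rewrite ler_peMr.
    by rewrite -pq; lia.
  have : (p + q)%:Z * c <= (p + q)%:Z * (-1) by rewrite ler_wpM2l.
  by rewrite -pq; lia.
case/orP: (signs x xs) => /eqP // xm; move: q0; rewrite /q => /eqP.
by rewrite -leqn0 leqNgt -has_count has_pred1 -xm xs.
Qed.
End SignSums.

Section Involutive.
Variables (K : closedFieldType) (charK : [pchar K] =i pred0).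
Variables (H : algType K) (hopfH : hopf_structure H).
Variables (I : finType) (B : basis H I).
Variables (L : H) (intL : left_integral hopfH L).
Hypothesis I0 : (0 < #|I|)%N.

Local Notation S := (antipode hopfH).
Local Notation eps := (counit hopfH).
Local Notation sw := (sw hopfH).
Local Notation lam := (lam hopfH B).
Local Notation g := (gmod hopfH B L).
Local Notation n := #|I|.

(** Apply lam to one factor of the coproduct of 1 and use [lam_left]. *)
Lemma gmod1 : g = 1.
Proof.
apply: (scalerI (lam_one_neq0 charK B intL I0)).
rewrite -(lam_left B intL 1 (G := id)) //.
by rewrite sw1 //; lin.
Qed.

Lemma antipode4_id h : S (S (S (S h))) = h.
Proof. by have := antipode4 B intL h; rewrite gmod1 mul1r mulr1 => <-. Qed.

(** By [trace_via_integral] the trace is lam of a sum with the factor S^3(L2)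
    L1, which is a counit because S^4 = 1. *)
Lemma trace_antipode2 (f : H -> K^o) : lin f ->
  trace B (fun h => sw h (fun a b => f b *: S (S a))) = lam 1 * f L.
Proof.
move=> lf; rewrite (trace_via_integral B intL); last by lin.
transitivity (sw L (fun a b => sw b (fun c d => f d *: lam (S (S (S c)) * a))) : K^o).
  apply: (@eq_sw _ _ _ K^o) => a b; rewrite (sw_lin (fun z => lam (S z * a))); last by lin.
  by apply: eq_sw => c d; rewrite linearZ -scalerAl linearZ.
rewrite -(swA (fun a c d => f d *: lam (S (S (S c)) * a))); last by lin.
(* Applying S gives S(p1) S^4(p2), and the fourth power of S is the identity. *)
have key p : sw p (fun a c => S (S (S c)) * a) = eps p *: 1.
  apply: (antipode_inj B intL); rewrite (sw_lin S); last by lin.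
  rewrite linearZ antipode1 /= -(sw_Sl id) //.
  by apply: eq_sw => a b; rewrite antipodeM antipode4_id.
transitivity (sw L (fun p d => eps p *: (f d *: lam 1)) : K^o).
  apply: (@eq_sw _ _ _ K^o) => p d.
  have := congr1 (fun z => f d *: lam z) (key p).
  rewrite (sw_lin (fun z => f d *: lam z)) => [->|]; last by lin.
  by rewrite linearZ !scalerA mulrC.
rewrite (sw_epsl (fun d => f d *: lam 1)); last by lin.
exact: mulrC.
Qed.

(** The character of the regular module. *)
Definition chi (h : H) : K^o := trace B (fun x => h * x).

Lemma chi_lin : lin chi.
Proof. by apply: trace_lin => x; lin. Qed.

Lemma chi_integral : chi L = 1.
Proof.
transitivity (trace B (fun x => eps x *: L)).
  by apply: eq_trace => x; rewrite (integral_right B intL).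
by rewrite trace_rank1; [case: intL | lin].
Qed.

Lemma chi_antipode2 h : chi (S (S h)) = chi h.
Proof.
transitivity (trace B (fun x => S (S (h * S (S x))))).
  by apply: eq_trace => x; rewrite !antipodeM antipode4_id.
rewrite (@traceC _ _ _ B (fun x => S (S x)) (fun x => h * S (S x))); try by lin.
by apply: eq_trace => x; rewrite antipode4_id.
Qed.

(** The tensor square of the regular module is a direct sum of n regular
    modules: the operator P, with inverse P', carries the diagonal action M to
    the action N on the second factor. *)
Lemma chi_square h : sw h (fun a b => chi b * chi a : K^o) = n%:R * chi h.
Proof.
pose TB := tensor_basis B B.
pose Mf x y := sw h (fun a b => tens (b * x) (a * y)).
pose Nf (x y : H) := tens x (h * y).
pose Pf x y := sw y (fun c d => tens (d * x) c).
pose Pf' x y := sw y (fun c d => tens (S d * x) c).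
have bM : bil Mf by rewrite /Mf; lin.
have bN : bil Nf by rewrite /Nf; lin.
have bP : bil Pf by rewrite /Pf; lin.
have bP' : bil Pf' by rewrite /Pf'; lin.
pose M := tlift Mf; pose N := tlift Nf; pose P := tlift Pf; pose P' := tlift Pf'.
have lM : lin M by apply: lin_tlift.
have lN : lin N by apply: lin_tlift.
have lP : lin P by apply: lin_tlift.
have lP' : lin P' by apply: lin_tlift.
have MP z : M (P z) = P (N z).
  apply: (tens_ext (f := fun z => M (P z)) (g := fun z => P (N z))); try by lin.
  move=> x y; rewrite [P _]tliftE // [N _]tliftE // [P _]tliftE //.
  rewrite (sw_lin _ lM) /Pf swM; last by lin.
  rewrite swC; apply: eq_sw => c d; rewrite [M _]tliftE //.
  by apply: eq_sw => a b; rewrite mulrA.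
have P'P z : P' (P z) = z.
  apply: (tens_ext (f := fun z => P' (P z)) (g := id)); try by lin.
  move=> x y; rewrite [P _]tliftE // (sw_lin _ lP').
  transitivity (sw y (fun c d => sw c (fun c1 c2 => tens (S c2 * (d * x)) c1))).
    by apply: eq_sw => c d; rewrite [P' _]tliftE.
  rewrite (swA (fun c1 c2 d => tens (S c2 * (d * x)) c1)); last by lin.
  transitivity (sw y (fun c1 t => eps t *: tens x c1)).
    apply: eq_sw => c1 t; rewrite -(mul1r x) -(sw_Sl (fun u => tens (u * x) c1)); last by lin.
    by apply: eq_sw => c d; rewrite mulrA mul1r.
  by rewrite (sw_epsr (fun c1 => tens x c1)) //; lin.
have trE : trace TB M = trace TB N.
  have PP' := mulmx1C (mxrep_inv TB lP' P'P).
  rewrite -[LHS]mxtrace_mxrep -[RHS]mxtrace_mxrep.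
  rewrite -[mxrep TB M]mulmx1 -PP' mulmxA mxtrace_mulC -(mxrepM TB P lM).
  rewrite (eq_mxrep TB MP) (mxrepM TB N lP) mulmxA.
  by rewrite (mxrep_inv TB lP' P'P) mul1mx.
rewrite trace_tensor // trace_tensor // in trE.
have bT i j := @tcoord_bil _ _ _ _ _ B B (i, j).
have -> : sw h (fun a b => chi b * chi a : K^o) = \sum_i \sum_j
    tlift (fun u v => (bcoord B i u : K^o) * bcoord B j v : K^o) (Mf (bvec B i) (bvec B j)).
  transitivity (\sum_i \sum_j sw h (fun a b => bcoord B i (b * bvec B i) * bcoord B j (a * bvec B j) : K^o)).
    transitivity (\sum_i sw h (fun a b => \sum_j bcoord B i (b * bvec B i) * bcoord B j (a * bvec B j) : K^o)).
      transitivity (sw h (fun a b => \sum_i \sum_j bcoord B i (b * bvec B i) * bcoord B j (a * bvec B j) : K^o)).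
        by apply: eq_sw => a b; rewrite /chi /trace mulr_suml; apply: eq_bigr => i _; rewrite mulr_sumr.
      exact: exchange_big.
    by apply: eq_bigr => i _; apply: exchange_big.
  apply: eq_bigr => i _; apply: eq_bigr => j _.
  rewrite /Mf [RHS](sw_lin (tlift _)); last by apply: lin_tlift => //; apply: (bT i j).
  by apply: eq_sw => a b; rewrite tliftE //; apply: (bT i j).
rewrite trE.
transitivity (\sum_(i in I) chi h); last by rewrite sumr_const mulr_natl.
apply: eq_bigr => i _; apply: eq_bigr => j _; rewrite /Nf (tliftE _ _ (bT i j)) /=.
by rewrite bcoordE eqxx mul1r.
Qed.

(** The operator P(h) = h1 chi(h2) satisfies P^2 = n P and commutes with S^2,
    because chi * chi = n chi and chi is invariant under S^2.  By
    [trace_antipode2], S^2 and S^2 P have the same trace lam(1), since chi(L) =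
    1.  So A = S^2 P / n satisfies A^3 = A, and n tr(A) is the trace of the
    involution S^2.  Now [sign_sum] applies to the eigenvalues of S^2 and of A;
    the vector 1 provides the eigenvalue 1 of S^2. *)
Lemma antipode_involutive h : S (S h) = h.
Proof.
have n0 : n%:R != 0 :> K by rewrite ((pcharf0P K).1 charK) -lt0n.
have lchi := chi_lin.
pose sg x := S (S x); have lsg : lin sg by rewrite /sg; lin.
pose P x := sw x (fun a b => chi b *: a); have lP : lin P by rewrite /P; lin.
have PP x : P (P x) = n%:R *: P x.
  transitivity (P (sw x (fun a b => chi b *: a))); first by [].
  rewrite (sw_lin P lP).
  transitivity (sw x (fun a b => sw a (fun c d => (chi b * chi d) *: c))).
    apply: eq_sw => a b; rewrite linZ // /P (sw_lin (fun z : H => (chi b : K) *: z)); last by lin.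
    by apply: eq_sw => c d; rewrite scalerA.
  rewrite (swA (fun c d b => (chi b * chi d) *: c)).
  - rewrite (sw_lin (fun z : H => n%:R *: z)); last by lin.
    apply: eq_sw => c t; rewrite scalerA -chi_square.
    by rewrite sw_scale.
  - split; first by move=> b c; lin.
      by move=> a c; apply: lin_scalel; apply: (@lin_mulr K _ K^o).
    by move=> a b; apply: lin_scalel; apply: (@lin_mull K _ K^o).
have Psg x : P (sg x) = sg (P x).
  rewrite /P /sg (sw_antipode hopfH); last by lin.
  rewrite (sw_antipode hopfH); last by lin.
  rewrite (sw_lin (fun z => S (S z))); last by lin.
  by apply: eq_sw => a b; rewrite chi_antipode2 !linearZ.
have sgsg x : sg (sg x) = x by apply: antipode4_id.
have trsg : trace B sg = lam 1.
  transitivity (trace B (fun h => sw h (fun a b => eps b *: S (S a)))).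
    by apply: eq_trace => x; rewrite (sw_epsr (fun a => S (S a))) //; lin.
  by rewrite trace_antipode2; [case: intL => -> _; rewrite mulr1 | lin].
have trsgP : trace B (fun x => sg (P x)) = lam 1.
  transitivity (trace B (fun h => sw h (fun a b => chi b *: S (S a)))).
    apply: eq_trace => x; rewrite /P (sw_lin sg lsg).
    by apply: eq_sw => a b; rewrite linZ.
  by rewrite trace_antipode2 // chi_integral mulr1.
pose A := n%:R^-1 *: mxrep B (fun x => sg (P x)).
have lsgP : lin (fun x => sg (P x)) by lin.
have A3 : A ^+ 3 = A.
  have E2 : A ^+ 2 = n%:R^-1 *: mxrep B P.
    rewrite expr2 -[A * A]/(A *m A) /A -scalemxAl -scalemxAr -(mxrepM B _ lsgP) scalerA.
    apply/matrixP => i j; rewrite !mxE -Psg sgsg PP linearZ /=.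
    by rewrite mulrA (mulfVK n0).
  rewrite exprS E2 -[A * _]/(A *m _) /A -scalemxAl -scalemxAr -(mxrepM B P lsgP) scalerA.
  apply/matrixP => i j; rewrite !mxE PP linZ // linearZ /=.
  by rewrite mulrA (mulfVK n0).
have [t [_ trt tE]] := mxtrace_eigenvalues A.
have [s [szs trs sE]] := mxtrace_eigenvalues (mxrep B sg)^T.
have s1 x : x \in s -> x ^+ 2 = 1.
  rewrite sE => /eigenvalueP[v vx v0]; have := eigenvector_exp 2 vx.
  have -> : (mxrep B sg)^T ^+ 2 = 1.
    rewrite expr2 -[_ * _]/(_ *m _) -trmx_mul -(mxrepM B sg lsg) (eq_mxrep B sgsg) mxrep_id.
    by rewrite trmx1.
  rewrite mulmx1 => /eqP; rewrite -subr_eq0 -{1}[v]scale1r -scalerBl scaler_eq0 (negPf v0) orbF.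
  by rewrite subr_eq0 => /eqP.
have t1 x : x \in t -> x ^+ 3 = x.
  rewrite tE => /eigenvalueP[v vx v0]; have := eigenvector_exp 3 vx; rewrite A3 vx => /eqP.
  by rewrite -subr_eq0 -scalerBl scaler_eq0 (negPf v0) orbF subr_eq0 => /eqP.
have sums : \sum_(x <- s) x = lam 1.
  by rewrite -trsg -(mxtrace_mxrep B) -mxtrace_tr -[_^T]expr1 trs; under [RHS]eq_bigr do rewrite expr1.
have sumt : \sum_(x <- t) x = n%:R^-1 * lam 1.
  rewrite -trsgP -(mxtrace_mxrep B) -mxtraceZ -/A -[A]expr1 trt.
  by under [RHS]eq_bigr do rewrite expr1.
have in_s x u : u != 0 -> sg u = x *: u -> x \in s.
  move=> u0 ux; rewrite sE; apply/eigenvalueP; exists (crow B u).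
    by rewrite crow_mxrep // ux crowZ.
  by apply: contra_neq u0 => /(@esym _ _ _); rewrite -(crow0 B) => /(@crow_inj _ _ _ B).
have all1 := sign_sum charK s1 t1.
apply/eqP; rewrite -subr_eq0; apply: contraT => u0.
have xm : -1 \in s.
  apply: (in_s _ _ u0); rewrite linB // -/(sg h) sgsg scaleN1r opprB //.
have : -1 = 1 :> K.
  apply: all1 => //.
  - by rewrite sums szs sumt mulVKf.
  - by rewrite sums (lam_one_neq0 charK B intL).
  - by apply: (in_s _ 1); rewrite ?oner_neq0 // scale1r /sg !antipode1.
move/eqP; rewrite eq_sym -subr_eq0 opprK -[1 + 1]/(2%:R) ((pcharf0P K).1 charK) //.
Qed.

Lemma lam_one : lam 1 = n%:R.
Proof.
have := trace_antipode2 (f := eps); case: intL => -> _; rewrite mulr1 => <-; last by lin.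
rewrite -(trace_id B); apply: eq_trace => x.
rewrite (sw_epsr (fun a => S (S a))); last by lin.
exact: antipode_involutive.
Qed.

End Involutive.

(** * Eigenvalues of the twist *)

Lemma eigenvalue_tr (F : fieldType) n (A : 'M[F]_n) a : eigenvalue A^T a = eigenvalue A a.
Proof.
rewrite !eigenvalue_root_char /char_poly; congr (root _ a).
by rewrite -[RHS]det_tr; congr (\det _); rewrite /char_poly_mx linearB /= tr_scalar_mx map_trmx.
Qed.

Section Legs.
Variables (K : fieldType) (H : algType K) (hopfH : hopf_structure H).
Variables (V : lmodType K) (act : H -> V -> V).
Hypotheses (bact : bil act) (act1 : forall v, act 1 v = v)
  (actM : forall x y v, act (x * y) v = act x (act y v)).

Local Notation S := (antipode hopfH).
Local Notation eps := (counit hopfH).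
Local Notation sw := (sw hopfH).
Hypothesis SS : forall h, S (S h) = h.

Local Notation Z := (((V ⊗ H) ⊗ H) ⊗ H).
Local Notation p4 v k w h := (tens (tens (tens v k) w) h).

Definition quad (X : lmodType K) (F : V -> H -> H -> H -> X) : Prop :=
  [/\ forall k w h, lin (fun v => F v k w h), forall v w h, lin (fun k => F v k w h),
      forall v k h, lin (fun w => F v k w h) & forall v k w, lin (fun h => F v k w h)].

Definition lift4 (X : lmodType K) (F : V -> H -> H -> H -> X) : Z -> X :=
  tlift (fun u h => tlift (fun t w => tlift (fun v k => F v k w h) t) u).

(** An element of V (x) H (x) H (x) H is written v (x) k (x) w (x) h; a linear
    map on this space is given by its values on such tensors. *)
Lemma lift4P (X : lmodType K) (F : V -> H -> H -> H -> X) : quad F ->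
  lin (lift4 F) /\ forall v k w h, lift4 F (p4 v k w h) = F v k w h.
Proof.
move=> [F1 F2 F3 F4].
have b1 w h : bil (fun v k => F v k w h) by split.
have b2 h : bil (fun t w => tlift (fun v k => F v k w h) t).
  by split=> [w|t]; [apply: lin_tlift | apply: lin_sum => p; apply: F3].
have b3 : bil (fun u h => tlift (fun t w => tlift (fun v k => F v k w h) t) u).
  split=> [h|u]; first by apply: lin_tlift.
  by apply: lin_sum => p; apply: lin_sum => q; apply: F4.
split=> [|v k w h]; first exact: lin_tlift.
by rewrite /lift4 tliftE // tliftE // tliftE.
Qed.

Lemma ext4 (X : lmodType K) (f g : Z -> X) : lin f -> lin g ->
  (forall v k w h, f (p4 v k w h) = g (p4 v k w h)) -> f =1 g.
Proof.
move=> lf lg fg; apply: tens_ext => // u h; move: u.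
apply: tens_ext => [||t w]; [by apply: lin_comp => //; lin..|]; move: t.
by apply: tens_ext => [||v k]; [by apply: lin_comp => //; lin..|].
Qed.

Definition mkop (X : lmodType K) (F : V -> H -> H -> H -> X) (q : quad F) : {linear Z -> X} :=
  mklin (lift4P q).1.

Lemma mkopE (X : lmodType K) (F : V -> H -> H -> H -> X) (q : quad F) v k w h :
  mkop q (p4 v k w h) = F v k w h.
Proof. exact: (lift4P q).2. Qed.

Ltac quad := split=> ? ? ?; lin.

(* U is the twist on the legs v and k; T exchanges w and h; J is the antipode on
   the leg h.  Av, Ak and Aw let the leg h act on the left of v, k and w, and E
   lets it act on the right of k through the antipode, so that Phi = Ak Av E
   below maps v (x) k (x) h to h2 v (x) h3 k S(h1) (x) h4.  Lh and Ll multiply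
   the leg h by the second factor of the coproduct of k and of w.  The inverses
   of Av, Ak, Aw, E and Lh are, up to conjugation by J, the operators Av', Ak',
   Aw', C and R, in which the factors have the opposite order; Ll' is the
   inverse of Ll.  X and Q are intermediate results. *)
Let qU : quad (fun v k w h => sw k (fun a b => p4 (act a v) b w h)). Proof. quad. Qed.
Let qT : quad (fun v k w h => p4 v k h w). Proof. quad. Qed.
Let qJ : quad (fun v k w h => p4 v k w (S h)). Proof. quad. Qed.
Let qAv : quad (fun v k w h => sw h (fun a b => p4 (act a v) k w b)). Proof. quad. Qed.
Let qAk : quad (fun v k w h => sw h (fun a b => p4 v (a * k) w b)). Proof. quad. Qed.
Let qE : quad (fun v k w h => sw h (fun a b => p4 v (k * S a) w b)). Proof. quad. Qed.
Let qAw : quad (fun v k w h => sw h (fun a b => p4 v k (a * w) b)). Proof. quad. Qed.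
Let qAw' : quad (fun v k w h => sw h (fun a b => p4 v k (b * w) a)). Proof. quad. Qed.
Let qLh : quad (fun v k w h => sw k (fun a b => p4 v a w (b * h))). Proof. quad. Qed.
Let qLl : quad (fun v k w h => sw w (fun a b => p4 v k a (b * h))). Proof. quad. Qed.
Let qLl' : quad (fun v k w h => sw w (fun a b => p4 v k a (S b * h))). Proof. quad. Qed.
Let qC : quad (fun v k w h => sw h (fun a b => p4 v (k * S b) w a)). Proof. quad. Qed.
Let qAv' : quad (fun v k w h => sw h (fun a b => p4 (act b v) k w a)). Proof. quad. Qed.
Let qAk' : quad (fun v k w h => sw h (fun a b => p4 v (b * k) w a)). Proof. quad. Qed.
Let qR : quad (fun v k w h => sw k (fun a b => p4 v a w (h * b))). Proof. quad. Qed.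
Let qX : quad (fun v k w h => sw h (fun a b => p4 v (S a) w (b * k))). Proof. quad. Qed.
Let qQ : quad (fun v k w h => sw k (fun a b => p4 v (a * S h) w b)). Proof. quad. Qed.

Let U := mkop qU. Let T := mkop qT. Let J := mkop qJ.
Let Av := mkop qAv. Let Ak := mkop qAk. Let E := mkop qE.
Let Aw := mkop qAw. Let Aw' := mkop qAw'.
Let Lh := mkop qLh. Let Ll := mkop qLl. Let Ll' := mkop qLl'.
Let C := mkop qC. Let Av' := mkop qAv'. Let Ak' := mkop qAk'.
Let R := mkop qR. Let X := mkop qX. Let Q := mkop qQ.

Let UE v k w h : U (p4 v k w h) = _ := mkopE qU v k w h.
Let TE v k w h : T (p4 v k w h) = _ := mkopE qT v k w h.
Let JE v k w h : J (p4 v k w h) = _ := mkopE qJ v k w h.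
Let AvE v k w h : Av (p4 v k w h) = _ := mkopE qAv v k w h.
Let AkE v k w h : Ak (p4 v k w h) = _ := mkopE qAk v k w h.
Let EE v k w h : E (p4 v k w h) = _ := mkopE qE v k w h.
Let AwE v k w h : Aw (p4 v k w h) = _ := mkopE qAw v k w h.
Let Aw'E v k w h : Aw' (p4 v k w h) = _ := mkopE qAw' v k w h.
Let LhE v k w h : Lh (p4 v k w h) = _ := mkopE qLh v k w h.
Let LlE v k w h : Ll (p4 v k w h) = _ := mkopE qLl v k w h.
Let Ll'E v k w h : Ll' (p4 v k w h) = _ := mkopE qLl' v k w h.
Let CE v k w h : C (p4 v k w h) = _ := mkopE qC v k w h.
Let Av'E v k w h : Av' (p4 v k w h) = _ := mkopE qAv' v k w h.
Let Ak'E v k w h : Ak' (p4 v k w h) = _ := mkopE qAk' v k w h.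
Let RE v k w h : R (p4 v k w h) = _ := mkopE qR v k w h.
Let XE v k w h : X (p4 v k w h) = _ := mkopE qX v k w h.
Let QE v k w h : Q (p4 v k w h) = _ := mkopE qQ v k w h.


(* Identities for Sweedler sums in which two adjacent factors cancel. *)

Let sw_op (W W' : lmodType K) (f : {linear W -> W'}) h (F : H -> H -> W) :
  f (sw h F) = sw h (fun a b => f (F a b)).
Proof. by apply: (sw_lin f); lin. Qed.

Let sw_SlV (W : lmodType K) h (F : H -> W) : lin F ->
  sw h (fun a b => F (S b * a)) = eps h *: F 1.
Proof.
move=> lF; rewrite -(antipode1 hopfH) -(sw_Sl (fun u => F (S u))) //; last by lin.
by apply: eq_sw => a b; rewrite antipodeM SS.
Qed.

Let sw_mul_key (W : lmodType K) (P : H -> H -> H -> W) h w : tri P ->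
  sw h (fun a b => sw (a * w) (fun c d => P c d b)) =
  sw w (fun w1 w2 => sw h (fun a b => sw b (fun b1 b2 => P (a * w1) (b1 * w2) b2))).
Proof.
move=> hP.
under eq_sw => a b do (rewrite swM; last by lin).
rewrite (swA (fun a1 a2 b => sw w (fun c d => P (a1 * c) (a2 * d) b))); last by lin.
by rewrite [RHS]swC; apply: eq_sw => a b; rewrite [RHS]swC.
Qed.

Let collapseV (W : lmodType K) (P : H -> H -> W) h : bil P ->
  sw h (fun a b => sw b (fun b1 b2 => P (S b1 * a) b2)) = P 1 h.
Proof.
move=> hP; rewrite -(swA (fun a b1 b2 => P (S b1 * a) b2)); last by lin.
transitivity (sw h (fun a b => eps a *: P 1 b)).
  by apply: eq_sw => a b; rewrite (sw_SlV a (F := fun u => P u b)) //; lin.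
by rewrite (sw_epsl (P 1)) //; lin.
Qed.

Let collapseSl (W : lmodType K) (P : H -> H -> W) h : bil P ->
  sw h (fun a b => sw b (fun b1 b2 => P (S a * b1) b2)) = P 1 h.
Proof.
move=> hP; rewrite -(swA (fun a b1 b2 => P (S a * b1) b2)); last by lin.
transitivity (sw h (fun a b => eps a *: P 1 b)).
  by apply: eq_sw => a b; rewrite (sw_Sl (fun u => P u b)) //; lin.
by rewrite (sw_epsl (P 1)) //; lin.
Qed.

Let collapseSr (W : lmodType K) (P : H -> H -> W) h : bil P ->
  sw h (fun a b => sw b (fun b1 b2 => P (a * S b1) b2)) = P 1 h.
Proof.
move=> hP; rewrite -(swA (fun a b1 b2 => P (a * S b1) b2)); last by lin.
transitivity (sw h (fun a b => eps a *: P 1 b)).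
  by apply: eq_sw => a b; rewrite (sw_Sr (fun u => P u b)) //; lin.
by rewrite (sw_epsl (P 1)) //; lin.
Qed.

Let collapse_left (W : lmodType K) (P : H -> H -> W) h : bil P ->
  sw h (fun a b => sw a (fun a1 a2 => P a1 (S a2 * b))) = P h 1.
Proof.
move=> hP; rewrite (swA (fun a1 a2 b => P a1 (S a2 * b))); last by lin.
transitivity (sw h (fun a b => eps b *: P a 1)).
  by apply: eq_sw => a b; rewrite (sw_Sl (fun u => P a u)) //; lin.
by rewrite (sw_epsr (fun a => P a 1)) //; lin.
Qed.

Ltac ext4 f g := apply: (ext4 (f := f) (g := g)); [by lin | by lin | move=> v k w h].

Let TT z : T (T z) = z.
Proof. ext4 (fun z => T (T z)) (fun z : Z => z). by rewrite !TE. Qed.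

Let JJ z : J (J z) = z.
Proof. ext4 (fun z => J (J z)) (fun z : Z => z). by rewrite !JE SS. Qed.

(* The operators in which the leg w plays the role of h. *)
Let Avw z := T (Av (T z)).
Let Akw z := T (Ak (T z)).
Let Ew z := T (E (T z)).
Let Lw z := T (Lh (T z)).

Let AvwE v k w h : Avw (p4 v k w h) = sw w (fun a b => p4 (act a v) k b h).
Proof. by rewrite /Avw TE AvE sw_op; apply: eq_sw => a b; rewrite TE. Qed.
Let AkwE v k w h : Akw (p4 v k w h) = sw w (fun a b => p4 v (a * k) b h).
Proof. by rewrite /Akw TE AkE sw_op; apply: eq_sw => a b; rewrite TE. Qed.
Let EwE v k w h : Ew (p4 v k w h) = sw w (fun a b => p4 v (k * S a) b h).
Proof. by rewrite /Ew TE EE sw_op; apply: eq_sw => a b; rewrite TE. Qed.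
Let LwE v k w h : Lw (p4 v k w h) = sw k (fun a b => p4 v a (b * w) h).
Proof. by rewrite /Lw TE LhE sw_op; apply: eq_sw => a b; rewrite TE. Qed.

Let lAvw : lin Avw. Proof. by rewrite /Avw; lin. Qed.
Let lAkw : lin Akw. Proof. by rewrite /Akw; lin. Qed.
Let lEw : lin Ew. Proof. by rewrite /Ew; lin. Qed.
Let lLw : lin Lw. Proof. by rewrite /Lw; lin. Qed.

(* Aw makes the action of w by Av, Ak or E into the action of both w and h. *)

Let relAv z : Avw (Aw z) = Aw (Av (Avw z)).
Proof.
ext4 (fun z => Avw (Aw z)) (fun z => Aw (Av (Avw z))).
rewrite AwE (sw_lin _ lAvw) AvwE !sw_op.
under eq_sw => a b do rewrite AvwE.
under [RHS]eq_sw => a b do (rewrite AvE sw_op; under eq_sw => c d do rewrite AwE -actM).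
by apply: (sw_mul_key _ _ (P := fun c d b => p4 (act c v) k d b)); lin.
Qed.

Let relAk z : Akw (Aw z) = Aw (Ak (Akw z)).
Proof.
ext4 (fun z => Akw (Aw z)) (fun z => Aw (Ak (Akw z))).
rewrite AwE (sw_lin _ lAkw) AkwE !sw_op.
under eq_sw => a b do rewrite AkwE.
under [RHS]eq_sw => a b do (rewrite AkE sw_op; under eq_sw => c d do rewrite AwE mulrA).
by apply: (sw_mul_key _ _ (P := fun c d b => p4 v (c * k) d b)); lin.
Qed.

Let relE z : Ew (Aw z) = Aw (E (Ew z)).
Proof.
ext4 (fun z => Ew (Aw z)) (fun z => Aw (E (Ew z))).
rewrite AwE (sw_lin _ lEw) EwE !sw_op.
under eq_sw => a b do rewrite EwE.
under [RHS]eq_sw => a b do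
  (rewrite EE sw_op; under eq_sw => c d do rewrite AwE -mulrA -antipodeM).
by apply: (sw_mul_key _ _ (P := fun c d b => p4 v (k * S c) d b)); lin.
Qed.

Let comAkAv z : Akw (Av z) = Av (Akw z).
Proof.
ext4 (fun z => Akw (Av z)) (fun z => Av (Akw z)).
rewrite AvE (sw_lin _ lAkw) AkwE sw_op.
under eq_sw => a b do rewrite AkwE.
by under [RHS]eq_sw => a b do rewrite AvE; rewrite swC.
Qed.

Let comAkE z : Akw (E z) = E (Akw z).
Proof.
ext4 (fun z => Akw (E z)) (fun z => E (Akw z)).
rewrite EE (sw_lin _ lAkw) AkwE sw_op.
under eq_sw => a b do rewrite AkwE.
by under [RHS]eq_sw => a b do rewrite EE; rewrite swC; apply: eq_sw => a b; apply: eq_sw => c d; rewrite mulrA.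
Qed.

Let comAvE z : Avw (E z) = E (Avw z).
Proof.
ext4 (fun z => Avw (E z)) (fun z => E (Avw z)).
rewrite EE (sw_lin _ lAvw) AvwE sw_op.
under eq_sw => a b do rewrite AvwE.
by under [RHS]eq_sw => a b do rewrite EE; rewrite swC.
Qed.

Let Phi z := Ak (Av (E z)).
Let Phiw z := T (Phi (T z)).

Let PhiwE z : Phiw z = Akw (Avw (Ew z)).
Proof. by rewrite /Phiw /Phi /Akw /Avw /Ew !TT. Qed.

Let relPhi z : Phiw (Aw z) = Aw (Phi (Phiw z)).
Proof.
rewrite !PhiwE relE relAv -/(Phi _) relAk; congr (Aw _).
by rewrite /Phi -comAkE -comAvE -comAkAv.
Qed.

(* All operators except B and R are shown to commute with U directly. *)
Let UT z : U (T z) = T (U z).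
Proof.
ext4 (fun z => U (T z)) (fun z => T (U z)).
by rewrite TE !UE sw_op; apply: eq_sw => a b; rewrite TE.
Qed.

Let UJ z : U (J z) = J (U z).
Proof.
ext4 (fun z => U (J z)) (fun z => J (U z)).
by rewrite JE !UE sw_op; apply: eq_sw => a b; rewrite JE.
Qed.

Let UAw z : U (Aw z) = Aw (U z).
Proof.
ext4 (fun z => U (Aw z)) (fun z => Aw (U z)).
rewrite AwE UE !sw_op; under eq_sw => a b do rewrite UE.
by rewrite swC; apply: eq_sw => a b; rewrite AwE.
Qed.

Let ULl z : U (Ll z) = Ll (U z).
Proof.
ext4 (fun z => U (Ll z)) (fun z => Ll (U z)).
rewrite LlE UE !sw_op; under eq_sw => a b do rewrite UE.
by rewrite swC; apply: eq_sw => a b; rewrite LlE.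
Qed.

Let ULh z : U (Lh z) = Lh (U z).
Proof.
ext4 (fun z => U (Lh z)) (fun z => Lh (U z)).
rewrite LhE UE !sw_op; under eq_sw => a b do rewrite UE.
rewrite (swA (fun c d b => p4 (act c v) d w (b * h))); last by lin.
by apply: eq_sw => a b; rewrite LhE.
Qed.

Let UAk z : U (Ak z) = Ak (Av (U z)).
Proof.
ext4 (fun z => U (Ak z)) (fun z => Ak (Av (U z))).
rewrite AkE UE !sw_op; under eq_sw => a b do rewrite UE.
under [RHS]eq_sw => a b do (rewrite AvE sw_op; under eq_sw => c d do rewrite AkE -actM).
by apply: (sw_mul_key _ _ (P := fun c d b => p4 (act c v) d w b)); lin.
Qed.

(* The factor S(h2) that the twist takes from k S(h1) cancels against Av. *)
Let UE' z : E (U z) = U (Av (E z)).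
Proof.
ext4 (fun z => E (U z)) (fun z => U (Av (E z))).
rewrite UE EE !sw_op; under eq_sw => a b do rewrite EE.
under [RHS]eq_sw => a b do (rewrite AvE sw_op; under eq_sw => c d do
  (rewrite UE swM; [under eq_sw => e f do (rewrite sw_antipode; [|by lin]) | by lin])).
transitivity (sw k (fun e f => sw h (fun a b => sw a (fun a1 a2 => sw b (fun c d =>
   p4 (act e (act (S a2 * c) v)) (f * S a1) w d))))).
  apply: eq_sw => e f.
  rewrite (swA (fun a1 a2 b => sw b (fun c d => p4 (act e (act (S a2 * c) v)) (f * S a1) w d))); last by lin.
  apply: eq_sw => a b.
  rewrite (collapseSl b (P := fun x d => p4 (act e (act x v)) (f * S a) w d)); last by lin.
  by rewrite act1.
under [RHS]eq_sw => a b do rewrite swC.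
rewrite [RHS]swC; apply: eq_sw => e f; apply: eq_sw => a b; rewrite [RHS]swC.
by apply: eq_sw => c d; apply: eq_sw => x y; rewrite -!actM !mulrA.
Qed.

Let UPhi z : U (Phi z) = Phi (U z).
Proof. by rewrite /Phi UAk -UE'. Qed.

Let UPhiw z : U (Phiw z) = Phiw (U z).
Proof. by rewrite /Phiw UT UPhi UT. Qed.

Let ULw z : U (Lw z) = Lw (U z).
Proof. by rewrite /Lw UT ULh UT. Qed.

(* The pentagon equation for L, by which Lh is a commutator. *)
Let relL z : Lw (Lh (Ll z)) = Ll (Lw z).
Proof.
ext4 (fun z => Lw (Lh (Ll z))) (fun z => Ll (Lw z)).
rewrite LlE LwE !sw_op (sw_lin _ lLw); under eq_sw => a b do
  (rewrite LhE (sw_lin _ lLw); under eq_sw => c d do rewrite LwE).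
under [RHS]eq_sw => a b do (rewrite LlE swM; [|by lin]).
rewrite swC; under eq_sw => a b do rewrite swC.
rewrite (swA (fun c d b => sw w (fun e f => p4 v c (d * e) (b * (f * h))))); last by lin.
apply: eq_sw => a b; apply: eq_sw => c d; apply: eq_sw => e f.
by rewrite mulrA.
Qed.

(* The inverses of the operators up to conjugation by J. *)
Let invLl z : Ll (Ll' z) = z.
Proof.
ext4 (fun z => Ll (Ll' z)) (fun z : Z => z).
rewrite Ll'E sw_op; under eq_sw => a b do rewrite LlE.
rewrite (swA (fun a1 a2 b => p4 v k a1 (a2 * (S b * h)))); last by lin.
under eq_sw => a b do under eq_sw => c d do rewrite mulrA.
transitivity (sw w (fun a b => (eps b : K) *: p4 v k a h)).
  by apply: eq_sw => a b; rewrite (sw_Sr (fun u => p4 v k a (u * h))) ?mul1r //; lin.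
by rewrite (sw_epsr (fun a => p4 v k a h)) //; lin.
Qed.

Let invAw z : J (Aw' (J (Aw z))) = z.
Proof.
ext4 (fun z => J (Aw' (J (Aw z)))) (fun z : Z => z).
rewrite AwE !sw_op; under eq_sw => a b do
  (rewrite JE Aw'E sw_antipode; [rewrite sw_op; under eq_sw => c d do rewrite JE SS mulrA | by lin]).
by rewrite (collapseV h (P := fun x d => p4 v k (x * w) d)) ?mul1r //; lin.
Qed.

Let invAk z : J (Ak' (J (Ak z))) = z.
Proof.
ext4 (fun z => J (Ak' (J (Ak z)))) (fun z : Z => z).
rewrite AkE !sw_op; under eq_sw => a b do
  (rewrite JE Ak'E sw_antipode; [rewrite sw_op; under eq_sw => c d do rewrite JE SS mulrA | by lin]).
by rewrite (collapseV h (P := fun x d => p4 v (x * k) w d)) ?mul1r //; lin.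
Qed.

Let invAv z : J (Av' (J (Av z))) = z.
Proof.
ext4 (fun z => J (Av' (J (Av z)))) (fun z : Z => z).
rewrite AvE !sw_op; under eq_sw => a b do
  (rewrite JE Av'E sw_antipode; [rewrite sw_op; under eq_sw => c d do rewrite JE SS -actM | by lin]).
by rewrite (collapseV h (P := fun x d => p4 (act x v) k w d)) ?act1 //; lin.
Qed.

Let invE z : J (C (J (E z))) = z.
Proof.
ext4 (fun z => J (C (J (E z)))) (fun z : Z => z).
rewrite EE !sw_op; under eq_sw => a b do
  (rewrite JE CE sw_antipode; [rewrite sw_op; under eq_sw => c d do rewrite JE !SS -mulrA | by lin]).
by rewrite (collapseSl h (P := fun x d => p4 v (k * x) w d)) ?mulr1 //; lin.
Qed.

Let invL z : J (R (J (Lh z))) = z.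
Proof.
ext4 (fun z => J (R (J (Lh z)))) (fun z : Z => z).
rewrite LhE !sw_op; under eq_sw => a b do
  (rewrite JE RE sw_op; under eq_sw => c d do rewrite JE antipodeM SS mulrA).
by rewrite (collapse_left k (P := fun x d => p4 v x w (d * h))) ?mul1r //; lin.
Qed.

Let B z := C (Av' (Ak' z)).

Let invPhi z : J (B (J (Phi z))) = z.
Proof.
by rewrite -[RHS]invE /B /Phi -[Ak' _]JJ invAk -[Av' _]JJ invAv.
Qed.

(* The relation Lh B U = Phi R in three steps. *)

Let theta1 z : Lh (C z) = Q z.
Proof.
ext4 (fun z => Lh (C z)) (fun z => Q z).
rewrite CE QE sw_op; under eq_sw => a b do
  (rewrite LhE swM; [under eq_sw => c d do (rewrite sw_antipode; [|by lin]) | by lin]).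
rewrite swC; apply: eq_sw => c d; under eq_sw => a b do under eq_sw => x y do rewrite -mulrA.
by rewrite (collapseV h (P := fun x y => p4 v (c * S y) w (d * x))) ?mulr1 //; lin.
Qed.

Let theta2 z : E (R z) = X z.
Proof.
ext4 (fun z => E (R z)) (fun z => X z).
rewrite RE XE sw_op; under eq_sw => a b do
  (rewrite EE swM; [under eq_sw => c d do under eq_sw => x y do rewrite antipodeM mulrA | by lin]).
rewrite swC; apply: eq_sw => c d.
by rewrite (collapseSr k (P := fun x y => p4 v (x * S c) w (d * y))) ?mul1r //; lin.
Qed.

Let theta3 z : Q (Av' (Ak' (U z))) = Ak (Av (X z)).
Proof.
ext4 (fun z => Q (Av' (Ak' (U z)))) (fun z => Ak (Av (X z))).
rewrite UE XE !sw_op.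
transitivity (sw k (fun k1 k2 => sw h (fun a b => sw a (fun a1 a2 => sw b (fun b1 b2 =>
   sw k2 (fun e f => p4 (act (a2 * k1) v) (b1 * e * S a1) w (b2 * f))))))).
  apply: eq_sw => k1 k2; rewrite Ak'E !sw_op; apply: eq_sw => a b.
  rewrite Av'E sw_op; apply: eq_sw => a1 a2; rewrite QE swM; last by lin.
  by apply: eq_sw => b1 b2; apply: eq_sw => e f; rewrite actM.
transitivity (sw h (fun a b => sw b (fun b1 b2 => sw k (fun k1 k2 => sw b2 (fun c1 c2 =>
   sw k2 (fun e f => p4 (act (b1 * k1) v) (c1 * e * S a) w (c2 * f))))))); last first.
  apply: eq_sw => a b; rewrite AvE swM; last by lin.
  rewrite sw_op; apply: eq_sw => b1 b2; rewrite sw_op; apply: eq_sw => k1 k2.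
  by rewrite AkE swM //; lin.
rewrite swC.
rewrite -(swA (fun a b1 b2 => sw k (fun k1 k2 => sw b2 (fun c1 c2 =>
   sw k2 (fun e f => p4 (act (b1 * k1) v) (c1 * e * S a) w (c2 * f)))))); last by lin.
by apply: eq_sw => a b; rewrite [LHS]swC.
Qed.

Let theta z : Lh (B (U z)) = Phi (R z).
Proof. by rewrite /B theta1 theta3 -theta2. Qed.

(** The operator U of the legs above acts as the twist on the first two factors
    of V (x) H (x) H (x) H. *)
Definition twist : V ⊗ H -> V ⊗ H :=
  tlift (fun v k => sw k (fun a b => tens (act a v) b)).

Let bil_twist : bil (fun v k => sw k (fun a b => tens (act a v) b)).
Proof. by lin. Qed.

Lemma twist_lin : lin twist.
Proof. by apply: lin_tlift. Qed.

Lemma twistE v k : twist (tens v k) = sw k (fun a b => tens (act a v) b).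
Proof. by rewrite /twist tliftE. Qed.

(** An eigenvector t of the twist gives the eigenvector t (x) 1 (x) 1 of U, and
    the relations between the leg operators are those required by
    [eigenvalue_unity]. *)
Lemma twist_eigenvalue (I1 I2 : finType) (B1 : basis V I1) (B2 : basis H I2) x t :
  t != 0 -> twist t = x *: t -> exists2 k, (0 < k)%N & x ^+ k = 1.
Proof.
move=> t0 tx.
pose BZ := tensor_basis (tensor_basis (tensor_basis B1 B2) B2) B2.
pose M (F : Z -> Z) := mxrep BZ F.
have MM (F G : Z -> Z) : lin F -> M (fun z => F (G z)) = M F *m M G by exact: mxrepM.
have eqM (F G : Z -> Z) : F =1 G -> M F = M G by exact: eq_mxrep.
have comU (F : Z -> Z) : lin F -> (forall z, U (F z) = F (U z)) -> comm_mx (M U) (M F).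
  by move=> lF UF; rewrite /comm_mx -(MM _ _ lF) -MM; [exact: eqM | lin].
have lPhiw : lin Phiw by rewrite /Phiw /Phi; lin.
have lPhi : lin Phi by rewrite /Phi; lin.
have lB : lin B by rewrite /B; lin.
have rinv (F G : Z -> Z) : lin G -> (forall z, G (F z) = z) -> exists M', M F *m M' = 1%:M.
  by move=> lG FG; exists (M G); apply: mulmx1C; apply: mxrep_inv.
apply: (@eigenvalue_unity _ _ (M U) (M Phiw) (M Phi) (M Aw) (M Lw) (M Lh) (M Ll) (M J) (M B) (M R)).
- move=> Y; rewrite !inE => /or4P[|||/or4P[||| /eqP]] => [/eqP->|/eqP->|/eqP->|/eqP->|/eqP->|/eqP->|->].
  + by apply: comU.
  + by apply: comU.
  + by apply: comU; [lin | exact: UAw].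
  + by apply: comU.
  + by apply: comU; [lin | exact: ULh].
  + by apply: comU; [lin | exact: ULl].
  + by apply: comU; [lin | exact: UJ].
- move=> Y; rewrite !inE => /or4P[] /eqP->.
  + apply: (rinv _ (fun z => T (J (B (J (T z)))))) => [|z]; first by rewrite /B; lin.
    by rewrite /Phiw TT invPhi TT.
  + by apply: (rinv _ (fun z => J (Aw' (J z)))) => [|z]; [lin | exact: invAw].
  + apply: (rinv _ (fun z => T (J (R (J (T z)))))) => [|z]; first by lin.
    by rewrite /Lw TT invL TT.
  + exists (M Ll'); rewrite -MM; last by lin.
    by rewrite -(mxrep_id BZ); apply: eqM => z; rewrite invLl.
- rewrite -mulmxA -!MM; try by lin.
  by apply: eqM => z; rewrite relPhi.
- rewrite -mulmxA -!MM; try by lin.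
  by apply: eqM => z; rewrite relL.
- rewrite -MM; last by lin.
  by rewrite -(mxrep_id BZ); apply: eqM => z; rewrite JJ.
- rewrite -!mulmxA -!MM; try by lin.
  by rewrite -(mxrep_id BZ); apply: eqM => z; rewrite invPhi.
- rewrite -!mulmxA -!MM; try by lin.
  by rewrite -(mxrep_id BZ); apply: eqM => z; rewrite invL.
- rewrite -mulmxA -!MM; try by lin.
  by apply: eqM => z; rewrite theta.
rewrite -eigenvalue_tr; apply/eigenvalueP.
pose z := tens (tens t 1) 1 : Z.
have Uz : U z = x *: z.
  have lt (s : V ⊗ H) : U (tens (tens s 1) 1) = tens (tens (twist s) 1) 1.
    move: s; apply: tens_ext => [||v k]; first by lin.
      by apply: lin_tensl; apply: lin_tensl; apply: twist_lin.
    rewrite UE twistE.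
    by rewrite (sw_lin (fun s => tens (tens s 1) 1 : Z)) //; lin.
  rewrite /z lt tx; rewrite (linZ (f := fun s => tens (tens s 1) 1 : Z)) //; lin.
exists (crow BZ z); first by rewrite crow_mxrep ?Uz ?crowZ //; lin.
apply/eqP => z0; case/negP: t0; apply/eqP.
have {}z0 : z = 0 by apply: (crow_inj (B := BZ)); rewrite z0 crow0.
pose f : Z -> V ⊗ H := tlift (fun u h => (eps h : K) *: tlift (fun s w => (eps w : K) *: s) u).
have b1 : bil (fun (s : V ⊗ H) w => (eps w : K) *: s) by lin.
have b2 : bil (fun (u : (V ⊗ H) ⊗ H) h => (eps h : K) *: tlift (fun s w => (eps w : K) *: s) u).
  by split=> ?; [apply: lin_scaler; apply: lin_tlift | lin].
have : f z = t by rewrite /f /z tliftE // tliftE // counit1 !scale1r.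
by rewrite z0 lin0 //; apply: lin_tlift.
Qed.

End Legs.

(** * Traces of the twist and the Frobenius-Schur indicator *)

Section Selfdual.
Variables (K : closedFieldType) (charK : [pchar K] =i pred0).
Variables (H : algType K) (hopfH : hopf_structure H).
Variables (I : finType) (B : basis H I).
Variables (L : H) (intL : left_integral hopfH L).
Hypothesis I0 : (0 < #|I|)%N.

Local Notation S := (antipode hopfH).
Local Notation sw := (sw hopfH).
Local Notation n := #|I|.

Let SS h : S (S h) = h. Proof. exact: (antipode_involutive charK B intL I0). Qed.

(** Conjugating by the antipode brings the operator into the form of
    [trace_antipode2]. *)
Lemma trace_comult (f : H -> K^o) : lin f ->
  trace B (fun h => sw h (fun a b => f a *: b)) = n%:R * f L.
Proof.
move=> lf; rewrite -(lam_one charK B intL I0).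
transitivity (trace B (fun h => sw h (fun a b => f (S b) *: S (S a)))).
  transitivity (trace B (fun h => S (S (sw h (fun a b => f a *: b))))).
    by apply: eq_trace => h; rewrite SS.
  rewrite (@traceC _ _ _ B S (fun h => S (sw h (fun a b => f a *: b)))); try by lin.
  apply: eq_trace => h; rewrite sw_antipode; last by lin.
  rewrite (sw_lin S); last by lin.
  by apply: eq_sw => a b; rewrite linearZ.
rewrite (trace_antipode2 charK B intL I0 (f := fun x => f (S x))); last by lin.
by rewrite (integral_antipode B intL).
Qed.

Section Twist.
Variables (k : nat) (r : rep H k).

Definition ract (h : H) (v : 'rV[K]_k) := v *m r h.

Lemma bil_ract : bil ract.
Proof. by split=> ?; rewrite /ract; lin. Qed.

Local Notation TB := (tensor_basis (rV_basis K k) B).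

(** The operator acts on V by the first leg of the coproduct of h, so its trace
    over V is a linear form in this leg and [trace_comult] applies. *)
Lemma trace_twist (P : H -> 'M[K]_k) : lin P ->
  trace TB (tlift (fun v h => sw h (fun a b => tens (v *m P a) b))) = n%:R * \tr (P L).
Proof.
move=> lP; have ltr : lin (fun h => \tr (P h) : K^o) by move=> c x y; rewrite lP linearP.
rewrite -(trace_comult ltr) trace_tensor; last by lin.
have bT i j := @tcoord_bil _ _ _ _ _ (rV_basis K k) B (i, j).
rewrite exchange_big; apply: eq_bigr => j _ /=.
rewrite (sw_lin (bcoord B j)); last by lin.
transitivity (\sum_i sw (bvec B j) (fun a b => P a i i *: bcoord B j b : K^o)).
  apply: eq_bigr => i _; rewrite (sw_lin (tlift _)); last by apply: lin_tlift => //; apply: (bT i j).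
  apply: (@eq_sw _ _ _ K^o) => a b; rewrite (tliftE _ _ (bT i j)).
  by rewrite /= -rowE mxE.
transitivity (sw (bvec B j) (fun a b => \sum_i (P a i i *: bcoord B j b) : K^o)).
  exact: exchange_big.
by apply: (@eq_sw _ _ _ K^o) => a b; rewrite linearZ -scaler_suml.
Qed.

(** The square of the twist acts on V by h2 h1, so its trace is n times the
    Frobenius-Schur indicator. *)
Lemma twist_parity : \tr (r L) = 0 ->
  exists2 y, integralOver (intr : int -> K) y &
    n%:R * sw L (fun a b => \tr (r (b * a)) : K^o) + 2%:R * y = 0.
Proof.
move=> rL.
pose tw := @twist _ _ hopfH _ ract.
have ltw : lin tw by apply: twist_lin; apply: bil_ract.
have [|y iy yE] := @mxtrace_sqr_parity K _ (mxrep TB tw)^T.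
  move=> x /eigenvalueP[u ux u0].
  pose t := of_crow TB u.
  have tu : crow TB t = u by exact: of_crowK.
  apply: (twist_eigenvalue bil_ract _ _ SS (rV_basis K k) B (t := t)).
  - by move=> v; rewrite /ract rep1 mulmx1.
  - by move=> a b v; rewrite /ract repM mulmxA.
  - by apply: contra_neq u0 => t0; rewrite -tu t0 crow0.
  - by apply: (crow_inj (B := TB)); rewrite -crow_mxrep // tu ux crowZ tu.
exists y => //; rewrite -[RHS](expr0n _ 2) -[X in X ^+ 2](mulr0 (n%:R : K)) -rL.
have lr : lin r by lin.
have -> : n%:R * \tr (r L) = \tr (mxrep TB tw)^T.
  by rewrite mxtrace_tr mxtrace_mxrep -(trace_twist lr).
rewrite yE; congr (_ + _).
rewrite (expr2 (mxrep TB tw)^T) -[(mxrep TB tw)^T * _]/((mxrep TB tw)^T *m (mxrep TB tw)^T) -trmx_mul mxtrace_tr -(mxrepM TB tw ltw) mxtrace_mxrep.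
pose P h := sw h (fun a b => r (b * a)).
have lP : lin P by rewrite /P; lin.
transitivity (n%:R * \tr (P L)).
  congr (_ * _); rewrite /P (sw_lin (fun z => \tr z : K^o)) //.
  by move=> c x y'; rewrite linearP.
rewrite -(trace_twist lP); apply: eq_trace => z.
apply: (tens_ext (f := tlift (fun v h => sw h (fun a b => tens (v *m P a) b))) (g := fun z => tw (tw z))).
- by apply: lin_tlift => //; lin.
- by lin.
move=> v h; rewrite tliftE; last by lin.
rewrite [tw (tens v h)]twistE; last exact: bil_ract.
rewrite (sw_lin tw ltw).
transitivity (sw h (fun a d => sw a (fun a' c => tens (v *m r (c * a')) d))).
  apply: eq_sw => a d; rewrite /P (sw_lin (fun z => tens (v *m z) d)) //; lin.
rewrite (swA (fun a c d => tens (v *m r (c * a)) d)); last by lin.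
apply: eq_sw => a b; rewrite /tw twistE; last exact: bil_ract.
by apply: eq_sw => c d; rewrite /ract repM mulmxA.
Qed.

End Twist.

Section Orthogonality.
Variables (k : nat) (r : rep H k) (irr : irreducible r).

(** The average commutes with H, hence is a scalar, and it has the same trace
    as X. *)
Lemma rep_averaging (X : 'M[K]_k) :
  sw L (fun a b => r (S a) *m X *m r b) = (\tr X / k%:R)%:M.
Proof.
set p := sw L _.
have [c pE] : exists c, p = c%:M.
  apply: (schur irr) => h; rewrite /comm_mx /p (sw_lin (fun z => z *m r h)); last by lin.
  rewrite (sw_lin (fun z => r h *m z)); last by lin.
  transitivity (sw L (fun a b => r (S a) *m X *m r (h * b))).
    by apply: eq_sw => a b; rewrite repM !mulmxA.
  rewrite (sw_integral_mulr intL h (F := fun a b => r (S a) *m X *m r b)); last by lin.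
  by apply: eq_sw => a b; rewrite antipodeM SS repM !mulmxA.
have k0 : k%:R != 0 :> K by rewrite ((pcharf0P K).1 charK) -lt0n; case: irr.
have : \tr p = \tr X.
  rewrite /p (sw_lin (fun z => \tr z : K^o)); last by move=> a x y; rewrite linearP.
  transitivity (sw L (fun a b => \tr (X *m r (S a * b)) : K^o)).
    by apply: (@eq_sw _ _ _ K^o) => a b; rewrite repM -mulmxA mxtrace_mulC mulmxA.
  rewrite (sw_Sl (fun z => \tr (X *m r z) : K^o)); last by move=> a x y; rewrite !linearP.
  by case: intL => -> _; rewrite scale1r rep1 mulmx1.
rewrite pE mxtrace_scalar -(mulr_natr c k) => <-.
by rewrite mulfK.
Qed.

(** The entries of [rep_averaging] are the orthogonality relations eE.  With
    r(L1) written as J r(S(L1))^T J^-1 they express the indicator as tr(J J^-T)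
    / k. *)
Lemma frobenius_schur (J : 'M[K]_k) : J^T = J -> J \in unitmx ->
  (forall h, r h *m J = J *m (r (S h))^T) ->
  sw L (fun a b => \tr (r (b * a)) : K^o) = 1.
Proof.
move=> Js Ju Jr.
have k0 : k%:R != 0 :> K by rewrite ((pcharf0P K).1 charK) -lt0n; case: irr.
pose J' := invmx J.
have rE h : r h = J *m (r (S h))^T *m J' by rewrite -Jr mulmxK.
pose e i j l m := sw L (fun a b => r (S a) l j * r b m i : K^o).
have eE i j l m : e i j l m = (l == i)%:R * (j == m)%:R / k%:R.
  have /matrixP/(_ l i) := rep_averaging (delta_mx j m).
  rewrite (sw_lin (fun z : 'M[K]_k => z l i : K^o)); last by move=> c x y; rewrite !mxE.
  have -> : \tr (delta_mx j m : 'M[K]_k) = (j == m)%:R.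
    rewrite /mxtrace (bigD1 j) //= mxE eqxx /= big1 ?addr0 // => s /negPf sj.
    by rewrite mxE sj.
  rewrite mxE => E; rewrite -mulrA [_ * (_ / _)]mulrC mulr_natr -E.
  apply: (@eq_sw _ _ _ K^o) => a b; rewrite !mxE (bigD1 m) //= mxE (bigD1 j) //= mxE !eqxx mulr1.
  rewrite big1 ?addr0 => [|s /negPf sj]; last by rewrite mxE sj mulr0.
  rewrite big1 ?addr0 // => s /negPf sm; rewrite mxE big1 ?mul0r // => t _.
  by rewrite mxE sm andbF mulr0.
transitivity (\sum_i \sum_m \sum_l \sum_j J i j * J' l m * e i j l m).
  transitivity (sw L (fun a b => \sum_i \sum_m \sum_l \sum_j J i j * J' l m * (r (S a) l j * r b m i) : K^o)).
    apply: (@eq_sw _ _ _ K^o) => a b; rewrite repM {1}[r a]rE; apply: eq_bigr => i _.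
    rewrite mxE; apply: eq_bigr => m _; rewrite mxE mulr_suml; apply: eq_bigr => l _.
    rewrite mxE !mulr_suml; apply: eq_bigr => j _; rewrite mxE; ring.
  have push (T : finType) (G : T -> H -> H -> K^o) :
      sw L (fun a b => \sum_t G t a b) = \sum_t sw L (G t) by exact: exchange_big.
  rewrite push; apply: eq_bigr => i _; rewrite push; apply: eq_bigr => m _.
  rewrite push; apply: eq_bigr => l _; rewrite push; apply: eq_bigr => j _.
  by symmetry; apply: (sw_lin (fun z : K^o => (J i j * J' l m) *: z : K^o)); lin.
transitivity (\tr (J *m J'^T) / k%:R).
  rewrite /mxtrace mulr_suml; apply: eq_bigr => i _; rewrite mxE mulr_suml exchange_big /=.
  rewrite (bigD1 i) //= [X in _ + X]big1 ?addr0 => [|l /negPf li]; last first.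
    by apply: big1 => m _; apply: big1 => j _; rewrite eE li !mul0r mulr0.
  apply: eq_bigr => m _; rewrite (bigD1 m) //= [X in _ + X]big1 ?addr0 => [|j /negPf jm].
    by rewrite eE !eqxx mxE !mul1r.
  by rewrite eE jm mulr0 mul0r mulr0.
by rewrite /J' trmx_inv Js mulmxV // mxtrace1 divff.
Qed.

Lemma no_selfdual (J : 'M[K]_k) : odd n -> J^T = J -> J \in unitmx ->
  (forall h, r h *m J = J *m (r (S h))^T) -> r L = 0 -> False.
Proof.
move=> oddn Js Ju Jr rL; have [|y iy] := twist_parity (r := r); first by rewrite rL mxtrace0.
rewrite (frobenius_schur Js Ju Jr) mulr1 => /eqP; rewrite addr_eq0 => /eqP yE.
have := @odd_half_not_integral K charK n (- y); rewrite oddn /= => nope.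
by have := nope (integral_opp iy); rewrite mulrN -yE => /(_ (erefl _)).
Qed.

End Orthogonality.

End Selfdual.

(** * Modules with a symmetric invariant form *)

Lemma gram_unit (K : fieldType) (k m : nat) (J : 'M[K]_k) (Y : 'M[K]_(m, k)) :
  (forall w : 'rV_k, (w <= Y)%MS -> w *m J *m Y^T = 0 -> w = 0) ->
  row_base Y *m J *m (row_base Y)^T \in unitmx.
Proof.
move=> nd; rewrite -row_free_unit; apply: inj_row_free => v.
rewrite (mulmxA v) (mulmxA v) => vJ.
have /eqP : v *m row_base Y = 0.
  apply: nd; first by rewrite (submx_trans (submxMl _ _)) // eq_row_base.
  have /submxP[D YD] : (Y <= row_base Y)%MS by rewrite eq_row_base.
  by rewrite (congr1 trmx YD) trmx_mul mulmxA vJ mul0mx.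
by rewrite mulmx_free_eq0 ?row_base_free // => /eqP.
Qed.

Section Forms.
Variables (K : closedFieldType) (charK : [pchar K] =i pred0).
Variables (H : algType K) (hopfH : hopf_structure H).
Variables (I : finType) (B : basis H I).
Variables (L : H) (intL : left_integral hopfH L).
Hypothesis I0 : (0 < #|I|)%N.
Hypothesis oddI : odd #|I|.

Local Notation S := (antipode hopfH).
Local Notation sw := (sw hopfH).

Let SS h : S (S h) = h. Proof. exact: (antipode_involutive charK B intL I0). Qed.

(** Invariance of the bilinear form with Gram matrix J. *)
Definition adjoint k (r : rep H k) (J : 'M[K]_k) :=
  forall h, r h *m J = J *m (r (S h))^T.

Lemma adjoint_sub k m (r : rep H k) (q : rep H m) (X : 'M[K]_(m, k)) J :
  (forall h, X *m r h = q h *m X) -> adjoint r J -> adjoint q (X *m J *m X^T).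
Proof.
move=> Xr rJ h; rewrite -!mulmxA -trmx_mul -Xr trmx_mul !mulmxA -Xr.
by rewrite -[in LHS](mulmxA X) rJ !mulmxA.
Qed.

Lemma stable_orthogonal k m (r : rep H k) (q : rep H m) (X : 'M[K]_(m, k)) J :
  (forall h, X *m r h = q h *m X) -> adjoint r J -> stable r (kermx (J *m X^T)).
Proof.
move=> Xr rJ; apply: stable_comm_ker => h; exists (q (S h))^T.
by rewrite mulmxA rJ -!mulmxA -!trmx_mul Xr.
Qed.

Lemma sub_kill k m (r : rep H k) (q : rep H m) (X : 'M[K]_(m, k)) h :
  row_free X -> (forall h, X *m r h = q h *m X) -> X *m r h = 0 -> q h = 0.
Proof. by move=> fX Xr; rewrite Xr => /eqP; rewrite mulmx_free_eq0 // => /eqP. Qed.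

(** Let q be a simple submodule with basis X.  Its Gram matrix G is invertible
    or zero.  The first case is [no_selfdual].  In the second case let Xp be
    the orthogonal space of X, which contains X, and let Y be the intersection
    of Xp with an invariant complement of X.  Then Xp is the direct sum of X
    and Y, the form is nondegenerate on Y, and the dimension of Y is odd, since
    it is that of the whole space minus twice that of X. *)
Lemma no_odd_form k (r : rep H k) (J : 'M[K]_k) : odd k ->
  J^T = J -> J \in unitmx -> adjoint r J -> r L = 0 -> False.
Proof.
have [b] := ubnP k; elim: b k r J => // b IHb k r J kb oddk Js Ju rJ rL.
have k0 : (0 < k)%N by case: (k) oddk.
have [m [q [iq [X fX Xr]]]] := irreducible_subrep r k0.
have m0 : (0 < m)%N by case: iq.
pose G := X *m J *m X^T.
have Gs : G^T = G by rewrite /G !trmx_mul trmxK Js mulmxA.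
have Gq : adjoint q G by apply: adjoint_sub.
have qL : q L = 0 by apply: (sub_kill fX Xr); rewrite rL mulmx0.
have [K0|K0] := eqVneq (kermx G) 0.
  by apply: (no_selfdual charK B intL I0 iq oddI Gs _ Gq qL); rewrite -row_free_unit -kermx_eq0 K0.
have G0 : G = 0.
  have sK : stable q (kermx G) by apply: stable_comm_ker => h; exists (q (S h))^T; apply: Gq.
  have /row_fullP[D DK] := iq.2 _ _ sK K0.
  by rewrite -[G]mul1mx -DK -mulmxA mulmx_ker mulmx0.
pose Xp := kermx (J *m X^T).
have sXp : stable r Xp by apply: stable_orthogonal Xr rJ.
have XXp : (X <= Xp)%MS by apply/sub_kermxP; rewrite mulmxA.
have rX : \rank X = m by apply/eqP.
have rXp : \rank Xp = (k - m)%N.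
  rewrite mxrank_ker eqmxMfull ?row_full_unit // mxrank_tr rX //.
(* The orthogonal space of Xp is X again, by comparison of dimensions. *)
have XpXp : (kermx (J *m Xp^T) <= X)%MS.
  have sub : (X <= kermx (J *m Xp^T))%MS.
    apply/sub_kermxP; apply: trmx_inj; rewrite (trmx_mul X) (trmx_mul J) trmxK Js -mulmxA.
    by rewrite /Xp mulmx_ker trmx0.
  rewrite -(geq_leqif (mxrank_leqif_sup sub)).
  rewrite mxrank_ker eqmxMfull ?row_full_unit // mxrank_tr rX rXp.
  by have := rank_leq_col X; rewrite rX; lia.
have sX : stable r X by move=> h; rewrite Xr submxMl.
have [Y0 [sY0 XY0 fXY0]] := maschke B intL sX.
pose Y := (Y0 :&: Xp)%MS.
have sY : stable r Y by move=> h; apply: submx_trans (capmxMr _ _ _) (capmxS (sY0 h) (sXp h)).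
have XY : (X + Y :=: Xp)%MS.
  apply: eqmx_trans (matrix_modl Y0 XXp) _; apply/eqmxP.
  by rewrite capmxSr sub_capmx submx_refl andbT submx_full.
have rY : \rank Y = (k - m - m)%N.
  have := mxrank_sum_cap X Y; rewrite XY rXp rX.
  suff -> : \rank (X :&: Y)%MS = 0%N by rewrite addn0 => ->; rewrite addKn.
  by apply/eqP; rewrite mxrank_eq0 -submx0 -XY0 capmxS // capmxSl.
have fY := row_base_free Y.
have sYb := stable_row_base sY.
have Yr h := restrE fY sYb h.
have le2m : (m <= k - m)%N by rewrite -rXp -rX mxrankS.
apply: (IHb _ (restr fY sYb) (row_base Y *m J *m (row_base Y)^T)).
- by rewrite rY; lia.
- by rewrite rY; lia.
- by rewrite (trmx_mul _ (row_base Y)^T) (trmx_mul (row_base Y)) trmxK Js mulmxA.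
- apply: gram_unit => w wY wJY.
  apply/eqP; rewrite -submx0 -XY0 sub_capmx (submx_trans wY (capmxSl _ _)) andbT.
  apply: submx_trans XpXp; apply/sub_kermxP.
  have /submxP[D ->] : (Xp <= col_mx X Y)%MS by rewrite -addsmxE XY.
  rewrite trmx_mul tr_col_mx !mulmxA mul_mx_row wJY.
  have -> : w *m J *m X^T = 0.
    by rewrite -mulmxA; apply/sub_kermxP; apply: submx_trans wY (capmxSr _ _).
  by rewrite row_mx0 mul0mx.
- exact: adjoint_sub Yr rJ.
- by apply: (sub_kill fY Yr); rewrite rL mulmx0.
Qed.


End Forms.

(** * The trace form on the endomorphisms of a module *)

Section MatrixSpace.
Variables (K : closedFieldType) (d : nat).

Lemma mxvec_ext m (P Q : 'M[K]_(d * d, m)) :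
  (forall X : 'M_d, mxvec X *m P = mxvec X *m Q) -> P = Q.
Proof. by move=> PQ; apply/row_matrixP => i; rewrite !rowE -[delta_mx 0 i]vec_mxK. Qed.

Lemma mxvec_dot (X Y : 'M[K]_d) : mxvec X *m (mxvec Y)^T = (\tr (X *m Y^T))%:M.
Proof.
apply/matrixP => i j; rewrite !ord1 !mxE eqxx mulr1n.
rewrite (reindex _ (curry_mxvec_bij d d)) /= /mxtrace.
transitivity (\sum_(p : 'I_d * 'I_d) X p.1 p.2 * Y p.1 p.2).
  by apply: eq_bigr => -[k l] _; rewrite /= mxE !mxvecE.
rewrite -(pair_bigA _ (fun k l => X k l * Y k l)); apply: eq_bigr => k _.
by rewrite mxE; apply: eq_bigr => l _; rewrite mxE.
Qed.

(** The Gram matrix of the bilinear form tr(XY) on matrices. *)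
Definition trace_form : 'M[K]_(d * d) := lin_mx trmx.

Lemma trace_formE X Y : mxvec X *m trace_form *m (mxvec Y)^T = (\tr (X *m Y))%:M.
Proof. by rewrite mul_vec_lin mxvec_dot -trmx_mul mxtrace_tr mxtrace_mulC. Qed.

Lemma form_ext (P Q : 'M[K]_(d * d)) :
  (forall X Y : 'M_d, mxvec X *m P *m (mxvec Y)^T = mxvec X *m Q *m (mxvec Y)^T) -> P = Q.
Proof.
move=> PQ; apply: mxvec_ext => X; apply: trmx_inj; apply: mxvec_ext => Y.
by apply: trmx_inj; rewrite !trmx_mul !trmxK.
Qed.

Lemma trace_form_sym : trace_form^T = trace_form.
Proof.
apply: form_ext => X Y; apply: trmx_inj.
by rewrite -mulmxA (trmx_mul (mxvec X)) (trmx_mul _ (mxvec Y)^T) !trmxK !trace_formE tr_scalar_mx mxtrace_mulC.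
Qed.

Lemma trace_form_unit : trace_form \in unitmx.
Proof.
have /mulmx1_unit[] // : trace_form *m trace_form = 1%:M.
by apply: mxvec_ext => X; rewrite mulmxA !mul_vec_lin /= trmxK mulmx1.
Qed.

End MatrixSpace.

Section Endomorphisms.
Variables (K : closedFieldType) (charK : [pchar K] =i pred0).
Variables (H : algType K) (hopfH : hopf_structure H).
Variables (I : finType) (B : basis H I).
Variables (L : H) (intL : left_integral hopfH L).
Hypothesis I0 : (0 < #|I|)%N.
Hypothesis oddI : odd #|I|.

Local Notation S := (antipode hopfH).
Local Notation eps := (counit hopfH).
Local Notation sw := (sw hopfH).

Let SS h : S (S h) = h. Proof. exact: (antipode_involutive charK B intL I0). Qed.

Variables (d : nat) (r : rep H d).

Definition conj_act (h : H) (X : 'M[K]_d) := sw h (fun a b => r (S a) *m X *m r b).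

Lemma conj_act_bil : bil conj_act.
Proof. by split=> ?; rewrite /conj_act; lin. Qed.

Definition end_mx (h : H) : 'M[K]_(d * d) := lin_mx (mklin (conj_act_bil.2 h)).

Lemma end_mxE h X : mxvec X *m end_mx h = mxvec (conj_act h X).
Proof. exact: mul_vec_lin. Qed.

Lemma end_lin : lin end_mx.
Proof.
move=> c x y; apply: mxvec_ext => X.
rewrite mulmxDr -scalemxAr !end_mxE (conj_act_bil.1 X) linearP //.
Qed.

Lemma end1 : mklin end_lin 1 = 1%:M.
Proof.
apply: mxvec_ext => X; rewrite mklinE end_mxE mulmx1 /conj_act sw1; last by lin.
by rewrite antipode1 rep1 mul1mx mulmx1.
Qed.

Lemma endM x y : mklin end_lin (x * y) = mklin end_lin y *m mklin end_lin x.
Proof.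
apply: mxvec_ext => X; rewrite !mklinE mulmxA !end_mxE; congr mxvec.
rewrite /conj_act swM; last by lin.
apply: eq_sw => a b; rewrite (sw_lin (fun Z => r (S a) *m Z *m r b)); last by lin.
by apply: eq_sw => c e; rewrite antipodeM !repM !mulmxA.
Qed.

Definition end_rep : rep H (d * d) := Rep end1 endM.

Lemma end_repE h X : mxvec X *m end_rep h = mxvec (conj_act h X).
Proof. exact: end_mxE. Qed.

Let lin_tr (V : lmodType K) (f : V -> 'M[K]_d) : lin f -> lin (fun v => \tr (f v) : K^o).
Proof. by move=> lf c x y; rewrite lf linearP. Qed.

(** The trace is cyclic and the antipode is an involution. *)
Lemma end_adjoint : adjoint hopfH end_rep (trace_form K d).
Proof.
move=> h; apply: form_ext => X Y.
rewrite (mulmxA (mxvec X) (end_rep h)) end_repE trace_formE.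
rewrite (mulmxA (mxvec X) (trace_form K d)) -(mulmxA (mxvec X *m _)) -trmx_mul end_repE trace_formE; congr (_%:M).
have lM (Z : 'M[K]_d) : lin (fun W : 'M[K]_d => \tr (W *m Z) : K^o) by apply: lin_tr; lin.
have lM' (Z : 'M[K]_d) : lin (fun W : 'M[K]_d => \tr (Z *m W) : K^o) by apply: lin_tr; lin.
rewrite [LHS](sw_lin _ (lM Y)) /conj_act sw_antipode; last by lin.
rewrite [RHS](sw_lin _ (lM' X)); apply: (@eq_sw _ _ _ K^o) => a b.
by rewrite SS -!mulmxA mxtrace_mulC -!mulmxA.
Qed.

Lemma trace_conj_act h X : \tr (conj_act h X) = eps h * \tr X.
Proof.
rewrite [LHS](sw_lin (fun Z => \tr Z : K^o)); last by apply: lin_tr; lin.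
transitivity (sw h (fun a b => \tr (X *m r (S a * b)) : K^o)).
  by apply: (@eq_sw _ _ _ K^o) => a b; rewrite repM -mulmxA mxtrace_mulC mulmxA.
rewrite (sw_Sl (fun z => \tr (X *m r z) : K^o)); last by apply: lin_tr; lin.
by rewrite rep1 mulmx1.
Qed.

(** The matrices of trace zero contradict [no_odd_form] when d is even. *)
Lemma irreducible_odd : irreducible r -> odd d.
Proof.
move=> irr; have d0 : (0 < d)%N by case: irr.
have dK : d%:R != 0 :> K by rewrite ((pcharf0P K).1 charK) -lt0n.
apply/negPn/negP => evend.
pose J := trace_form K d; pose u : 'rV[K]_(d * d) := mxvec 1%:M.
pose Y := kermx (J *m u^T).
have trE (X : 'M_d) : mxvec X *m (J *m u^T) = (\tr X)%:M.
  by rewrite mulmxA trace_formE mulmx1.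
have memY (X : 'M_d) : (mxvec X <= Y)%MS = (\tr X == 0).
  apply/sub_kermxP/eqP; rewrite trE; last by move->; rewrite raddf0.
  by move/matrixP/(_ 0 0); rewrite !mxE.
have sY : stable end_rep Y.
  apply: stable_comm_ker => h; exists (eps h)%:M.
  apply: mxvec_ext => X; rewrite mulmxA end_repE trE mulmxA trE.
  by rewrite -scalar_mxM mulrC trace_conj_act.
have rY : \rank Y = (d * d).-1.
  rewrite mxrank_ker eqmxMfull ?row_full_unit ?trace_form_unit // mxrank_tr rank_rV.
  suff -> : u != 0 by rewrite subn1.
  apply: contra_neq dK => /(congr1 (mulmx^~ (J *m u^T))); rewrite trE mul0mx mxtrace1.
  by move/matrixP/(_ 0 0); rewrite !mxE.
have fY := row_base_free Y.
have sYb := stable_row_base sY.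
have Yr h := restrE fY sYb h.
apply: (@no_odd_form _ charK _ hopfH _ B _ intL I0 oddI _ (restr fY sYb)
  (row_base Y *m J *m (row_base Y)^T)).
- have : ~~ odd (d * d) by rewrite oddM negb_and evend.
  by have : (0 < d * d)%N by [rewrite muln_gt0 d0]; rewrite rY; case: (d * d)%N => // e _ /=; rewrite negbK.
- by rewrite (trmx_mul _ (row_base Y)^T) (trmx_mul (row_base Y)) trmxK trace_form_sym mulmxA.
- apply: gram_unit => w wY wJY.
  suff : w *m J = 0 by move/(congr1 (mulmx^~ (invmx J))); rewrite mulmxK ?trace_form_unit // mul0mx.
  apply: trmx_inj; apply: mxvec_ext => Z; rewrite trmx0 mulmx0.
  apply: trmx_inj; rewrite trmx0 trmx_mul trmxK.
  (* Z is the sum of a matrix of trace zero and a scalar matrix; w is orthogonal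
     to both. *)
  pose Z1 := Z - (\tr Z / d%:R)%:M.
  have -> : mxvec Z = mxvec Z1 + (\tr Z / d%:R) *: u.
    by rewrite -linearZ -linearD scalemx1 subrK.
  rewrite linearD [X in _ + X]linearZ mulmxDr -scalemxAr.
  have -> : w *m J *m u^T = 0 by rewrite -mulmxA; apply/sub_kermxP.
  rewrite scaler0 addr0.
  have /submxP[D ->] : (mxvec Z1 <= Y)%MS.
    by rewrite memY linearB /= mxtrace_scalar -(mulr_natr (\tr Z / d%:R)) divfK // subrr.
  by rewrite /= trmx_mul mulmxA wJY mul0mx.
- exact: (adjoint_sub Yr end_adjoint).
- apply: (sub_kill fY Yr); apply/row_matrixP => i; rewrite row0 row_mul.
  have : (row i (row_base Y) <= Y)%MS by rewrite (submx_trans (row_sub _ _)) // eq_row_base.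
  rewrite -[row i _]vec_mxK memY => /eqP tr0; rewrite end_repE.
  rewrite /conj_act (rep_averaging charK B intL I0 irr) tr0 mul0r raddf0 linear0 //.
Qed.

End Endomorphisms.

(** * Simple modules and the theorem *)

Section SimpleModule.
Variables (K : fieldType) (H : algType K) (M : lmodType H).

(** Coordinates on M turn it into a representation on row vectors; a stable row
    space X is the image of the submodule N. *)
Lemma simple_module_rep d : simple_module M -> has_dim (restrict_scalars M) d ->
  exists r : rep H d, irreducible r.
Proof.
move=> [[x0 x0N] simpleM] [[v2r v2r_lin [r2v v2rK r2vK]]].
have r2v_lin (c : K) u v : r2v (c *: u + v) = c%:A *: (r2v u : M) + r2v v.
  by apply: (can_inj v2rK); rewrite [RHS]v2r_lin !r2vK.
have v2r_linM (c : K) (x y : M) : v2r (c%:A *: x + y) = c *: v2r x + v2r y.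
  exact: v2r_lin.
pose f h (v : 'rV[K]_d) := v2r (h *: (r2v v : M)).
have f_lin h : lin (f h).
  move=> c u v; rewrite /f r2v_lin scalerDr scalerA -scalerAr mulr1.
  by rewrite -{1}[h]mul1r scalerAl -scalerA v2r_linM.
have fE h v : v *m lin1_mx (mklin (f_lin h)) = f h v by rewrite mul_rV_lin1.
pose g h : 'M[K]_d := lin1_mx (mklin (f_lin h)).
have mx_ext (P Q : 'M[K]_d) : (forall v : 'rV_d, v *m P = v *m Q) -> P = Q.
  by move=> PQ; apply/row_matrixP => i; rewrite !rowE.
have g_lin : lin g.
  move=> c h h'; apply: mx_ext => v; rewrite mulmxDr -scalemxAr !fE /f.
  by rewrite -v2r_linM scalerA -scalerAl mul1r -scalerDl.
have g1 : mklin g_lin 1 = 1%:M.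
  by apply: mx_ext => v; rewrite mklinE fE /f scale1r r2vK mulmx1.
have gM x y : mklin g_lin (x * y) = mklin g_lin y *m mklin g_lin x.
  by apply: mx_ext => v; rewrite !mklinE mulmxA !fE /f v2rK scalerA.
have v2r0 : v2r 0 = 0 by have := v2r_lin (-1) 0 0; rewrite !scaleN1r !addNr.
exists (Rep g1 gM); split.
  rewrite lt0n; apply: contra_neq x0N => d0; apply: (can_inj v2rK).
  by rewrite v2r0; apply/rowP => i; by have := ltn_ord i; rewrite {2}d0.
move=> m X sX X0.
pose N : {pred M} := [pred x : M | (v2r x <= X)%MS].
have [|N0|NM] := simpleM N.
- split=> [|a x y]; rewrite !inE; first by rewrite v2r0 sub0mx.
  move=> xX yX; rewrite -[a *: x]scale1r -[1]scale1r v2r_linM scale1r addmx_sub //.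
  rewrite -[x]v2rK -[v2r _]/(f a (v2r x)) -fE.
  exact: submx_trans (submxMr _ xX) (sX a).
- case/negP: X0; rewrite -submx0; apply/rV_subP => v vX.
  by rewrite -[v]r2vK (N0 (r2v v)) ?v2r0 ?sub0mx // inE r2vK.
- by rewrite -sub1mx; apply/row_subP => i; have := NM (r2v (row i 1%:M)); rewrite inE r2vK.
Qed.

End SimpleModule.

Theorem mainTheorem2 (K : closedFieldType) (charK : [pchar K] =i pred0)
    (H : algType K) (hopfH : hopf_structure H) (ssH : semisimple_algebra H)
    (M : lmodType H) (simpleM : simple_module M)
    (d : nat) (dimM : has_dim (restrict_scalars M) d) (evend : ~~ odd d) :
  exists2 n : nat, has_dim H n & ~~ odd n.
Proof.
have [L intL] := semisimple_integral hopfH ssH.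
have [n dimH] := integral_has_dim intL.
have [B _] := has_dim_basis dimH.
have [r irr] := simple_module_rep simpleM dimM.
exists n => //; apply: contra evend => oddn.
have I0 : (0 < #|'I_n|)%N by rewrite card_ord odd_gt0.
by apply: (irreducible_odd charK B intL I0 _ irr); rewrite card_ord.
Qed.
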